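(* Let $\Gamma$ be a strongly projectively convex cocompact subgroup of $\mathrm{SL}(n,\mathbb{R})$, and let $\xi^{sym}=(\xi,\xi^* ):\partial_\infty\Gamma\to \mathbf{P}(\mathbb{R}^n)\times\mathbf{P}({\mathbb{R}^n}^* )$ be its symmetric boundary map. Then \[2\,\delta_{1,n}(\Gamma)\;\leq\;\dim_H\big(\xi^{sym}(\partial_\infty\Gamma)\big)\;\leq\;\delta_{1,2}(\Gamma).\]
   Context: For $g\in\mathrm{SL}(n,\mathbb{R})$, $\mu_i(g)$ denotes the logarithm of the $i$-th eigenvalue (in decreasing order) of $\sqrt{gg^T}$. For a discrete subgroup $\Gamma$, $\delta_{1,2}(\Gamma)=\limsup_{R\to\infty}\frac1R\log\#\{\gamma\in\Gamma:\mu_1(\gamma)-\mu_2(\gamma)\le R\}$ and $\delta_{1,n}(\Gamma)=\limsup_{R\to\infty}\frac1R\log\#\{\gamma\in\Gamma:\mu_1(\gamma)-\mu_n(\gamma)\le R\}$. A properly convex open domain $\Omega\subset\mathbf{P}(\mathbb{R}^n)$ is a convex open set bounded in some affine chart; it carries the Hilbert distance $d_H(x,y)=\frac12\log\frac{xb\cdot ay}{ax\cdot yb}$, where $a,b$ are the points where the line through $x,y$ meets $\partial\Omega$ (with $a$ on the side of $x$). A discrete subgroup $\Gamma\subset\mathrm{SL}(n,\mathbb{R})$ is strongly projectively convex cocompact if it preserves a properly convex open domain $\Omega$ such that $(\Omega,d_H)$ is Gromov hyperbolic, and acts properly discontinuously and cocompactly on some non-empty $\Gamma$-invariant convex subset $C\subset\Omega$.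 Such a $\Gamma$ is Gromov hyperbolic and projective Anosov; its boundary maps $\xi:\partial_\infty\Gamma\to\mathbf{P}(\mathbb{R}^n)$ and $\xi^*:\partial_\infty\Gamma\to\mathbf{P}({\mathbb{R}^n}^* )$ are the continuous $\Gamma$-equivariant maps such that $\xi$ is a homeomorphism onto $\overline{C}\cap\partial\Omega$ and $\xi^*(x)$ is the hyperplane tangent to $\partial\Omega$ at $\xi(x)$. The Hausdorff dimension $\dim_H$ of a compact subset of a smooth manifold is computed with respect to (the distance induced by) any Riemannian metric; it does not depend on this choice. *)

(* Defs.v *)
From HB Require Import structures.
From mathcomp Require Import all_boot all_order all_algebra.
From mathcomp Require Import all_classical all_reals all_analysis.
Set Implicit Arguments. Unset Strict Implicit. Unset Printing Implicit Defensive.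
Import Order.TTheory GRing.Theory Num.Theory numFieldNormedType.Exports.
Local Open Scope classical_set_scope.
Local Open Scope ring_scope.

Section Defs.
Variable R : realType.

Section Hausdorff.
Variables (T : Type) (d : T -> T -> R).

Definition hdiam (U : set T) : \bar R :=
  ereal_sup [set (d p.1 p.2)%:E | p in U `*` U].

(* contribution diam(U)^s of a covering set (empty sets contribute 0, s > 0) *)
Definition hcontrib (s : R) (U : set T) : \bar R := (powR (fine (hdiam U)) s)%:E.

Definition hausdorff_pre (s delta : R) (A : set T) : \bar R :=
  ereal_inf [set (\sum_(i <oo) hcontrib s (U i))%E
            | U in [set U : nat -> set T |
                    A `<=` \bigcup_i U i /\ forall i, (hdiam (U i) <= delta%:E)%E]].

Definition hausdorff_measure (s : R) (A : set T) : \bar R :=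
  ereal_sup [set hausdorff_pre s delta A | delta in [set delta : R | 0 < delta]].

Definition hausdorff_dim (A : set T) : \bar R :=
  ereal_inf [set s%:E | s in [set s : R | 0 < s /\ hausdorff_measure s A = 0%E]].
End Hausdorff.

Variable n : nat.

Definition pairing (phi : 'rV[R]_n) (v : 'cV[R]_n) : R := (phi *m v) 0 0.
Definition dotc (v w : 'cV[R]_n) : R := (v^T *m w) 0 0.
Definition normc (v : 'cV[R]_n) : R := Num.sqrt (dotc v v).
Definition dotr (p q : 'rV[R]_n) : R := (p *m q^T) 0 0.
Definition normrow (p : 'rV[R]_n) : R := Num.sqrt (dotr p p).

(* Riemannian (Fubini-Study / round) distance on P(R^n) and P(dual of R^n),
   computed on nonzero representatives *)
Definition angle_c (v w : 'cV[R]_n) : R := acos (`|dotc v w| / (normc v * normc w)).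
Definition angle_r (p q : 'rV[R]_n) : R := acos (`|dotr p q| / (normrow p * normrow q)).
Definition dsym (a b : 'cV[R]_n * 'rV[R]_n) : R :=
  Num.sqrt (angle_c a.1 b.1 ^+ 2 + angle_r a.2 b.2 ^+ 2).

(* ---------- subsets of P(R^n), encoded by their cones of representatives --- *)
Definition proj_set (X : set 'cV[R]_n) : Prop :=
  ~ X 0 /\ forall v (t : R), X v -> t != 0 -> X (t *: v).

Definition proj_compact (K : set 'cV[R]_n) : Prop :=
  compact [set v | K v /\ normc v = 1].

Definition chart_slice (phi : 'rV[R]_n) (X : set 'cV[R]_n) : set 'cV[R]_n :=
  [set v | X v /\ pairing phi v = 1].

Definition good_chart (phi : 'rV[R]_n) (Om : set 'cV[R]_n) : Prop :=
  (forall v, Om v -> pairing phi v != 0) /\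
  (forall v w (t : R), chart_slice phi Om v -> chart_slice phi Om w ->
      0 <= t <= 1 -> Om ((1 - t) *: v + t *: w)) /\
  (exists M : R, forall v, chart_slice phi Om v -> normc v <= M).

Definition properly_convex_open (Om : set 'cV[R]_n) : Prop :=
  proj_set Om /\ open Om /\ (exists v, Om v) /\ exists phi, good_chart phi Om.

(* a chosen affine chart of Om (the Hilbert distance does not depend on it) *)
Definition chart (Om : set 'cV[R]_n) : 'rV[R]_n := xget 0 [set phi | good_chart phi Om].

Definition normalize (phi : 'rV[R]_n) (v : 'cV[R]_n) : 'cV[R]_n :=
  (pairing phi v)^-1 *: v.

(* Hilbert distance d_H(x,y) = 1/2 log (|xb| |ay| / (|ax| |yb|)),
   computed in the affine chart; a, b are the endpoints of the chord through x, y,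
   a on the side of x *)
Definition hilbert_dist (Om : set 'cV[R]_n) (x y : 'cV[R]_n) : R :=
  let phi := chart Om in
  let x' := normalize phi x in
  let y' := normalize phi y in
  if x' == y' then 0 else
  let I := [set t : R | Om (x' + t *: (y' - x'))] in
  let a := x' + inf I *: (y' - x') in
  let b := x' + sup I *: (y' - x') in
  ln ((normc (b - x') * normc (y' - a)) / (normc (a - x') * normc (b - y'))) / 2.

Definition gromov_product (T : Type) (d : T -> T -> R) (w x y : T) : R :=
  (d w x + d w y - d x y) / 2.

Definition gromov_hyperbolic (T : Type) (X : set T) (d : T -> T -> R) : Prop :=
  exists delta : R, 0 <= delta /\
    forall x y z w, X x -> X y -> X z -> X w ->
      Num.min (gromov_product d w x y) (gromov_product d w y z) - delta
        <= gromov_product d w x z.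

Definition SL_subgroup (G : set 'M[R]_n) : Prop :=
  G 1%:M /\ (forall g h, G g -> G h -> G (g *m h)) /\
  (forall g, G g -> G (invmx g)) /\ (forall g, G g -> \det g = 1).

Definition discrete_subgroup (G : set 'M[R]_n) : Prop :=
  SL_subgroup G /\
  exists eps : R, 0 < eps /\
    forall g, G g -> (forall i j, `|g i j - (1%:M : 'M[R]_n) i j| < eps) -> g = 1%:M.

Definition convex_in (Om C : set 'cV[R]_n) : Prop :=
  forall v w (t : R), chart_slice (chart Om) C v -> chart_slice (chart Om) C w ->
    0 <= t <= 1 -> C ((1 - t) *: v + t *: w).

Definition acts_properly_discontinuously (G : set 'M[R]_n) (C : set 'cV[R]_n) : Prop :=
  forall K, proj_set K -> K `<=` C -> proj_compact K ->
    finite_set [set g | G g /\ exists v, K v /\ K (g *m v)].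

Definition acts_cocompactly (G : set 'M[R]_n) (C : set 'cV[R]_n) : Prop :=
  exists K, proj_set K /\ K `<=` C /\ proj_compact K /\
    forall v, C v -> exists g k, G g /\ K k /\ v = g *m k.

Definition strongly_proj_convex_cocompact
    (G : set 'M[R]_n) (Om C : set 'cV[R]_n) : Prop :=
  discrete_subgroup G /\
  properly_convex_open Om /\
  (forall g v, G g -> Om v -> Om (g *m v)) /\
  gromov_hyperbolic Om (hilbert_dist Om) /\
  proj_set C /\ (exists v, C v) /\ C `<=` Om /\ convex_in Om C /\
  (forall g v, G g -> C v -> C (g *m v)) /\
  acts_properly_discontinuously G C /\ acts_cocompactly G C.

(* xi(boundary Gamma) = closure(C) cap boundary(Om); xi^*(x) = the tangent
   (= unique supporting) hyperplane of Om at xi(x) *)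
Definition limit_set (Om C : set 'cV[R]_n) : set 'cV[R]_n :=
  [set v | v != 0 /\ closure C v /\ ~ Om v].

Definition xi_sym_image (Om C : set 'cV[R]_n) : set ('cV[R]_n * 'rV[R]_n) :=
  [set p | limit_set Om C p.1 /\ p.2 != 0 /\ pairing p.2 p.1 = 0 /\
           forall v, Om v -> pairing p.2 v != 0].

Definition desc_eigs (A : 'M[R]_n) : seq R :=
  xget [::] [set s : seq R | size s = n /\ sorted >=%R s /\
                              char_poly A = \prod_(x <- s) ('X - x%:P)].

Definition psd_sqrt (A : 'M[R]_n) : 'M[R]_n :=
  xget 0 [set S : 'M[R]_n | S^T = S /\
            (forall v : 'cV[R]_n, 0 <= (v^T *m S *m v) 0 0) /\ S *m S = A].

(* mu g i = log of the (i+1)-th eigenvalue (decreasing) of sqrt(g g^T) *)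
Definition mu (g : 'M[R]_n) (i : nat) : R := ln (nth 0 (desc_eigs (psd_sqrt (g *m g^T))) i).

Definition elog (x : \bar R) : \bar R :=
  match x with EFin r => (ln r)%:E | EPInf => +oo%E | ENInf => -oo%E end.

Definition count_le (G : set 'M[R]_n) (f : 'M[R]_n -> R) (r : R) : \bar R :=
  \esum_(g in [set g | G g /\ f g <= r]) 1%E.

Definition crit_exp (G : set 'M[R]_n) (f : 'M[R]_n -> R) : \bar R :=
  ereal_inf [set ereal_sup [set ((r^-1)%:E * elog (count_le G f r))%E
                           | r in [set r : R | T <= r]] | T in [set: R]].

Definition delta12 (G : set 'M[R]_n) : \bar R := crit_exp G (fun g => mu g 0 - mu g 1).
Definition delta1n (G : set 'M[R]_n) : \bar R := crit_exp G (fun g => mu g 0 - mu g n.-1).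

End Defs.

(* Main.v *)
(** Both bounds take place in the open convex cone [K] over [Om], on which
    [d_H(x, y) = 1/2 ln (M(x, y) M(y, x))], where [M(x, y)] is the least [a] with
    [y <= a x] in the order of [K].

    Lower bound.  For flags [(x, p)], [(x', p')] of the image of [xi^sym] one has
    [p'(x) + p(x') = (p' - p)(x - x')], which is at most the square of their
    distance.  By hyperbolicity, the points [z] of [Om] with [p(z) <= k |p|] all
    lie behind the point of the ray [o, x) at distance [-1/2 ln k] from [o].  So a
    cover of the image by sets of diameters [r_i] with [sum r_i^s] small gives
    finitely many [h_i] in the group such that all but finitely many [g] satisfy
    [d_H(o, h_i^-1 g o) <= d_H(o, g o) + ln r_i + c] for some [i].  Summing over
    the group, each truncated Poincare series satisfies [S <= F + S / 2], and hence
    the series converges at [s]; finally [d_H(o, g o) <= (mu_1 - mu_n)(g) / 2 + c].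

    Upper bound.  The flags whose ray from [o] passes near [g o], pulled back by
    [g], stay away from the repelling hyperplane of [g]; so they form a set of
    diameter at most [C (exp (- (mu_1 - mu_2)(g)) + exp (- (mu_1 - mu_2)(g^-1)))].
    By cocompactness these sets cover the image, and even do so after removing
    finitely many [g]. *)
Require Import Defs.
From HB Require Import structures.
From mathcomp Require Import all_boot all_order all_algebra.
From mathcomp Require Import all_classical all_reals all_analysis.
From mathcomp Require Import ring lra zify.
Set Implicit Arguments. Unset Strict Implicit. Unset Printing Implicit Defensive.
Import Order.TTheory GRing.Theory Num.Theory numFieldNormedType.Exports.
Local Open Scope classical_set_scope.
Local Open Scope ring_scope.

(** * Euclidean norms *)

(** A Hausdorff dimension is usually bounded below by putting a measure on the set, here a
    Patterson-Sullivan measure. No measure is built: every [s] with vanishing [s]-dimensional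
    measure is shown to make the Poincare series converge, and [hausdorff_dim] is the infimum of
    these [s]. The inequality [S <= F + S / 2] proves something only for finite [S], hence the
    truncation; and a truncated sum is compatible with [g |-> h_i^-1 g] only where this map does not
    increase [d_H(o, g o)], so the radii must be small enough for [ln r_i + c <= 0]. The pairing of
    two flags is quadratic in their distance, which cancels the [1/2] of the Hilbert distance in the
    shadow estimate, while [d_H(o, g o)] is half of [mu_1 - mu_n] up to a constant: this is the
    factor 2. An element of the group preserves the cone only up to sign, so arguments on the cone
    use [g] or [- g], which have the same norms and the same projective action. In the upper bound
    [g] contracts the points and the inverse transpose the hyperplanes, which is why the gaps of [g]
    and of its inverse both appear. *)

Section Euclid.
Variables (R : realType) (n : nat).
Implicit Types (u v w : 'cV[R]_n) (p q : 'rV[R]_n) (t : R).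

Lemma dotcE v w : dotc v w = \sum_i v i 0 * w i 0.
Proof. by rewrite /dotc mxE; apply: eq_bigr => i _; rewrite mxE. Qed.

Lemma dotcC v w : dotc v w = dotc w v.
Proof. by rewrite !dotcE; apply: eq_bigr => i _; rewrite mulrC. Qed.

Lemma dotcDl u v w : dotc (u + v) w = dotc u w + dotc v w.
Proof. by rewrite /dotc linearD /= mulmxDl mxE. Qed.

Lemma dotcZl t v w : dotc (t *: v) w = t * dotc v w.
Proof. by rewrite /dotc linearZ /= -scalemxAl mxE. Qed.

Lemma dotcNl v w : dotc (- v) w = - dotc v w.
Proof. by rewrite -scaleN1r dotcZl mulN1r. Qed.

Lemma dotcDr u v w : dotc w (u + v) = dotc w u + dotc w v.
Proof. by rewrite dotcC dotcDl !(dotcC w). Qed.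

Lemma dotcZr t v w : dotc w (t *: v) = t * dotc w v.
Proof. by rewrite dotcC dotcZl (dotcC w). Qed.

Lemma dotcNr v w : dotc w (- v) = - dotc w v.
Proof. by rewrite dotcC dotcNl (dotcC w). Qed.

Lemma dotc_ge0 v : 0 <= dotc v v.
Proof. by rewrite dotcE sumr_ge0// => i _; rewrite -expr2 sqr_ge0. Qed.

Lemma dotc_eq0 v : (dotc v v == 0) = (v == 0).
Proof.
apply/eqP/eqP => [|->]; last by rewrite /dotc mulmx0 mxE.
rewrite dotcE => /psumr_eq0P H; apply/matrixP => i j; rewrite mxE ord1.
have /H : forall i, true -> 0 <= v i 0 * v i 0 by move=> k _; rewrite -expr2 sqr_ge0.
by move=> /(_ i isT)/eqP; rewrite mulf_eq0 orbb => /eqP.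
Qed.

Lemma normc_ge0 v : 0 <= normc v.
Proof. exact: sqrtr_ge0. Qed.

Lemma normc_sqr v : normc v ^+ 2 = dotc v v.
Proof. by rewrite /normc sqr_sqrtr ?dotc_ge0. Qed.

Lemma normc_eq0 v : (normc v == 0) = (v == 0).
Proof. by rewrite -dotc_eq0 -normc_sqr sqrf_eq0. Qed.

Lemma normc0 : normc (0 : 'cV[R]_n) = 0.
Proof. by apply/eqP; rewrite normc_eq0. Qed.

Lemma normc_gt0 v : (0 < normc v) = (v != 0).
Proof. by rewrite lt0r normc_eq0 normc_ge0 andbT. Qed.

Lemma normcZ t v : normc (t *: v) = `|t| * normc v.
Proof.
by rewrite /normc dotcZl dotcZr mulrA -expr2 sqrtrM ?sqr_ge0// sqrtr_sqr.
Qed.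

Lemma normcN v : normc (- v) = normc v.
Proof. by rewrite -scaleN1r normcZ normrN1 mul1r. Qed.

Lemma dotc_CS_sqr v w : dotc v w ^+ 2 <= dotc v v * dotc w w.
Proof.
have [->|w0] := eqVneq w 0.
  by rewrite /dotc !mulmx0 mxE expr0n mulr0.
have ww : 0 < dotc w w by rewrite lt0r dotc_eq0 w0 dotc_ge0.
have := dotc_ge0 (dotc w w *: v - dotc v w *: w).
rewrite !(dotcDl, dotcDr, dotcNl, dotcNr, dotcZl, dotcZr) (dotcC w v).
set a := dotc v v; set b := dotc v w; set c := dotc w w.
rewrite (_ : _ + _ = c * (a * c - b ^+ 2)); last by ring.
by rewrite pmulr_rge0// subr_ge0.
Qed.

Lemma dotc_CS v w : `|dotc v w| <= normc v * normc w.
Proof.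
rewrite -ler_sqr ?nnegrE ?normr_ge0 ?mulr_ge0 ?normc_ge0//.
by rewrite exprMn !normc_sqr real_normK ?num_real// dotc_CS_sqr.
Qed.

Lemma normcD v w : normc (v + w) <= normc v + normc w.
Proof.
rewrite -ler_sqr ?nnegrE ?addr_ge0 ?normc_ge0//.
rewrite normc_sqr dotcDl !dotcDr sqrrD !normc_sqr (dotcC w v).
have := le_trans (ler_norm _) (dotc_CS v w); lra.
Qed.

Lemma normcB v w : normc (v - w) <= normc v + normc w.
Proof. by rewrite -(normcN w) normcD. Qed.

Lemma normc_distC v w : normc (v - w) = normc (w - v).
Proof. by rewrite -normcN opprB. Qed.

Lemma pairingE p v : pairing p v = dotc p^T v.
Proof. by rewrite /pairing /dotc trmxK. Qed.

Lemma normrowE p : normrow p = normc p^T.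
Proof. by rewrite /normrow /normc /dotr /dotc trmxK. Qed.

Lemma angle_rE p q : angle_r p q = angle_c p^T q^T.
Proof. by rewrite /angle_r /angle_c !normrowE /dotr /dotc trmxK. Qed.

Lemma pairingD p v w : pairing p (v + w) = pairing p v + pairing p w.
Proof. by rewrite !pairingE dotcDr. Qed.
Lemma pairingZ p t v : pairing p (t *: v) = t * pairing p v.
Proof. by rewrite !pairingE dotcZr. Qed.
Lemma pairingN p v : pairing p (- v) = - pairing p v.
Proof. by rewrite !pairingE dotcNr. Qed.
Lemma pairingDl p q v : pairing (p + q) v = pairing p v + pairing q v.
Proof. by rewrite !pairingE linearD dotcDl. Qed.
Lemma pairingZl t p v : pairing (t *: p) v = t * pairing p v.
Proof. by rewrite !pairingE linearZ /= dotcZl. Qed.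
Lemma pairingNl p v : pairing (- p) v = - pairing p v.
Proof. by rewrite !pairingE linearN dotcNl. Qed.
Lemma pairing_le p v : `|pairing p v| <= normrow p * normc v.
Proof. by rewrite pairingE normrowE dotc_CS. Qed.

Lemma mx_norm_le_normc v : `|v| <= normc v.
Proof.
rewrite [`|v|]/Num.norm /= mx_normrE; apply/bigmax_leP; split; first exact: normc_ge0.
move=> [i j] _ /=; rewrite ord1 -ler_sqr ?nnegrE ?normc_ge0// normc_sqr dotcE.
rewrite real_normK ?num_real// (bigD1 i)//= expr2 lerDl sumr_ge0// => k _.
by rewrite -expr2 sqr_ge0.
Qed.

(** The crude factor [n.+1] is positive even for [n = 0], so one can divide by it. *)
Lemma normc_le_mx_norm v : normc v <= n.+1%:R * `|v|.
Proof.
rewrite -ler_sqr ?nnegrE ?normc_ge0 ?mulr_ge0//.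
rewrite normc_sqr dotcE exprMn; apply: (@le_trans _ _ (\sum_(i < n) `|v| ^+ 2)).
  apply: ler_sum => i _; rewrite -expr2 -(real_normK (num_real (v i 0))) lerXn2r ?nnegrE//.
  rewrite [`|v|]/Num.norm /= mx_normrE.
  exact: (le_bigmax _ (fun ij : 'I_n * 'I_1 => `|v ij.1 ij.2|) (i, ord0)).
rewrite sumr_const card_ord -[leLHS]mulr_natl ler_wpM2r ?sqr_ge0// -natrX ler_nat.
by nia.
Qed.

End Euclid.

(** * Topology of column vectors through the Euclidean norm *)

Section Topology.
Variables (R : realType) (n : nat).
Implicit Types (u v w x y : 'cV[R]_n) (A : set 'cV[R]_n).

Lemma nbhs_normcP x A :
  nbhs x A <-> exists2 e : R, 0 < e & forall y, normc (y - x) < e -> A y.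
Proof.
split=> [/nbhs_normP[e /= e0 He]|[e e0 He]].
  exists e => // y yx; apply: He => /=.
  by rewrite -opprB normrN (le_lt_trans (mx_norm_le_normc _)).
apply/(nbhs_normP x A); exists (e / n.+1%:R) => /=; first by rewrite divr_gt0.
move=> y /= yx; apply: He; rewrite (le_lt_trans (normc_le_mx_norm _))//.
by rewrite mulrC -ltr_pdivlMr// -opprB normrN.
Qed.

Lemma closure_normcP A x :
  closure A x <-> forall e : R, 0 < e -> exists2 y, A y & normc (y - x) < e.
Proof.
split=> [cAx e e0|H B /nbhs_normcP[e e0 He]].
  have [|y [Ay yx]] := cAx [set y | normc (y - x) < e]; last by exists y.
  by apply/nbhs_normcP; exists e.
by have [y Ay yx] := H e e0; exists y; split=> //; apply: He.
Qed.

Lemma open_normcP A x : open A -> A x ->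
  exists2 e : R, 0 < e & forall y, normc (y - x) < e -> A y.
Proof. by move=> oA Ax; apply/nbhs_normcP; exact: open_nbhs_nbhs. Qed.

(** Asking for the bound only near [x], with a constant that may depend on [x], lets quadratic forms
    qualify. *)
Lemma loclip_continuous (f : 'cV[R]_n -> R) x (L : R) : 0 <= L ->
  (forall y, normc (y - x) < 1 -> `|f y - f x| <= L * normc (y - x)) ->
  {for x, continuous f}.
Proof.
move=> L0 Hf B /nbhs_ballP[e /= e0 He].
apply/(nbhs_normcP x (f @^-1` B)); exists (Num.min 1 (e / (L + 1))).
  by rewrite lt_min ltr01 divr_gt0// ltr_wpDl.
move=> y; rewrite lt_min => /andP[y1 ye] /=; apply: He; rewrite /ball /= distrC.
rewrite (le_lt_trans (Hf y y1))//.
move: ye; rewrite ltr_pdivlMr ?ltr_wpDl// mulrDr mulr1 => ye.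
have := normc_ge0 (y - x); rewrite mulrC; lra.
Qed.

Lemma normc_dist_le v w : `|normc v - normc w| <= normc (v - w).
Proof.
rewrite ler_norml; apply/andP; split.
  rewrite lerBrDr addrC lerBlDr.
  by rewrite -[X in X <= _](_ : normc (v - (v - w)) = _) ?normcB// subKr.
by rewrite lerBlDr -[X in X <= _](_ : normc (v - w + w) = _) ?normcD// subrK.
Qed.

Lemma normc_continuous : continuous (@normc R n).
Proof.
by move=> x; apply: (@loclip_continuous _ _ 1) => // y _; rewrite mul1r normc_dist_le.
Qed.

Lemma pairing_continuous (p : 'rV[R]_n) : continuous (pairing p).
Proof.
move=> x; apply: (@loclip_continuous _ _ (normrow p)) => [|y _].
  by rewrite normrowE normc_ge0.
by rewrite -pairingN -pairingD pairing_le.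
Qed.

Lemma mulmx_normc_bound (A : 'M[R]_n) :
  exists2 c : R, 0 <= c & forall y, normc (A *m y) <= c * normc y.
Proof.
exists (n.+1%:R * \sum_i \sum_j `|A i j|).
  by rewrite mulr_ge0// sumr_ge0// => i _; rewrite sumr_ge0.
move=> y; rewrite (le_trans (normc_le_mx_norm _))// -mulrA ler_wpM2l//.
rewrite [X in X <= _]/Num.norm /= mx_normrE; apply/bigmax_leP; split.
  by rewrite mulr_ge0 ?normc_ge0// sumr_ge0// => i _; rewrite sumr_ge0.
move=> [i j] _ /=; rewrite ord1 mxE (le_trans (ler_norm_sum _ _ _))//.
rewrite [X in _ <= X * _](bigD1 i)//= mulrDl.
apply: ler_wpDr.
  by rewrite mulr_ge0 ?normc_ge0// sumr_ge0// => k _; rewrite sumr_ge0.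
rewrite mulr_suml; apply: ler_sum => k _; rewrite normrM ler_wpM2l//.
rewrite -ler_sqr ?nnegrE ?normc_ge0// normc_sqr dotcE.
rewrite real_normK ?num_real// (bigD1 k)//= expr2 lerDl sumr_ge0// => l _.
by rewrite -expr2 sqr_ge0.
Qed.

Lemma quad_continuous (A : 'M[R]_n) : continuous (fun v => dotc v (A *m v)).
Proof.
move=> x; have [c c0 Hc] := mulmx_normc_bound A.
apply: (@loclip_continuous _ _ (c * (1 + normc x) + normc x * c)).
  by rewrite addr_ge0 ?mulr_ge0 ?addr_ge0 ?normc_ge0.
move=> y yx.
have -> : dotc y (A *m y) - dotc x (A *m x) =
    dotc (y - x) (A *m y) + dotc x (A *m (y - x)).
  by rewrite mulmxBr dotcDl dotcDr dotcNl dotcNr; ring.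
rewrite (le_trans (ler_normD _ _))// mulrDl lerD//.
  rewrite (le_trans (dotc_CS _ _))// mulrC ler_wpM2r ?normc_ge0//.
  rewrite (le_trans (Hc _))// ler_wpM2l//.
  have := normcD (y - x) x; rewrite subrK; lra.
by rewrite (le_trans (dotc_CS _ _))// -mulrA ler_wpM2l ?normc_ge0.
Qed.

(** Compactness is transported from row vectors by the transpose, which does not increase the sup
    norm. *)
Lemma closed_normc_bounded_compact A (M : R) :
  closed A -> (forall v, A v -> normc v <= M) -> compact A.
Proof.
move=> cA bA.
have trn m k (z : 'M[R]_(m, k)) : `|z^T| <= `|z|.
  rewrite [X in X <= _]/Num.norm /= mx_normrE; apply/bigmax_leP; split=> //.
  move=> [i j] _ /=; rewrite mxE [leRHS]/Num.norm /= mx_normrE.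
  exact: (le_bigmax _ (fun ij => `|z ij.1 ij.2|) (j, i)).
have trc m k : continuous (@trmx R m k).
  move=> z B /nbhs_normP[e /= e0 He].
  apply/(nbhs_normP z); exists e => //= y yz; apply: He => /=.
  by rewrite -linearB /= (le_lt_trans (trn _ _ _)).
have -> : A = trmx @` [set p : 'rV[R]_n | A p^T].
  by apply/seteqP; split=> [v Av|_ [p /= Ap <-]//]; exists v^T => /=; rewrite ?trmxK.
apply: continuous_compact.
  by apply: continuous_subspaceT; exact: trc.
apply: bounded_closed_compact.
  exists M; split; first exact: num_real.
  move=> N MN p /= Ap; rewrite -[p]trmxK (le_trans (trn _ _ _))//.
  by rewrite (le_trans (mx_norm_le_normc _))// (le_trans (bA _ Ap))// ltW.
by apply: closed_comp => // p _; exact: trc.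
Qed.

Lemma closed_sphere : closed [set v : 'cV[R]_n | normc v = 1].
Proof.
rewrite (_ : [set _ | _] = (@normc R n) @^-1` [set 1])//.
by apply: closed_comp => [x _|]; [exact: normc_continuous|exact: closed_eq].
Qed.

End Topology.

(** * Singular values *)

Section Spectral.
Variable R : realType.

Lemma dotc_mulmxl m n (A : 'M[R]_(m, n)) v w : dotc (A *m v) w = dotc v (A^T *m w).
Proof. by rewrite /dotc trmx_mul mulmxA. Qed.

(** A maximiser [v] of the form on the unit sphere is an eigenvector: [lam - A] is positive
    semidefinite and its form vanishes at [v], so its value at [v - t b], with [b = (lam - A) v], is
    [- 2 t |b|^2 + O(t^2)], which forces [b = 0]. *)
Lemma max_rayleigh n (A : 'M[R]_n.+1) : A^T = A ->
  exists lam v, [/\ dotc v v = 1, A *m v = lam *: v &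
    forall w, dotc w (A *m w) <= lam * dotc w w].
Proof.
move=> sA; pose S := [set v : 'cV[R]_n.+1 | normc v = 1].
have cS : compact S.
  by apply: (@closed_normc_bounded_compact _ _ _ 1) => [|v ->//]; exact: closed_sphere.
have S0 : S !=set0.
  exists (delta_mx 0 0); rewrite /S/= /normc dotcE (bigD1 0)//= !mxE eqxx mulr1 big1 ?addr0 ?sqrtr1//.
  by move=> i i0; rewrite !mxE (negPf i0) mulr0.
have [v vS vmax] := compact_EVT_max S0 cS (continuous_subspaceT (@quad_continuous _ _ A)).
move: vS; rewrite inE /S /= => v1.
have vv : dotc v v = 1 by rewrite -normc_sqr v1 expr1n.
pose lam := dotc v (A *m v).
have Hw w : dotc w (A *m w) <= lam * dotc w w.
  have [->|w0] := eqVneq w 0; first by rewrite mulmx0 /dotc !mulmx0 mxE mulr0.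
  have nw : 0 < normc w by rewrite normc_gt0.
  have := vmax ((normc w)^-1 *: w); rewrite inE /S /= => /(_ _).
  rewrite normcZ ger0_norm ?invr_ge0 ?normc_ge0// mulVf ?gt_eqF// => /(_ erefl).
  rewrite -scalemxAr dotcZl dotcZr mulrA -/lam -normc_sqr.
  by rewrite -invfM mulrC ler_pdivrMr ?mulr_gt0// -expr2.
exists lam, v; split=> //.
pose B := lam%:M - A.
have Bq w : 0 <= dotc w (B *m w).
  by rewrite /B mulmxBl mul_scalar_mx dotcDr dotcNr dotcZr subr_ge0.
have sB : B^T = B by rewrite /B linearB /= tr_scalar_mx sA.
have Bv : dotc v (B *m v) = 0.
  by rewrite /B mulmxBl mul_scalar_mx dotcDr dotcNr dotcZr vv mulr1 subrr.
suff : B *m v == 0.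
  by rewrite /B mulmxBl mul_scalar_mx subr_eq0 => /eqP.
rewrite -dotc_eq0 eq_le dotc_ge0 andbT.
set b := B *m v; set c := dotc b (B *m b).
have c0 : 0 <= c by exact: Bq.
have key t : 0 < t -> 2 * dotc b b <= t * c.
  move=> t0; have := Bq (v - t *: b).
  rewrite mulmxBr -scalemxAr !(dotcDl, dotcDr, dotcNl, dotcNr, dotcZl, dotcZr) Bv.
  have -> : dotc v (B *m b) = dotc b b by rewrite -[in RHS]/b dotc_mulmxl sB.
  rewrite -/b -/c => H.
  rewrite -(ler_pM2l t0); nra.
have [//|bb] := leP (dotc b b) 0.
have := key (dotc b b / (c + 1)) (divr_gt0 bb (ltr_wpDl c0 ltr01)).
rewrite mulrAC ler_pdivlMr ?ltr_wpDl//; nra.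
Qed.

(** The reflection in the hyperplane orthogonal to [v - e] exchanges the unit vectors [e] and
    [v]. *)
Lemma householder n (v : 'cV[R]_n.+1) : dotc v v = 1 ->
  exists H : 'M[R]_n.+1, [/\ H^T = H, H *m H = 1%:M & H *m delta_mx 0 0 = v].
Proof.
move=> vv; pose e : 'cV[R]_n.+1 := delta_mx 0 0.
have ee : dotc e e = 1.
  rewrite dotcE (bigD1 0)//= !mxE eqxx mulr1 big1 ?addr0//.
  by move=> i i0; rewrite !mxE (negPf i0) mulr0.
have [->|ve] := eqVneq v e; first by exists 1%:M; rewrite trmx1 mulmx1 mul1mx.
pose u := v - e.
have uu : 0 < dotc u u by rewrite lt0r dotc_ge0 dotc_eq0 subr_eq0 ve.
have mulu m (x : 'rV[R]_m) : u^T *m u *m x = dotc u u *: x.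
  by rewrite [u^T *m u]mx11_scalar mul_scalar_mx.
exists (1%:M - (2 / dotc u u) *: (u *m u^T)); split.
- by rewrite linearB linearZ /= trmx1 trmx_mul trmxK.
- set W := u *m u^T; set a := 2 / _.
  have WW : W *m W = dotc u u *: W.
    by rewrite /W mulmxA -[u *m u^T *m u]mulmxA -[u *m (u^T *m u) *m _]mulmxA mulu -scalemxAr.
  rewrite mulmxBl mul1mx mulmxBr mulmx1 -scalemxAl -scalemxAr WW !scalerA.
  rewrite (_ : a * a * dotc u u = 2 * a); last by rewrite /a; field; rewrite gt_eqF.
  by rewrite mulr_natl mulr2n scalerDl opprB addrK subrK.
- rewrite mulmxBl mul1mx -scalemxAl -mulmxA [u^T *m _]mx11_scalar mul_mx_scalar scalerA.
  rewrite -/e -/(dotc u e).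
  have -> : dotc u e = - (dotc u u / 2).
    rewrite /u !(dotcDl, dotcDr, dotcNl, dotcNr) vv ee (dotcC e v).
    by field.
  rewrite (_ : _ * _ = -1); last by field; rewrite gt_eqF.
  by rewrite scaleN1r opprK /u addrC subrK.
Qed.

(** A diagonal entry is the value of the form at a unit column of [P]. This yields the order of the
    eigenvalues and, applied to [- A], their sign. *)
Lemma diag_le_rayleigh n (A P : 'M[R]_n) (d : 'rV[R]_n) (lam : R) :
  P *m P^T = 1%:M -> A = P *m diag_mx d *m P^T ->
  (forall w, dotc w (A *m w) <= lam * dotc w w) -> forall k, d 0 k <= lam.
Proof.
move=> PP AE Hw k.
have PP' : P^T *m P = 1%:M by exact: mulmx1C.
have E : P^T *m A *m P = diag_mx d.
  by rewrite AE !mulmxA PP' mul1mx -mulmxA PP' mulmx1.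
have -> : d 0 k = dotc (col k P) (A *m col k P).
  rewrite colE dotc_mulmxl !mulmxA E -colE dotcE (bigD1 k)//= big1 ?addr0.
    by rewrite !mxE !eqxx mul1r.
  by move=> l lk; rewrite !mxE (negPf lk) mul0r.
have := Hw (col k P); suff -> : dotc (col k P) (col k P) = 1 by rewrite mulr1.
have := congr1 (fun M : 'M[R]_n => M k k) PP'; rewrite !mxE eqxx mulr1n => <-.
by rewrite dotcE; apply: eq_bigr => l _; rewrite !mxE.
Qed.

(** Deflation: a Householder matrix takes the first basis vector to a top eigenvector, and induction
    treats the remaining block. The order comes for free, as the eigenvalue split off maximises the
    Rayleigh quotient. *)
Lemma real_spectral n (A : 'M[R]_n) : A^T = A ->
  exists P (d : 'rV[R]_n), [/\ P *m P^T = 1%:M,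
    (forall i j : 'I_n, (i <= j)%N -> d 0 j <= d 0 i) & A = P *m diag_mx d *m P^T].
Proof.
elim: n A => [|n IH] A sA.
  by exists 1%:M, 0; split=> [|[]//|]; [rewrite trmx1 mulmx1|rewrite [A]thinmx0 [RHS]thinmx0].
have [lam [v [vv Av Hw]]] := max_rayleigh sA.
have [H [sH HH He]] := householder vv.
have [B BE] : exists B, B = H *m A *m H by eexists.
have sB : B^T = B by rewrite BE !trmx_mul sA sH mulmxA.
have Be : B *m delta_mx 0 0 = lam *: (delta_mx 0 0 : 'cV_n.+1).
  by rewrite BE -!mulmxA He Av -scalemxAr -He mulmxA HH mul1mx.
have Bi i (j : 'I_n.+1) : j = 0%N :> nat -> B i j = lam *+ (i == 0%N :> nat).
  move=> j0; rewrite (_ : j = 0); last by apply/val_inj.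
  have := congr1 (fun M : 'cV_n.+1 => M i 0) Be.
  by rewrite -colE !mxE eqxx andbT mulr_natr.
pose B1 : 'M[R]_(1 + n) := B.
have [A' A'0] : exists A', A' = drsubmx B1 by eexists.
have B1E : B1 = block_mx lam%:M 0 0 A'.
  rewrite -[LHS]submxK A'0; congr block_mx.
  - apply/matrixP => i j; rewrite !ord1 !mxE /B1. by rewrite Bi.
  - by apply/matrixP => i j; rewrite !ord1 !mxE /B1 -sB mxE Bi.
  - apply/matrixP => i j; rewrite !ord1 !mxE /B1. by rewrite Bi.
have sA' : A'^T = A'.
  by rewrite A'0 trmx_drsub /B1 sB.
have [P' [d' [P'1 d's A'E]]] := IH _ sA'.
pose Q : 'M[R]_(1 + n) := block_mx 1%:M 0 0 P'.
pose d : 'rV_(1 + n) := row_mx lam%:M d'.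
have QQ : Q *m Q^T = 1%:M.
  rewrite /Q tr_block_mx !trmx0 trmx1 mulmx_block.
  by rewrite !mulmx0 !mul0mx !mulmx1 !addr0 !add0r P'1 -scalar_mx_block.
have QdQ : Q *m diag_mx d *m Q^T = B1.
  rewrite /Q tr_block_mx !trmx0 trmx1 diag_mx_row !mulmx_block.
  rewrite !mulmx0 !mul0mx !mulmx1 !mul1mx !addr0 !add0r -A'E B1E.
  rewrite (_ : diag_mx (lam%:M : 'M[R]_1) = lam%:M) ?mul0mx//.
  by apply/matrixP => i j; rewrite !ord1 !mxE.
pose P : 'M[R]_(1 + n) := (H : 'M[R]_(1 + n)) *m Q.
have PP : P *m P^T = 1%:M.
  by rewrite /P trmx_mul mulmxA -[_ *m Q *m _]mulmxA QQ mulmx1 sH HH.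
have AE : A = P *m diag_mx d *m P^T.
  have -> : P *m diag_mx d *m P^T = H *m (Q *m diag_mx d *m Q^T) *m H^T.
    by rewrite /P trmx_mul !mulmxA.
  by rewrite QdQ /B1 BE sH !mulmxA HH mul1mx -mulmxA HH mulmx1.
exists P, d; split=> // i j ij.
have dle k : d 0 k <= lam.
  exact: (@diag_le_rayleigh (1 + n) A P d lam PP AE Hw k).
case: (@splitP 1 n i) ij => [i0 i0E _|i' ii'].
  rewrite (_ : d 0 i = lam) ?dle//.
  rewrite (_ : i = lshift n i0); last by apply/val_inj.
  by rewrite /d row_mxEl !ord1 mxE.
case: (@splitP 1 n j) => [j0 -> |j' jj' ij]; first by rewrite ii' ord1.
have dr (k : 'I_(1 + n)) (k' : 'I_n) : k = (1 + k')%N :> nat -> d 0 k = d' 0 k'.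
  move=> kk'; rewrite (_ : k = rshift 1 k'); last by apply/val_inj.
  exact: row_mxEr.
by rewrite (dr _ _ ii') (dr _ _ jj') d's//; move: ij; rewrite ii' jj'.
Qed.

End Spectral.

Section SVD.
Variable R : realType.

Lemma normc_orthogonal n (P : 'M[R]_n) v : P *m P^T = 1%:M -> normc (P *m v) = normc v.
Proof.
by move=> /mulmx1C PP; rewrite /normc dotc_mulmxl mulmxA PP mul1mx.
Qed.

Lemma diag_mulE n (d : 'rV[R]_n) (v : 'cV[R]_n) i : (diag_mx d *m v) i 0 = d 0 i * v i 0.
Proof. by rewrite mul_diag_mx mxE. Qed.

Lemma char_poly_orthogonal n (P A : 'M[R]_n) : P *m P^T = 1%:M ->
  char_poly (P *m A *m P^T) = char_poly A.
Proof.
move=> PP.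
have PPp : map_mx polyC P *m map_mx polyC P^T = 1%:M.
  by rewrite -map_mxM PP map_mx1.
rewrite /char_poly /char_poly_mx !map_mxM.
rewrite -[X in \det (X - _)]mulmx1 -PPp mulmxA -scalar_mxC.
rewrite -mulmxBl.
have -> : map_mx polyC P *m 'X%:M - map_mx polyC P *m map_mx polyC A =
          map_mx polyC P *m ('X%:M - map_mx polyC A) by rewrite mulmxBr.
by rewrite -mulmxA det_mulmx mulrC -det_mulmx -mulmxA (mulmx1C PPp) mulmx1.
Qed.

(** The choice in [desc_eigs] has one candidate: the characteristic polynomial determines the
    multiset of its roots, and a decreasing list is determined by its multiset. *)
Lemma desc_eigs_diag n (P A : 'M[R]_n) (d : 'rV[R]_n) : P *m P^T = 1%:M ->
  (forall i j : 'I_n, (i <= j)%N -> d 0 j <= d 0 i) ->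
  A = P *m diag_mx d *m P^T -> desc_eigs A = [seq d 0 i | i <- enum 'I_n].
Proof.
move=> PP ds AE; set s := [seq _ | _ <- _].
have cpA : char_poly A = \prod_(x <- s) ('X - x%:P).
  rewrite AE char_poly_orthogonal// char_poly_trig.
    rewrite /s big_map big_enum; apply: eq_bigr => i _.
    by rewrite mxE eqxx mulr1n.
  by apply/is_trig_mxP => i j ij; rewrite mxE; case: eqP ij => // ->; rewrite ltnn.
have ss : sorted >=%R s.
  rewrite /s sorted_map; apply: (@sub_sorted _ (fun i j : 'I_n => (i <= j)%N)).
    by move=> i j ij /=; exact: ds.
  have := iota_sorted 0 n; rewrite -val_enum_ord sorted_map.
  exact.
apply: xget_unique => [|t [st [tt tp]]].
  by rewrite /= /s size_map size_enum_ord.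
apply: (@sorted_eq _ >=%R) => //.
- by move=> x y z /= yx zy; exact: le_trans zy yx.
- by move=> x y /= /andP[xy yx]; apply/eqP; rewrite eq_le xy yx.
- by apply: prod_XsubC_eq; rewrite -tp cpA.
Qed.

(** Polar decomposition: [S = sqrt (g g^T)] is invertible since [\det S ^+ 2 = 1], and [S^-1 g] is
    orthogonal. Diagonalising [S] then gives the factorisation. *)
Lemma svd n (g : 'M[R]_n) : \det g = 1 ->
  exists P Q (d : 'rV[R]_n),
    [/\ P *m P^T = 1%:M, Q *m Q^T = 1%:M, g = P *m diag_mx d *m Q,
        (forall i j : 'I_n, (i <= j)%N -> d 0 j <= d 0 i) &
        forall i : 'I_n, 0 < d 0 i /\ mu g i = ln (d 0 i)].
Proof.
move=> dg.
have sgg : (g *m g^T)^T = g *m g^T by rewrite trmx_mul trmxK.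
pose S := psd_sqrt (g *m g^T).
have [sS [pS SS]] : S^T = S /\ (forall v : 'cV[R]_n, 0 <= (v^T *m S *m v) 0 0) /\ S *m S = g *m g^T.
  apply: (xgetPex 0 (P := [set S : 'M[R]_n | S^T = S /\
            (forall v : 'cV[R]_n, 0 <= (v^T *m S *m v) 0 0) /\ S *m S = g *m g^T])).
  have [P [d [PP ds ggE]]] := real_spectral sgg.
  have PP' := mulmx1C PP.
  have d0 i : 0 <= d 0 i.
    rewrite -oppr_le0 -[- _](_ : (- d) 0 i = _); last by rewrite mxE.
    apply: (@diag_le_rayleigh _ _ (- (g *m g^T)) P (- d) 0 PP).
      by rewrite ggE linearN /= mulmxN mulNmx.
    move=> w; rewrite mul0r mulNmx dotcNr oppr_le0 -mulmxA.
    by rewrite dotcC dotc_mulmxl dotc_ge0.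
  pose r : 'rV[R]_n := \row_i Num.sqrt (d 0 i).
  exists (P *m diag_mx r *m P^T); split.
    by rewrite !trmx_mul trmxK tr_diag_mx mulmxA.
  split=> [v|].
    have -> : v^T *m (P *m diag_mx r *m P^T) *m v =
       (P^T *m v)^T *m (diag_mx r *m (P^T *m v)) by rewrite trmx_mul trmxK !mulmxA.
    rewrite -/(dotc _ _) dotcE sumr_ge0// => i _; rewrite diag_mulE mulrCA.
    by rewrite mulr_ge0// ?mxE ?sqrtr_ge0// -expr2 sqr_ge0.
  rewrite !mulmxA -[_ *m P^T *m P]mulmxA PP' mulmx1 -[P *m _ *m _]mulmxA mulmx_diag.
  rewrite ggE; congr (_ *m diag_mx _ *m _).
  by apply/rowP => i; rewrite !mxE -expr2 sqr_sqrtr.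
have [P [d [PP ds SE]]] := real_spectral sS.
have PP' := mulmx1C PP.
have dS : \det S ^+ 2 = 1 by rewrite expr2 -det_mulmx SS det_mulmx det_tr dg mulr1.
have Su : S \in unitmx.
  rewrite unitmxE unitfE; apply/negP => /eqP S0.
  by move: dS; rewrite S0 expr0n /= => /eqP; rewrite eq_sym oner_eq0.
have d0 i : 0 <= d 0 i.
  rewrite -oppr_le0 -[- _](_ : (- d) 0 i = _); last by rewrite mxE.
  apply: (@diag_le_rayleigh _ _ (- S) P (- d) 0 PP).
    by rewrite {1}SE linearN /= mulmxN mulNmx.
  by move=> w; rewrite mul0r mulNmx dotcNr oppr_le0 /dotc mulmxA pS.
have dd : \det S = \prod_i d 0 i.
  rewrite SE !det_mulmx mulrAC -det_mulmx PP det1 mul1r det_diag//.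
have dp i : 0 < d 0 i.
  rewrite lt0r d0 andbT; apply/negP => /eqP di.
  move: dS; rewrite dd (bigD1 i)//= di mul0r expr0n /= => /eqP.
  by rewrite eq_sym oner_eq0.
pose Q := P^T *m invmx S *m g.
exists P, Q, d; split=> //.
- have iS : (invmx S)^T = invmx S by rewrite trmx_inv sS.
  rewrite /Q !trmx_mul trmxK iS !mulmxA -[_ *m g *m g^T]mulmxA -SS.
  by rewrite !mulmxA mulmxKV// mulmxK.
- by rewrite /Q !mulmxA -SE mulmxV// mul1mx.
- move=> i; split=> //; rewrite /mu -/S (desc_eigs_diag PP ds SE).
  rewrite (nth_map i) ?size_enum_ord//; congr (ln (d 0 _)).
  by rewrite nth_ord_enum.
Qed.

End SVD.

(** * Angles between lines, and their contraction by a matrix *)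

Section Angles.
Variable R : realType.

Lemma sin_mvt (y : R) : 0 <= y -> exists2 c, 0 <= c <= y & sin y = y * cos c.
Proof.
move=> y0; have [c ci] := @MVT_segment R sin cos 0 y y0 (fun x _ => is_derive_sin x) (continuous_subspaceT (@continuous_sin R)).
rewrite sin0 !subr0 mulrC => E; exists c => //.
Qed.

Lemma sin_le_id (y : R) : 0 <= y -> sin y <= y.
Proof.
by move=> y0; have [c _ ->] := sin_mvt y0; rewrite ler_piMr ?cos_le1.
Qed.

Lemma cos_double (y : R) : cos y = 1 - 2 * sin (y / 2) ^+ 2.
Proof.
rewrite {1}(_ : y = (y / 2) *+ 2); last by rewrite -mulr_natr divfK.
rewrite cos_mulr2n -mulr_natl; have := cos2Dsin2 (y / 2); lra.
Qed.

(** A chord is shorter than its arc: with [x = cos a], the left side is the squared chord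
    [4 sin^2 (a / 2)]. *)
Lemma acos_sqr_ge (x : R) : 0 <= x <= 1 -> 2 - 2 * x <= acos x ^+ 2.
Proof.
move=> /andP[x0 x1]; have x11 : -1 <= x <= 1 by rewrite x1 andbT; lra.
have a0 := acos_ge0 x11.
have xE : x = cos (acos x) by rewrite acosK// in_itv.
rewrite {1}xE cos_double.
have h0 : 0 <= acos x / 2 by rewrite divr_ge0.
have s0 : sin (acos x / 2) <= acos x / 2 by exact: sin_le_id.
have : 0 <= sin (acos x / 2).
  by apply: sin_ge0_pi; rewrite h0 /=; have := acos_lepi x11; lra.
nra.
Qed.

(** For [a = acos x] in [[0, pi / 2]] this is [a <= 2 sin a]. By the mean value theorem
    [sin (a / 2) = (a / 2) cos c], so [sin a = a cos c cos (a / 2)], and [cos c cos (a / 2) >= cos^2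
    (a / 2) >= 1 / 2]. *)
Lemma acos_le_sin (x : R) : 0 <= x <= 1 -> acos x <= 2 * Num.sqrt (1 - x ^+ 2).
Proof.
move=> /andP[x0 x1]; have x11 : -1 <= x <= 1 by rewrite x1 andbT; lra.
have a0 := acos_ge0 x11; have api := acos_lepi x11.
have xE : x = cos (acos x) by rewrite acosK// in_itv.
rewrite -[Num.sqrt _](sin_acos x11); set a := acos x in a0 api xE *.
have h0 : 0 <= a / 2 by rewrite divr_ge0.
have [c /andP[c0 c1] sc] := sin_mvt h0.
have sE : sin a = 2 * sin (a / 2) * cos (a / 2).
  rewrite {1}(_ : a = (a / 2) *+ 2); last by rewrite -mulr_natr divfK.
  by rewrite sin_mulr2n -mulr_natl mulrA [RHS]mulrAC.
have hpi : a / 2 <= pi / 2 by rewrite ler_pM2r.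
have pi0 := pi_gt0 R.
have cosh : 0 <= cos (a / 2) by apply: cos_ge0_pihalf; rewrite hpi andbT; lra.
have c2 : 1 <= 2 * cos (a / 2) ^+ 2.
  have := cos_double a; rewrite -xE; have := cos2Dsin2 (a / 2); lra.
have cc : cos (a / 2) <= cos c.
  by rewrite leNgt ltr_cos ?in_itv/= -?leNgt//; lra.
rewrite sE sc.
have cc2 : 1 <= 2 * (cos c * cos (a / 2)).
  by rewrite (le_trans c2)// ler_pM2l// expr2 ler_wpM2r.
have := ler_wpM2l a0 cc2; rewrite mulr1 => /le_trans; apply.
by rewrite le_eqVlt; apply/orP; left; apply/eqP; field.
Qed.

Lemma angle_c_arg n (v w : 'cV[R]_n) :
  0 <= `|dotc v w| / (normc v * normc w) <= 1.
Proof.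
rewrite divr_ge0 ?mulr_ge0 ?normc_ge0//=.
have [->|h] := eqVneq (normc v * normc w) 0; first by rewrite invr0 mulr0.
by rewrite ler_pdivrMr ?mul1r ?dotc_CS// lt0r h mulr_ge0 ?normc_ge0.
Qed.

Lemma angle_c_ge0 n (v w : 'cV[R]_n) : 0 <= angle_c v w.
Proof.
by have /andP[h0 h1] := angle_c_arg v w; apply: acos_ge0; rewrite h1 andbT; lra.
Qed.

Lemma angle_c_le2 n (v w : 'cV[R]_n) : angle_c v w <= 2.
Proof.
rewrite /angle_c (le_trans (acos_le_sin (angle_c_arg v w)))//.
rewrite -[leRHS]mulr1 ler_pM2l//.
by rewrite -[leRHS]sqrtr1 ler_wsqrtr// gerBl sqr_ge0.
Qed.

(** The sine of the angle is the distance from [v] to the line of [w], divided by [|v|]. It is read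
    off the Gram determinant of [v] and [w], which does not change when a multiple of [w] is added
    to [v]. *)
Lemma angle_c_le_dist n (v w u : 'cV[R]_n) (t : R) : v != 0 -> w != 0 ->
  v = t *: w + u -> angle_c v w <= 2 * (normc u / normc v).
Proof.
move=> v0 w0 E; rewrite /angle_c (le_trans (acos_le_sin (angle_c_arg v w)))//.
rewrite ler_pM2l//.
have nv : 0 < normc v by rewrite normc_gt0.
have nw : 0 < normc w by rewrite normc_gt0.
rewrite -ler_sqr ?nnegrE ?sqrtr_ge0 ?divr_ge0 ?normc_ge0// sqr_sqrtr; last first.
  rewrite subr_ge0 -[leRHS](expr1n _ 2) ler_sqr ?nnegrE//.
    by have /andP[] := angle_c_arg v w.
  by have /andP[] := angle_c_arg v w.
rewrite !expr_div_n exprMn real_normK ?num_real// !normc_sqr.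
have vv : 0 < dotc v v by rewrite -normc_sqr exprn_gt0.
have ww : 0 < dotc w w by rewrite -normc_sqr exprn_gt0.
rewrite -(ler_pM2r (mulr_gt0 vv ww)) mulrBl mul1r divfK ?gt_eqF ?mulr_gt0//.
rewrite mulrA divfK ?gt_eqF//.
have -> : dotc v v * dotc w w - dotc v w ^+ 2 = dotc u u * dotc w w - dotc u w ^+ 2.
  by rewrite E !(dotcDl, dotcDr, dotcZl, dotcZr) (dotcC w u); ring.
by rewrite gerBl sqr_ge0.
Qed.

Lemma normc_dist_le_angle n (v w : 'cV[R]_n) : normc v = 1 -> normc w = 1 ->
  0 <= dotc v w -> normc (v - w) <= angle_c v w.
Proof.
move=> v1 w1 vw; rewrite -ler_sqr ?nnegrE ?normc_ge0 ?angle_c_ge0//.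
have := acos_sqr_ge (angle_c_arg v w); rewrite -/(angle_c v w) v1 w1 mulr1 divr1 ger0_norm//.
rewrite normc_sqr !(dotcDl, dotcDr, dotcNl, dotcNr) (dotcC w v) -!normc_sqr v1 w1.
lra.
Qed.

(** A vector expanded at a rate comparable to the top singular value has, in the frame [Q], a first
    coordinate comparable to its norm. A controlled multiple of [w] then cancels the first
    coordinate of [v], and what is left is expanded by at most the second singular value. *)
Lemma svd_contraction n (P Q : 'M[R]_n.+2) (d : 'rV[R]_n.+2) (c : R) v w :
  P *m P^T = 1%:M -> Q *m Q^T = 1%:M ->
  (forall i j : 'I_n.+2, (i <= j)%N -> d 0 j <= d 0 i) -> (forall i, 0 < d 0 i) ->
  0 < c -> v != 0 -> w != 0 ->
  c * d 0 0 * normc v <= normc (P *m diag_mx d *m Q *m v) ->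
  c * d 0 0 * normc w <= normc (P *m diag_mx d *m Q *m w) ->
  angle_c (P *m diag_mx d *m Q *m v) (P *m diag_mx d *m Q *m w) <=
    (4 / c + 2 * (1 + 2 / c) / c) * (d 0 1 / d 0 0).
Proof.
move=> PP QQ ds d0 c0 v0 w0 hv hw.
set h := P *m diag_mx d *m Q in hv hw *; set e := d 0 1 / d 0 0.
have e0 : 0 < e by rewrite divr_gt0.
have nv : 0 < normc v by rewrite normc_gt0.
have nw : 0 < normc w by rewrite normc_gt0.
(* If the gap is too small to be exploited, the bound of every angle by [2] suffices; it accounts
   for the summand [4 / c]. *)
have [ce|ec] := leP (c / 2) e.
  rewrite (le_trans (angle_c_le2 _ _))// mulrDl ler_wpDr//.
    by rewrite mulr_ge0 ?(ltW e0)// divr_ge0 ?(ltW c0)// mulr_ge0// addr_ge0// divr_ge0// ltW.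
  rewrite mulrAC ler_pdivlMr//; lra.
have hE x : normc (h *m x) ^+ 2 = \sum_i (d 0 i * (Q *m x) i 0) ^+ 2.
  rewrite /h -!mulmxA normc_orthogonal// normc_sqr dotcE.
  by apply: eq_bigr => i _; rewrite diag_mulE expr2.
have Qx x : normc x ^+ 2 = \sum_i (Q *m x) i 0 ^+ 2.
  by rewrite -(normc_orthogonal x QQ) normc_sqr dotcE; apply: eq_bigr => i _; rewrite expr2.
have hle x : normc (h *m x) ^+ 2 <= d 0 0 ^+ 2 * (Q *m x) 0 0 ^+ 2 + d 0 1 ^+ 2 * normc x ^+ 2.
  rewrite hE Qx (bigD1 0)//= exprMn lerD2l (bigD1 0 (F := fun i => (Q *m x) i 0 ^+ 2))//= mulrDr.
  apply: ler_wpDl; first by rewrite mulr_ge0// sqr_ge0.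
  rewrite mulr_sumr; apply: ler_sum => i i0; rewrite exprMn ler_wpM2r ?sqr_ge0//.
  rewrite lerXn2r ?nnegrE ?(ltW (d0 _))//; apply: ds.
  by rewrite /= lt0n.
pose t := (Q *m v) 0 0 / (Q *m w) 0 0.
have d00 := d0 0.
have d1E : d 0 1 = e * d 0 0 by rewrite /e divfK// gt_eqF.
(* Since [e < c / 2], the coordinates after the first contribute at most a quarter of
   [(c |w|)^2]. *)
have w'0 : (c / 2 * normc w) ^+ 2 <= (Q *m w) 0 0 ^+ 2.
  have := le_trans (lerXn2r 2 _ _ hw) (hle w).
  rewrite !nnegrE normc_ge0 !mulr_ge0 ?normc_ge0 ?(ltW c0) ?(ltW d00)// => /(_ isT isT).
  rewrite d1E.
  have -> : (c * d 0 0 * normc w) ^+ 2 = d 0 0 ^+ 2 * (c * normc w) ^+ 2 by ring.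
  have -> : d 0 0 ^+ 2 * (Q *m w) 0 0 ^+ 2 + (e * d 0 0) ^+ 2 * normc w ^+ 2 =
     d 0 0 ^+ 2 * ((Q *m w) 0 0 ^+ 2 + (e * normc w) ^+ 2) by ring.
  rewrite ler_pM2l ?exprn_gt0// => H.
  have : (e * normc w) ^+ 2 <= (c / 2 * normc w) ^+ 2.
    have e1 : 0 <= e * normc w by rewrite mulr_ge0 ?normc_ge0// ltW.
    have e2 : 0 <= c / 2 * normc w by rewrite mulr_ge0 ?normc_ge0// divr_ge0// ltW.
    by rewrite ler_sqr ?nnegrE// ler_wpM2r ?normc_ge0// ltW.
  have -> : (c / 2 * normc w) ^+ 2 = (c * normc w) ^+ 2 / 4 by field.
  have := sqr_ge0 (c * normc w); lra.
have w'n : c / 2 * normc w <= `|(Q *m w) 0 0|.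
  by rewrite -ler_sqr ?nnegrE ?mulr_ge0 ?normc_ge0 ?divr_ge0 ?(ltW c0)// real_normK ?num_real.
have w'p : 0 < `|(Q *m w) 0 0|.
  by rewrite (lt_le_trans _ w'n)// mulr_gt0// divr_gt0.
have w'ne : (Q *m w) 0 0 != 0 by rewrite -normr_gt0.
have v'n : `|(Q *m v) 0 0| <= normc v.
  rewrite -ler_sqr ?nnegrE ?normc_ge0// real_normK ?num_real// Qx (bigD1 0)//= lerDl.
  by rewrite sumr_ge0// => i _; rewrite sqr_ge0.
have tn : `|t| * normc w <= 2 / c * normc v.
  rewrite /t normrM normfV mulrAC ler_pdivrMr//.
  have := ler_pM (normr_ge0 _) (normc_ge0 w) v'n (lexx (normc w)) => H1.
  have : normc v * normc w <= 2 / c * normc v * `|(Q *m w) 0 0|.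
    have -> : normc v * normc w = 2 / c * normc v * (c / 2 * normc w).
      by field; rewrite gt_eqF.
    by rewrite ler_wpM2l// mulr_ge0 ?normc_ge0// divr_ge0// ltW.
  exact: le_trans.
pose u := v - t *: w.
have u'0 : (Q *m u) 0 0 = 0.
  have sub_entry (x y : 'cV[R]_n.+2) (r : R) : (x - r *: y) 0 0 = x 0 0 - r * y 0 0.
    by rewrite !mxE.
  by rewrite /u mulmxBr -scalemxAr sub_entry /t divfK ?subrr.
have hu : normc (h *m u) <= d 0 1 * normc u.
  rewrite -ler_sqr ?nnegrE ?normc_ge0 ?mulr_ge0 ?normc_ge0 ?(ltW (d0 _))//.
  by rewrite (le_trans (hle u))// u'0 expr0n /= mulr0 add0r exprMn.
have un : normc u <= (1 + 2 / c) * normc v.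
  by rewrite (le_trans (normcB _ _))// normcZ mulrDl mul1r lerD2l.
have hvp : 0 < normc (h *m v) by rewrite (lt_le_trans _ hv)// !mulr_gt0.
have hwp : 0 < normc (h *m w) by rewrite (lt_le_trans _ hw)// !mulr_gt0.
rewrite (le_trans (@angle_c_le_dist _ _ _ (h *m u) t _ _ _))//.
- by rewrite -normc_gt0.
- by rewrite -normc_gt0.
- by rewrite /u mulmxBr -scalemxAr addrC subrK.
rewrite [leRHS]mulrDl; apply: ler_wpDl; first by rewrite mulr_ge0 ?(ltW e0)// divr_ge0// ltW.
have -> : 2 * (1 + 2 / c) / c * e = 2 * ((1 + 2 / c) / c * e) by ring.
rewrite ler_pM2l// ler_pdivrMr//.
apply: le_trans hu _; rewrite d1E.
have -> : e * d 0 0 * normc u = (e / c) * (c * d 0 0 * normc u) by field; rewrite gt_eqF.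
have -> : (1 + 2 / c) / c * e * normc (h *m v) = (e / c) * ((1 + 2 / c) * normc (h *m v)) by field; rewrite gt_eqF.
rewrite ler_pM2l ?divr_gt0//.
apply: (@le_trans _ _ (c * d 0 0 * ((1 + 2 / c) * normc v))).
  by rewrite ler_pM2l// mulr_gt0.
rewrite mulrCA ler_pM2l// addr_gt0// divr_gt0//.
Qed.

End Angles.

Section SingularValues.
Variables (R : realType) (n : nat).
Hypothesis n0 : (0 < n)%N.
Implicit Types g : 'M[R]_n.

Lemma diag_normc_le (d : 'rV[R]_n) (a : R) v : 0 <= a -> (forall i, `|d 0 i| <= a) ->
  normc (diag_mx d *m v) <= a * normc v.
Proof.
move=> a0 da; rewrite -ler_sqr ?nnegrE ?mulr_ge0 ?normc_ge0//.
rewrite exprMn !normc_sqr !dotcE mulr_sumr; apply: ler_sum => i _.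
rewrite diag_mulE -!expr2 exprMn ler_wpM2r ?sqr_ge0//.
by rewrite -(real_normK (num_real (d 0 i))) ler_sqr ?nnegrE.
Qed.

Lemma normc_mul_le g v : \det g = 1 -> normc (g *m v) <= expR (mu g 0) * normc v.
Proof.
move=> /svd[P [Q [d [PP QQ gE ds dm]]]].
have [d0 m0] := dm (Ordinal n0); rewrite [mu g 0]m0 lnK ?posrE//.
rewrite gE -!mulmxA normc_orthogonal// -(normc_orthogonal v QQ).
apply: diag_normc_le; first exact: ltW.
by move=> i; rewrite gtr0_norm ?ds//; have [] := dm i.
Qed.

Lemma normc_mul_attained g : \det g = 1 ->
  exists2 u, normc u = 1 & normc (g *m u) = expR (mu g 0).
Proof.
move=> /svd[P [Q [d [PP QQ gE ds dm]]]].
have [d0 m0] := dm (Ordinal n0); rewrite [mu g 0]m0 lnK ?posrE//.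
pose e : 'cV[R]_n := delta_mx (Ordinal n0) 0.
have e1 : normc e = 1.
  rewrite /normc dotcE (bigD1 (Ordinal n0))//= !mxE !eqxx mulr1 big1 ?addr0 ?sqrtr1//.
  by move=> i i0; rewrite !mxE (negPf i0) mulr0.
have QT : Q^T *m Q^T^T = 1%:M by rewrite trmxK; exact: mulmx1C.
exists (Q^T *m e); first by rewrite normc_orthogonal.
rewrite gE -!mulmxA normc_orthogonal// [Q *m _]mulmxA QQ mul1mx.
have -> : diag_mx d *m e = d 0 (Ordinal n0) *: e.
  apply/colP => i; rewrite diag_mulE !mxE.
  by case: (eqVneq i (Ordinal n0)) => [->//|_]; rewrite !mulr0.
by rewrite normcZ e1 mulr1 gtr0_norm.
Qed.

Lemma normc_invmx_le g v : \det g = 1 ->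
  normc (invmx g *m v) <= expR (- mu g n.-1) * normc v.
Proof.
move=> dg; have [P [Q [d [PP QQ gE ds dm]]]] := svd dg.
have nl : (n.-1 < n)%N by rewrite prednK.
have [dl ml] := dm (Ordinal nl); rewrite [mu g n.-1]ml expRN lnK ?posrE//.
have gu : g \in unitmx by rewrite unitmxE dg unitr1.
set w := invmx g *m v; have -> : v = g *m w by rewrite /w mulmxA mulmxV// mul1mx.
rewrite ler_pdivlMl// gE -!mulmxA normc_orthogonal// -(normc_orthogonal w QQ).
set x := Q *m w.
rewrite -ler_sqr ?nnegrE ?mulr_ge0 ?normc_ge0 ?(ltW dl)//.
rewrite exprMn !normc_sqr !dotcE mulr_sumr; apply: ler_sum => i _.
rewrite diag_mulE -!expr2 exprMn ler_wpM2r ?sqr_ge0//.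
rewrite ler_sqr ?nnegrE ?(ltW dl)//; last by have [/ltW] := dm i.
by apply: ds => /=; rewrite -ltnS prednK.
Qed.

Lemma det_orthogonal (A : 'M[R]_n) : A *m A^T = 1%:M -> `|\det A| = 1.
Proof.
move=> AA; have := congr1 determinant AA; rewrite det_mulmx det_tr det1 => E.
by apply/eqP; rewrite -sqrp_eq1// real_normK ?num_real// expr2 E.
Qed.

Lemma mu0_ge0 g : \det g = 1 -> 0 <= mu g 0.
Proof.
move=> dg; have [P [Q [d [PP QQ gE ds dm]]]] := svd dg.
have [d0 m0] := dm (Ordinal n0); rewrite [mu g 0]m0 ln_ge0// leNgt; apply/negP => d1.
have : `|\det g| = 1 by rewrite dg normr1.
rewrite gE !det_mulmx !normrM (det_orthogonal PP) (det_orthogonal QQ) mulr1 mul1r det_diag => E.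
have : `|\prod_i d 0 i| <= d 0 (Ordinal n0).
  rewrite normr_prod (bigD1 (Ordinal n0))//= gtr0_norm// ler_piMr ?(ltW d0)//.
  apply: prodr_ile1 => i _; have [di _] := dm i.
  by rewrite normr_ge0 gtr0_norm//= ltW// (le_lt_trans (ds (Ordinal n0) i _)).
by rewrite E leNgt d1.
Qed.

(** The transpose has the same singular values. It is included because hyperplanes are moved by the
    inverse transpose. *)
Lemma angle_contraction (c : R) : 0 < c -> exists2 C : R, 0 < C &
  forall g h v w, \det g = 1 -> (h = g \/ h = g^T) -> v != 0 -> w != 0 ->
    c * expR (mu g 0) * normc v <= normc (h *m v) ->
    c * expR (mu g 0) * normc w <= normc (h *m w) ->
    angle_c (h *m v) (h *m w) <= C * expR (- (mu g 0 - mu g 1)).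
Proof.
move=> c0; exists (2 + (4 / c + 2 * (1 + 2 / c) / c)).
  by rewrite !addr_gt0// ?divr_gt0// mulr_gt0// addr_gt0// divr_gt0.
move=> g h v w dg gh v0 w0.
have C0 : 0 <= 4 / c + 2 * (1 + 2 / c) / c.
  by rewrite !addr_ge0// ?divr_ge0 ?(ltW c0)// mulr_ge0// addr_ge0// divr_ge0// ltW.
have [P [Q [d [PP QQ gE ds dm]]]] := svd dg.
(* For [n = 1] the index in [mu g 1] is out of range: [nth] returns [0] and [ln 0 = 0]. As
   [mu g 0 = 0] too, the gap is [0], and the summand [2] of the constant covers this case. *)
have [n1|n1] := ltnP 1 n; last first.
  have n1E : n = 1%N by lia.
  move=> _ _; rewrite (le_trans (angle_c_le2 _ _))//.
  rewrite (_ : expR _ = 1) ?mulr1 ?lerDl//.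
  have dE : d 0 (Ordinal n0) = 1.
    have : `|\det g| = 1 by rewrite dg normr1.
    rewrite gE !det_mulmx !normrM (det_orthogonal PP) (det_orthogonal QQ) mulr1 mul1r det_diag.
    rewrite (bigD1 (Ordinal n0))//= big1 ?mulr1 => [|i /eqP ni]; last first.
      by exfalso; apply: ni; apply/val_inj => /=; case: i => /= i; lia.
    by rewrite gtr0_norm//; have [] := dm (Ordinal n0).
  have [_ ->] := dm (Ordinal n0); rewrite dE ln1 sub0r opprK.
  suff -> : mu g 1 = 0 by rewrite expR0.
  rewrite /mu nth_default ?ln0// /desc_eigs; case: xgetP => [s _ [sn _]|]; last by [].
  by rewrite sn.
have [d0 m0] := dm (Ordinal n0); have [d1 m1] := dm (Ordinal n1).
rewrite [mu g 0]m0 [mu g 1]m1 opprB expRD expRN !lnK ?posrE//.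
have [P' [Q' [PP' QQ' hE]]] : exists P' Q' : 'M[R]_n, [/\ P' *m P'^T = 1%:M,
    Q' *m Q'^T = 1%:M & h = P' *m diag_mx d *m Q'].
  case: gh => ->; first by exists P, Q.
  exists Q^T, P^T; rewrite !trmxK; split; [exact: mulmx1C|exact: mulmx1C|].
  by rewrite gE !trmx_mul tr_diag_mx mulmxA.
have dp i : 0 < d 0 i by have [] := dm i.
rewrite hE; clear gE m0 m1 dm gh hE h PP QQ P Q dg => hv hw.
move: n1 n0 P' Q' d PP' QQ' ds d0 d1 v w v0 w0 hv hw dp.
case: n => [//|[//|m]] n1 n0' P Q d PP QQ ds d0 d1 v w v0 w0.
rewrite (_ : Ordinal n0' = 0); last exact/val_inj.
rewrite (_ : Ordinal n1 = 1); last exact/val_inj.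
move=> hv hw dp.
apply: le_trans (svd_contraction PP QQ ds dp c0 v0 w0 hv hw) _.
apply: ler_wpM2r; first by rewrite divr_ge0// ltW.
by rewrite lerDr.
Qed.

End SingularValues.

(** * The Hilbert distance on the cone *)

Section Cone.
Variables (R : realType) (n : nat).
Implicit Types (Om : set 'cV[R]_n) (u v w x y z : 'cV[R]_n) (a b s t : R).

(** [Om] is a double cone of representatives; the sign of the chart selects one of its two convex
    halves. *)
Definition cone Om : set 'cV[R]_n := [set v | Om v /\ 0 < pairing (chart Om) v].

(** On a slice of the cone its logarithm is the non-symmetric Funk distance, of which [d_H] is the
    symmetrisation. *)
Definition gauge Om x y : R := inf [set a | cone Om (a *: x - y)].

Variable Om : set 'cV[R]_n.
Hypothesis OmP : properly_convex_open Om.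
Local Notation phi := (chart Om).
Local Notation K := (cone Om).
Local Notation M := (gauge Om).

Lemma chartP : good_chart phi Om.
Proof. by case: OmP => _ [_ [_ H]]; exact: (xgetPex 0 H). Qed.

Lemma Om_scale t v : t != 0 -> Om v -> Om (t *: v).
Proof. by case: OmP => -[_ H] _ t0 Ov; exact: H. Qed.

Lemma cone_scale t v : 0 < t -> K v -> K (t *: v).
Proof.
by move=> t0 [Ov pv]; split; [apply: Om_scale => //; rewrite gt_eqF|rewrite pairingZ mulr_gt0].
Qed.

Lemma cone_add v w : K v -> K w -> K (v + w).
Proof.
move=> [Ov pv] [Ow pw]; have p0 : 0 < pairing phi v + pairing phi w by rewrite addr_gt0.
split; last by rewrite pairingD.
have [_ [conv _]] := chartP.
pose t := pairing phi w / (pairing phi v + pairing phi w).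
have sl x : Om x -> 0 < pairing phi x -> chart_slice phi Om ((pairing phi x)^-1 *: x).
  by move=> Ox px; split; [apply: Om_scale => //; rewrite invr_eq0 gt_eqF|rewrite pairingZ mulVf// gt_eqF].
have := conv _ _ t (sl _ Ov pv) (sl _ Ow pw).
rewrite divr_ge0 ?(ltW p0) ?(ltW pw)//= ler_pdivrMr// mul1r lerDr (ltW pv) => /(_ isT).
move=> /(Om_scale (lt0r_neq0 p0)).
rewrite scalerDr !scalerA.
by congr (Om (_ + _)); rewrite -[RHS]scale1r; congr (_ *: _); rewrite /t; field; rewrite !gt_eqF.
Qed.

(** The homogeneous form of boundedness in the chart: on the cone, [phi] is comparable to the
    norm. *)
Lemma cone_normc : exists2 B : R, 0 < B & forall v, K v -> normc v <= B * pairing phi v.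
Proof.
have [_ [_ [B HB]]] := chartP; exists (`|B| + 1); first by rewrite ltr_wpDl.
move=> v [Ov pv].
have := HB ((pairing phi v)^-1 *: v).
rewrite normcZ ger0_norm ?invr_ge0 ?(ltW pv)// ler_pdivrMl// mulrC => /(_ _)/le_trans; apply.
  split; last by rewrite pairingZ mulVf// gt_eqF.
  by apply: Om_scale => //; rewrite invr_eq0 gt_eqF.
by rewrite ler_wpM2r ?(ltW pv)// (le_trans (ler_norm B))// lerDl.
Qed.

Lemma cone_neq0 v : K v -> v != 0.
Proof. by move=> [_]; apply: contraTneq => ->; rewrite pairingE /dotc mulmx0 mxE ltxx. Qed.

Lemma cone_open v : K v -> exists2 r : R, 0 < r & forall u, normc u <= r -> K (v + u).
Proof.
move=> [Ov pv]; have [_ [oOm _]] := OmP.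
have [e e0 He] := open_normcP oOm Ov.
pose q := normrow phi + 1.
have q0 : 0 < q by rewrite ltr_wpDl// normrowE normc_ge0.
exists (Num.min (e / 2) (pairing phi v / 2 / q)).
  by rewrite lt_min !divr_gt0.
move=> u; rewrite le_min => /andP[ue up]; split.
  by apply: He; rewrite addrC addKr; lra.
rewrite pairingD.
have : `|pairing phi u| <= pairing phi v / 2.
  rewrite (le_trans (pairing_le _ _))//.
  move: up; rewrite ler_pdivlMr// => up; apply: le_trans up; rewrite mulrC ler_wpM2l ?normc_ge0//.
  by rewrite /q lerDl.
by rewrite ler_norml => /andP[]; lra.
Qed.

Lemma Om_cone v : Om v -> K v \/ K (- v).
Proof.
move=> Ov; have [H _] := chartP.
have := H _ Ov; rewrite neq_lt => /orP[pv|pv]; [right|left]; split=> //.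
  by rewrite -scaleN1r; apply: Om_scale.
by rewrite pairingN oppr_gt0.
Qed.

Lemma cone_normalize v : Om v -> K (normalize phi v).
Proof.
move=> Ov; have [H _] := chartP; have p0 := H _ Ov.
split; first by apply: Om_scale => //; rewrite invr_eq0.
by rewrite /normalize pairingZ mulVf.
Qed.

Lemma pairing_normalize v : Om v -> pairing phi (normalize phi v) = 1.
Proof. by move=> Ov; have [H _] := chartP; rewrite /normalize pairingZ mulVf ?H. Qed.

Lemma gauge_lbound x y a : K x -> K (a *: x - y) -> pairing phi y / pairing phi x <= a.
Proof.
move=> [_ px] [_]; rewrite pairingD pairingN pairingZ subr_gt0 => /ltW.
by rewrite ler_pdivrMr.
Qed.

Lemma gauge_has_inf x y : K x -> has_inf [set a | K (a *: x - y)].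
Proof.
move=> Kx; split; last first.
  by exists (pairing phi y / pairing phi x) => a /= Ha; exact: gauge_lbound.
have [r r0 Hr] := cone_open Kx.
have d0 : 0 < r / (normc y + 1) by rewrite divr_gt0// ltr_wpDl ?normc_ge0.
exists (r / (normc y + 1))^-1 => /=.
set d := r / _ in d0 *.
have -> : d^-1 *: x - y = d^-1 *: (x - d *: y).
  by rewrite scalerBr scalerA mulVf ?scale1r// gt_eqF.
apply: cone_scale; first by rewrite invr_gt0.
apply: Hr; rewrite normcN normcZ gtr0_norm// /d mulrAC ler_pdivrMr ?ltr_wpDl ?normc_ge0//.
by rewrite ler_wpM2l ?(ltW r0)// lerDl.
Qed.

Lemma gauge_le x y a : K x -> K (a *: x - y) -> M x y <= a.
Proof. by move=> Kx Ka; apply: ge_inf => //; have [] := gauge_has_inf y Kx. Qed.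

Lemma gauge_lt x y a : K x -> M x y < a -> K (a *: x - y).
Proof.
move=> Kx /(inf_lt (gauge_has_inf y Kx).1) [b /= Kb ba].
have -> : a *: x - y = (b *: x - y) + (a - b) *: x.
  by rewrite scalerBl addrAC subrKC.
by apply: cone_add => //; apply: cone_scale; rewrite ?subr_gt0.
Qed.

Lemma gauge_ge x y b : K x -> (forall a, K (a *: x - y) -> b <= a) -> b <= M x y.
Proof. by move=> Kx Hb; apply: lb_le_inf => //; have [] := gauge_has_inf y Kx. Qed.

Lemma gauge_gt0 x y : K x -> K y -> 0 < M x y.
Proof.
move=> Kx Ky; apply: (@lt_le_trans _ _ (pairing phi y / pairing phi x)).
  by case: Kx Ky => _ px [_ py]; rewrite divr_gt0.
by apply: gauge_ge => // a; exact: gauge_lbound.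
Qed.

(* A functional that is nonnegative on the cone is monotone for the cone order,
   of which [gauge x y] is the best constant in [y <= a x]. *)
Lemma gauge_pairing (p : 'rV[R]_n) x y : (forall v, K v -> 0 <= pairing p v) ->
  K x -> pairing p y <= M x y * pairing p x.
Proof.
move=> Hp Kx; have px := Hp _ Kx.
rewrite leNgt; apply/negP => H.
have h : 0 < (pairing p y - M x y * pairing p x) / (pairing p x + 1).
  by rewrite divr_gt0 ?subr_gt0// ltr_wpDl.
set h' := _ / _ in h.
have l : M x y < M x y + h' by rewrite ltrDl.
have := Hp _ (gauge_lt Kx l).
rewrite pairingD pairingN pairingZ mulrDl.
have : h' * pairing p x < pairing p y - M x y * pairing p x.
  rewrite /h' mulrAC ltr_pdivrMr ?ltr_wpDl// ltr_pM2l ?subr_gt0//; lra.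
lra.
Qed.

Lemma gauge_triangle x y z : K x -> K y -> K z -> M x z <= M x y * M y z.
Proof.
move=> Kx Ky Kz; have m1 := gauge_gt0 Kx Ky; have m2 := gauge_gt0 Ky Kz.
have H a b : M x y < a -> M y z < b -> M x z <= a * b.
  move=> xa yb; apply: gauge_le => //.
  have b0 : 0 < b by lra.
  have -> : (a * b) *: x - z = b *: (a *: x - y) + (b *: y - z).
    by rewrite scalerBr scalerA addrA subrK mulrC.
  by apply: cone_add; [apply: cone_scale => //|]; apply: gauge_lt.
rewrite leNgt; apply/negP => L.
(* As [e <= 1], the product [(M x y + e) * (M y z + e)] stays below [M x z]. *)
pose e := Num.min 1 ((M x z - M x y * M y z) / (M x y + M y z + 2)).
have s0 : 0 < M x y + M y z + 2 by lra.
have e0 : 0 < e by rewrite lt_min ltr01 divr_gt0// subr_gt0.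
have e1 : e <= 1 by rewrite ge_min lexx.
have e2 : e * (M x y + M y z + 2) <= M x z - M x y * M y z.
  by rewrite -ler_pdivlMr// ge_min lexx orbT.
have := H (M x y + e) (M y z + e); rewrite !ltrDl => /(_ e0 e0).
nra.
Qed.

Lemma gauge_scale s t x y : 0 < s -> 0 < t -> K x -> K y ->
  M (s *: x) (t *: y) = t / s * M x y.
Proof.
have half s' t' x' y' : 0 < s' -> 0 < t' -> K x' -> K y' ->
    M (s' *: x') (t' *: y') <= t' / s' * M x' y'.
  move=> s0 t0 Kx Ky; have Ksx := cone_scale s0 Kx.
  rewrite leNgt; apply/negP => L.
  have Ha : (t' / s' * M x' y' + M (s' *: x') (t' *: y')) / 2 < M (s' *: x') (t' *: y') by lra.
  have Hb : M x' y' < s' / t' * ((t' / s' * M x' y' + M (s' *: x') (t' *: y')) / 2).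
    by rewrite -ltr_pdivrMl ?divr_gt0// invf_div; lra.
  have := gauge_lt Kx Hb.
  set c := _ / 2 in Ha Hb *; move=> Kc.
  have := gauge_le Ksx (_ : K (c *: (s' *: x') - t' *: y')).
  rewrite leNgt Ha => /(_ _)/negP; apply.
  - have -> : c *: (s' *: x') - t' *: y' = t' *: ((s' / t' * c) *: x' - y').
      rewrite scalerBr !scalerA; congr (_ *: _ - _).
      by field; rewrite gt_eqF.
    exact: cone_scale.
  - by [].
move=> s0 t0 Kx Ky; apply/eqP; rewrite eq_le half//=.
have := half s^-1 t^-1 (s *: x) (t *: y).
rewrite !scalerA !mulVf ?gt_eqF// !scale1r !invr_gt0 => /(_ s0 t0 (cone_scale s0 Kx) (cone_scale t0 Ky)).
by rewrite invrK [_ * s]mulrC -ler_pdivrMl ?divr_gt0// invf_div.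
Qed.

Lemma gaugexx x : K x -> M x x = 1.
Proof.
move=> Kx; apply/eqP; rewrite eq_le; apply/andP; split.
  apply/ler_addgt0Pl => e e0; apply: gauge_le => //.
  rewrite scalerDl scale1r addrK.
  exact: cone_scale.
by apply: gauge_ge => // a /(gauge_lbound Kx); rewrite divff// gt_eqF//; case: Kx.
Qed.

Lemma cone_segment s x y : 0 <= s <= 1 -> K x -> K y -> K ((1 - s) *: x + s *: y).
Proof.
move=> /andP[s0 s1] Kx Ky.
have [->|s0'] := eqVneq s 0; first by rewrite subr0 scale1r scale0r addr0.
have [->|s1'] := eqVneq s 1; first by rewrite subrr scale1r scale0r add0r.
apply: cone_add; apply: cone_scale => //; last by rewrite lt0r s0'.
by rewrite subr_gt0 lt_neqAle s1'.
Qed.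

(* Hence [M x p * M p y = M x y]: segments are geodesic. *)
Lemma gauge_segment s x y : 0 <= s <= 1 -> K x -> K y ->
  let p := (1 - s) *: x + s *: y in let a := M x y in
  M x p = 1 - s + s * a /\ M p y = a / (1 - s + s * a).
Proof.
move=> s01 Kx Ky p a; have Kp : K p by exact: cone_segment.
have a0 : 0 < a by exact: gauge_gt0.
move: (s01) => /andP[s0 s1].
have q0 : 0 < 1 - s + s * a.
  have [->|s0'] := eqVneq s 0; first by rewrite subr0 mul0r addr0.
  by rewrite ltr_wpDl ?subr_ge0// mulr_gt0// lt0r s0'.
have h1 : M x p <= 1 - s + s * a.
  apply/ler_addgt0Pl => e e0; apply: gauge_le => //.
  have -> : (e + (1 - s + s * a)) *: x - p =
     s *: ((a + e) *: x - y) + ((1 - s) * e) *: x.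
    by apply/matrixP => i j; rewrite /p !mxE; ring.
  have Ka : K ((a + e) *: x - y) by apply: gauge_lt => //; rewrite ltrDl.
  have [->|s0'] := eqVneq s 0.
    by rewrite scale0r add0r subr0 mul1r; apply: cone_scale.
  have [->|s1'] := eqVneq s 1.
    by rewrite subrr mul0r scale0r addr0 scale1r.
  apply: cone_add; apply: cone_scale => //; first by rewrite lt0r s0'.
  by rewrite mulr_gt0// subr_gt0 lt_neqAle s1'.
have h2 : M p y <= a / (1 - s + s * a).
  apply/ler_addgt0Pl => e e0; apply: gauge_le => //.
  set b := e + _.
  have b0 : 0 < b by rewrite ltr_pwDl// divr_ge0 ?(ltW a0) ?(ltW q0).
  have [s1'|s1'] := eqVneq s 1.
    have bE : b = 1 + e by rewrite /b s1' subrr mul1r add0r divff ?gt_eqF// addrC.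
    rewrite /p s1' subrr scale0r add0r scale1r bE scalerDl scale1r addrC addKr.
    exact: cone_scale.
  have s1s : 0 < 1 - s by rewrite subr_gt0 lt_neqAle s1'.
  (* [b p - y = b (1 - s) x + (b s - 1) y] is a sum of cone vectors if [b s >= 1]; otherwise it is a
     positive multiple of some [a' x - y] with [a' > a]. *)
  have [sb|sb] := leP 1 (b * s).
    have -> : b *: p - y = (b * (1 - s)) *: x + (b * s - 1) *: y.
      by rewrite /p scalerDr !scalerA scalerBl scale1r addrA.
    have Kx' : K ((b * (1 - s)) *: x) by apply: cone_scale => //; rewrite mulr_gt0.
    move: sb; rewrite le_eqVlt => /orP[/eqP <-|sb].
      by rewrite subrr scale0r addr0.
    by apply: cone_add => //; apply: cone_scale; rewrite ?subr_gt0.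
  have sb' : 0 < 1 - b * s by rewrite subr_gt0.
  have -> : b *: p - y = (1 - b * s) *: ((b * (1 - s) / (1 - b * s)) *: x - y).
    rewrite /p scalerDr scalerBr !scalerA mulrCA divff ?gt_eqF// mulr1.
    by rewrite [(1 - b * s) *: y]scalerBl scale1r opprB addrA addrAC.
  apply: cone_scale => //; apply: gauge_lt => //.
  rewrite ltr_pdivlMr// -/a.
  have : a / (1 - s + s * a) < b by rewrite /b ltrDr.
  rewrite ltr_pdivrMr//; lra.
have p1 := gauge_gt0 Kx Kp; have p2 := gauge_gt0 Kp Ky.
(* The two upper bounds have product [a], so the triangle inequality makes both of them
   equalities. *)
have tr : a <= M x p * M p y by exact: gauge_triangle.
have aE : a = (1 - s + s * a) * (a / (1 - s + s * a)) by field; rewrite gt_eqF.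
have q1 : 0 < a / (1 - s + s * a) by rewrite divr_gt0.
split; apply/eqP; rewrite eq_le ?h1 ?h2 /= leNgt; apply/negP => L.
  have : M x p * M p y < a by rewrite [ltRHS]aE; apply: (lt_le_trans (y := (1 - s + s * a) * M p y)); rewrite ?ltr_pM2r ?ler_pM2l.
  by rewrite ltNge tr.
have : M x p * M p y < a by rewrite [ltRHS]aE; apply: (le_lt_trans (y := (1 - s + s * a) * M p y)); rewrite ?ler_pM2r ?ltr_pM2l.
by rewrite ltNge tr.
Qed.

End Cone.

Section Hilbert.
Variables (R : realType) (n : nat).
Implicit Types (u v w x y z : 'cV[R]_n) (a b s t : R).
Variable Om : set 'cV[R]_n.
Hypothesis OmP : properly_convex_open Om.
Local Notation phi := (chart Om).
Local Notation K := (cone Om).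
Local Notation M := (gauge Om).
Local Notation d := (hilbert_dist Om).

(** If [M x y] were [1], then [(1 + h) x - y] would be in the cone with [phi]-value [h] for all
    [h > 0], hence of norm [O(h)], and [x = y] in the limit. *)
Lemma gauge_gt1 x y : K x -> K y -> pairing phi x = 1 -> pairing phi y = 1 ->
  x != y -> 1 < M x y.
Proof.
move=> Kx Ky px py xy.
have m1 : 1 <= M x y.
  by apply: (gauge_ge OmP) => // a /(gauge_lbound Kx); rewrite px py divr1.
rewrite lt_neqAle m1 andbT eq_sym; apply: contra xy => /eqP m.
have [B B0 HB] := cone_normc OmP.
rewrite -subr_eq0 -normc_eq0 eq_le normc_ge0 andbT.
apply/ler_addgt0Pr => e e0; rewrite add0r.
have s0 : 0 < B + normc x + 1 by have := normc_ge0 x; lra.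
have h0 : 0 < e / (B + normc x + 1) by rewrite divr_gt0.
set h := e / _ in h0.
have Kh : K ((1 + h) *: x - y) by apply: (gauge_lt OmP) => //; rewrite m ltrDl.
have := HB _ Kh; rewrite pairingD pairingN pairingZ px py (_ : (1 + h) * 1 - 1 = h); last by ring.
move=> L.
have -> : x - y = ((1 + h) *: x - y) - h *: x.
  by apply/matrixP => i j; rewrite !mxE; ring.
rewrite (le_trans (normcB _ _))// normcZ gtr0_norm//.
have : h * (B + normc x + 1) = e.
  by rewrite /h divfK// gt_eqF.
have := normc_ge0 x; nra.
Qed.

Lemma chord_mem x y t : K x -> K y -> pairing phi x = 1 -> pairing phi y = 1 ->
  Om (x + t *: (y - x)) -> K (x + t *: (y - x)).
Proof.
move=> Kx Ky px py O; split=> //.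
by rewrite pairingD pairingZ pairingD pairingN px py subrr mulr0 addr0.
Qed.

(** For [u > 0], [x - u (y - x)] is [u] times [((1 + u) / u) x - y], so the chord leaves the cone on
    the side of [x] where [(1 + u) / u = M x y], that is at [u = 1 / (M x y - 1)]. *)
Lemma chord_lower x y t : K x -> K y -> pairing phi x = 1 -> pairing phi y = 1 ->
  x != y -> Om (x + t *: (y - x)) -> - (M x y - 1)^-1 <= t.
Proof.
move=> Kx Ky px py xy /(chord_mem Kx Ky px py) Kt.
have m1 := gauge_gt1 Kx Ky px py xy.
have [t0|t0] := leP 0 t.
  by apply: le_trans t0; rewrite oppr_le0 invr_ge0; lra.
rewrite lerNl.
have u0 : 0 < - t by rewrite oppr_gt0.
have : M x y <= (1 - t) / - t.
  apply: (gauge_le OmP) => //.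
  have -> : ((1 - t) / - t) *: x - y = (- t)^-1 *: (x + t *: (y - x)).
    apply/matrixP => i j; rewrite !mxE; field; rewrite ?oppr_eq0; lra.
  by apply: (cone_scale OmP) => //; rewrite invr_gt0.
rewrite ler_pdivlMr// => H.
rewrite -[leRHS]mul1r ler_pdivlMr; last by lra.
lra.
Qed.

Lemma chord_near x y (u : R) : K x -> K y -> pairing phi x = 1 -> pairing phi y = 1 ->
  x != y -> 0 < u -> u < (M x y - 1)^-1 -> Om (x - u *: (y - x)).
Proof.
move=> Kx Ky px py xy u0; have m1 := gauge_gt1 Kx Ky px py xy.
rewrite -[ltRHS]mul1r ltr_pdivlMr ?subr_gt0// => u1.
have : K (((1 + u) / u) *: x - y).
  by apply: (gauge_lt OmP) => //; rewrite ltr_pdivlMr//; lra.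
move=> /(cone_scale OmP u0)[].
have -> // : u *: (((1 + u) / u) *: x - y) = x - u *: (y - x).
by apply/matrixP => i j; rewrite !mxE; field; rewrite gt_eqF.
Qed.

Lemma chord_inf x y : K x -> K y -> pairing phi x = 1 -> pairing phi y = 1 -> x != y ->
  inf [set t | Om (x + t *: (y - x))] = - (M x y - 1)^-1.
Proof.
move=> Kx Ky px py xy; set I := [set _ | _].
have m1 := gauge_gt1 Kx Ky px py xy.
have lb : lbound I (- (M x y - 1)^-1).
  by move=> t; exact: chord_lower.
have I0 : I !=set0 by exists 0; rewrite /I /= scale0r addr0; case: Kx.
apply/eqP; rewrite eq_le lb_le_inf// andbT.
have v0 : 0 < (M x y - 1)^-1 by rewrite invr_gt0 subr_gt0.
set V := _^-1 in v0 lb *.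
apply/ler_addgt0Pr => e e0.
pose u := V - Num.min (e / 2) (V / 2).
have h1 : Num.min (e / 2) (V / 2) <= V / 2 by rewrite ge_min lexx orbT.
have h2 : Num.min (e / 2) (V / 2) <= e / 2 by rewrite ge_min lexx.
have h3 : 0 < Num.min (e / 2) (V / 2) by rewrite lt_min !divr_gt0.
have : I (- u).
  rewrite /I/= scaleNr; apply: chord_near => //; rewrite -?/V /u; lra.
move=> /(ge_inf (ex_intro _ _ lb)) /le_trans; apply; rewrite /u; lra.
Qed.

(** The substitution [t |-> 1 - t] exchanges the two ends of the chord. *)
Lemma chord_sup x y : K x -> K y -> pairing phi x = 1 -> pairing phi y = 1 -> x != y ->
  sup [set t | Om (x + t *: (y - x))] = 1 + (M y x - 1)^-1.
Proof.
move=> Kx Ky px py xy.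
have yx : y != x by rewrite eq_sym.
have := chord_inf Ky Kx py px yx.
rewrite /inf => /eqP; rewrite eqr_opp => /eqP <-.
set I := [set _ | _]; set J := [set _ | _].
have IJ : I = [set 1 + t | t in -%R @` J].
  apply/seteqP; split=> [t It|_ [_ [t Jt <-] <-]].
    exists (t - 1); last by rewrite addrC subrK.
    exists (1 - t); last by rewrite opprB.
    rewrite /J /=; congr (Om _) : It.
    by apply/matrixP => i j; rewrite !mxE; ring.
  rewrite /I /=; congr (Om _) : Jt.
  by apply/matrixP => i j; rewrite !mxE; ring.
have lb : lbound J (- (M y x - 1)^-1) by move=> t; exact: chord_lower.
have hs : has_sup (-%R @` J).
  split; last by exists ((M y x - 1)^-1) => _ [t Jt <-]; rewrite lerNl lb.
  by exists (- 0), 0 => //; rewrite /J /= scale0r addr0; case: Ky.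
rewrite IJ.
have -> : [set 1 + t | t in -%R @` J] = [set x + y | x in [set 1] & y in -%R @` J].
  apply/seteqP; split=> [_ [t Jt <-]|_ [_ -> [t Jt <-]]]; last by exists t.
  by exists 1 => //; exists t.
by rewrite sup_sumE// ?sup1//; exact: has_sup1.
Qed.

Lemma hilbert_slice x y : K x -> K y -> pairing phi x = 1 -> pairing phi y = 1 ->
  d x y = ln (M x y * M y x) / 2.
Proof.
move=> Kx Ky px py; rewrite /hilbert_dist /normalize px py invr1 !scale1r.
case: eqP => [<-|/eqP xy]; first by rewrite (gaugexx OmP)// mulr1 ln1 mul0r.
have yx : y != x by rewrite eq_sym.
rewrite chord_inf// chord_sup//.
have a1 := gauge_gt1 Kx Ky px py xy; have b1 := gauge_gt1 Ky Kx py px yx.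
set a := M x y in a1 *; set b := M y x in b1 *.
congr (ln _ / 2).
have nx : 0 < normc (y - x) by rewrite normc_gt0 subr_eq0.
have A0 : 0 < (a - 1)^-1 by rewrite invr_gt0; lra.
have B0 : 0 < (b - 1)^-1 by rewrite invr_gt0; lra.
have -> : x + (1 + (b - 1)^-1) *: (y - x) - x = (1 + (b - 1)^-1) *: (y - x).
  by rewrite addrC addKr.
have -> : y - (x + - (a - 1)^-1 *: (y - x)) = (1 + (a - 1)^-1) *: (y - x).
  by apply/matrixP => i j; rewrite !mxE; ring.
have -> : x + - (a - 1)^-1 *: (y - x) - x = - (a - 1)^-1 *: (y - x).
  by rewrite addrC addKr.
have -> : x + (1 + (b - 1)^-1) *: (y - x) - y = (b - 1)^-1 *: (y - x).
  by apply/matrixP => i j; rewrite !mxE; ring.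
(* With [A = 1 / (a - 1)] and [B = 1 / (b - 1)], the cross-ratio is
   [(1 + A) (1 + B) / (A B) = a b]. *)
rewrite !normcZ normrN !gtr0_norm ?addr_gt0//.
by field; rewrite !gt_eqF//; lra.
Qed.

Lemma hilbert_normalize x y : Om x -> Om y ->
  d x y = d (normalize phi x) (normalize phi y).
Proof.
move=> Ox Oy; rewrite /hilbert_dist.
have E z : Om z -> normalize phi (normalize phi z) = normalize phi z.
  by move=> Oz; rewrite {1}/normalize (pairing_normalize OmP Oz) invr1 scale1r.
by rewrite !E.
Qed.

Lemma hilbert_gauge x y : K x -> K y -> d x y = ln (M x y * M y x) / 2.
Proof.
move=> Kx Ky; have [Ox px] := Kx; have [Oy py] := Ky.
rewrite (hilbert_normalize Ox Oy).
rewrite hilbert_slice ?(pairing_normalize OmP)//; [|exact: cone_normalize..].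
rewrite /normalize !(gauge_scale OmP) ?invr_gt0//.
by congr (ln _ / 2); field; rewrite !gt_eqF.
Qed.

Lemma hilbert_scale s t x y : Om x -> Om y -> s != 0 -> t != 0 ->
  d (s *: x) (t *: y) = d x y.
Proof.
move=> Ox Oy s0 t0; rewrite /hilbert_dist.
have [H _] := chartP OmP.
have E r z : Om z -> r != 0 -> normalize phi (r *: z) = normalize phi z.
  move=> Oz r0; rewrite /normalize pairingZ scalerA; congr (_ *: z).
  by field; rewrite r0 H.
by rewrite !E.
Qed.

Lemma hilbert_sym x y : Om x -> Om y -> d x y = d y x.
Proof.
move=> Ox Oy.
rewrite (hilbert_normalize Ox Oy) (hilbert_normalize Oy Ox).
have Kx := cone_normalize OmP Ox; have Ky := cone_normalize OmP Oy.
by rewrite (hilbert_gauge Kx Ky) (hilbert_gauge Ky Kx); congr (ln _ / 2); rewrite mulrC.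
Qed.

Lemma hilbert_triangle x y z : Om x -> Om y -> Om z -> d x z <= d x y + d y z.
Proof.
move=> Ox Oy Oz.
rewrite (hilbert_normalize Ox Oy) (hilbert_normalize Oy Oz) (hilbert_normalize Ox Oz).
have := cone_normalize OmP Ox; have := cone_normalize OmP Oy; have := cone_normalize OmP Oz.
set x' := normalize _ x; set y' := normalize _ y; set z' := normalize _ z => Kz Ky Kx.
have g0 u v : K u -> K v -> 0 < M u v by exact: gauge_gt0.
rewrite (hilbert_gauge Kx Ky) (hilbert_gauge Ky Kz) (hilbert_gauge Kx Kz).
rewrite -mulrDl ler_pM2r ?invr_gt0//.
rewrite -lnM ?posrE ?mulr_gt0 ?g0// ler_ln ?posrE ?mulr_gt0 ?g0//.
rewrite [leRHS](_ : _ = (M x' y' * M y' z') * (M z' y' * M y' x')); last by ring.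
by rewrite ler_pM ?(gauge_triangle OmP) ?ltW ?g0.
Qed.

Lemma hilbertxx x : Om x -> d x x = 0.
Proof. by move=> Ox; rewrite /hilbert_dist eqxx. Qed.

Lemma hilbert_segment x y t : K x -> K y -> 0 <= t <= d x y ->
  exists2 s, 0 <= s <= 1 &
    let p := (1 - s) *: x + s *: y in d x p = t /\ d p y = d x y - t.
Proof.
move=> Kx Ky /andP[t0 td].
have a0 := gauge_gt0 OmP Kx Ky; have b0 := gauge_gt0 OmP Ky Kx.
have dE : d x y = ln (M x y * M y x) / 2 by exact: hilbert_gauge.
set a := M x y in a0 dE; set b := M y x in b0 dE.
pose E := expR (2 * t).
have E1 : 1 <= E by rewrite -expR0 ler_expR; lra.
have Eab : E <= a * b.
  rewrite -[leRHS](@lnK _ (a * b)) ?posrE ?mulr_gt0// ler_expR; lra.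
(* By [gauge_segment], the equation [M x p * M p x = E] is linear in [s]: it reads
   [s D = b (E - 1)], and [D] vanishes only for [t = 0]. *)
have [D0|D0] := eqVneq ((a * b - E) + b * (E - 1)) 0.
  have E1' : E = 1.
    have : 0 <= b * (E - 1) by rewrite mulr_ge0 ?(ltW b0)//; lra.
    by nra.
  have t00 : t = 0.
    have := congr1 (@ln R) E1'; rewrite expRK ln1; lra.
  exists 0; first by rewrite lexx ler01.
  have [Ox _] := Kx.
  by rewrite /= subr0 scale1r scale0r addr0 hilbertxx// t00 subr0.
have Dp : 0 < (a * b - E) + b * (E - 1).
  by rewrite lt0r D0 /= addr_ge0 ?subr_ge0// mulr_ge0 ?(ltW b0)// subr_ge0.
set D := _ + _ in D0 Dp; pose s := b * (E - 1) / D.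
have s01 : 0 <= s <= 1.
  rewrite divr_ge0 ?mulr_ge0 ?(ltW b0) ?subr_ge0 ?(ltW Dp)//= ler_pdivrMr// mul1r.
  by rewrite /D lerDr subr_ge0.
exists s => //; set p := _ + _ => /=.
have Kp : K p by exact: (cone_segment OmP).
have [xp py] := gauge_segment OmP s01 Kx Ky.
have s01' : 0 <= 1 - s <= 1 by move: s01 => /andP[]; lra.
have [] := gauge_segment OmP s01' Ky Kx.
have -> : (1 - (1 - s)) *: y + (1 - s) *: x = p.
  by rewrite /p subKr addrC.
rewrite -/b subKr => yp px; rewrite -/p -/a in xp py.
have sD : s * D = b * (E - 1) by rewrite /s divfK.
have q1 : 0 < 1 - s + s * a.
  by rewrite -xp; exact: (gauge_gt0 OmP).
have q2 : 0 < s + (1 - s) * b.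
  by rewrite -yp; exact: (gauge_gt0 OmP).
have dxp : d x p = t.
  rewrite hilbert_gauge// xp px.
  have -> : (1 - s + s * a) * (b / (s + (1 - s) * b)) = E.
    rewrite mulrA.
    have -> : (1 - s + s * a) * b = E * (s + (1 - s) * b).
      by move: sD; rewrite /D => sD; lra.
    by rewrite mulfK// gt_eqF.
  by rewrite /E expRK; field.
split=> //.
have -> : d p y = d x y - d x p.
  apply/eqP; rewrite eq_sym subr_eq (hilbert_gauge Kx Ky) (hilbert_gauge Kp Ky) (hilbert_gauge Kx Kp) -mulrDl; apply/eqP; congr (_ / 2).
  rewrite -lnM ?posrE ?mulr_gt0 ?(gauge_gt0 OmP)//; congr ln.
  rewrite xp px py yp -/a -/b; field.
  by rewrite !gt_eqF.
by rewrite dxp.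
Qed.

End Hilbert.

(** * Separation and supporting hyperplanes of the cone *)

Section Support.
Variables (R : realType) (n : nat).
Implicit Types (u v w x y z : 'cV[R]_n) (a b s t : R).
Variable Om : set 'cV[R]_n.
Hypothesis OmP : properly_convex_open Om.
Local Notation phi := (chart Om).
Local Notation K := (cone Om).
Local Notation M := (gauge Om).
Local Notation d := (hilbert_dist Om).

Lemma cone_closure_add v w : K v -> closure K w -> K (v + w).
Proof.
move=> Kv /closure_normcP cw; have [r r0 Hr] := cone_open OmP Kv.
have [w' Kw' ww'] := cw r r0.
have -> : v + w = (v + (w - w')) + w'.
  by apply/matrixP => i j; rewrite !mxE; ring.
by apply: (cone_add OmP) => //; apply: Hr; rewrite normc_distC ltW.
Qed.

Lemma closure_cone_scale t v : 0 < t -> closure K v -> closure K (t *: v).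
Proof.
move=> t0 /closure_normcP cv; apply/closure_normcP => e e0.
have [w Kw wv] := cv (e / t) (divr_gt0 e0 t0).
exists (t *: w); first exact: (cone_scale OmP).
by rewrite -scalerBr normcZ gtr0_norm// mulrC -ltr_pdivlMr.
Qed.

Lemma closure_cone0 : closure K 0.
Proof.
have [ o Ko] : exists o, K o.
  by have [_ [_ [[v Ov] _]]] := OmP; have [Kv|Kv] := Om_cone OmP Ov; eexists; exact: Kv.
have no : 0 < normc o by rewrite normc_gt0 (cone_neq0 Ko).
apply/closure_normcP => e e0; exists ((e / 2 / normc o) *: o).
  by apply: (cone_scale OmP) => //; rewrite !divr_gt0.
rewrite subr0 normcZ gtr0_norm ?divr_gt0// divfK ?gt_eqF//; lra.
Qed.

Lemma pairing_closure_cone_ge0 (p : 'rV[R]_n) v : (forall v, K v -> 0 <= pairing p v) ->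
  closure K v -> 0 <= pairing p v.
Proof.
move=> Hp /closure_normcP cv; rewrite leNgt; apply/negP => pv.
have np : 0 < normrow p + 1 by rewrite ltr_wpDl// normrowE normc_ge0.
have [|w Kw wv] := cv (- pairing p v / (normrow p + 1)).
  by rewrite divr_gt0// oppr_gt0.
have := Hp _ Kw; rewrite -[w](subrK v) pairingD.
have := le_trans (ler_norm _) (pairing_le p (w - v)).
move: wv; rewrite ltr_pdivlMr// => wv.
have := normc_ge0 (w - v); lra.
Qed.

Lemma small_quadratic (a b : R) : 0 <= b -> (forall t, 0 < t -> t <= 1 -> 0 <= a + t * b) -> 0 <= a.
Proof.
move=> b0 H; rewrite leNgt; apply/negP => a0.
have := H (Num.min 1 (- a / (b + 1) / 2)).
have q0 : 0 < - a / (b + 1) by rewrite divr_gt0; lra.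
rewrite lt_min ltr01 divr_gt0// ge_min lexx => /(_ isT isT).
have : Num.min 1 (- a / (b + 1) / 2) <= - a / (b + 1) / 2 by rewrite ge_min lexx orbT.
move=> /(ler_wpM2r b0).
have : - a / (b + 1) / 2 * b <= - a / 2.
  rewrite mulrAC ler_pM2r// mulrAC ler_pdivrMr; last by lra.
  nra.
lra.
Qed.

(** Let [q] be the point of the closed cone nearest to [x], and [u = q - x]. Moving [q] in a
    direction of the cone, or towards the origin, cannot bring it closer to [x]; so [u] is
    nonnegative on the cone and [<u, q> <= 0], whence [<u, x> = <u, q> - |u|^2 < 0]. *)
Lemma cone_separation x : ~ closure K x -> exists p : 'rV[R]_n,
  (forall v, K v -> 0 <= pairing p v) /\ pairing p x < 0.
Proof.
move=> ncx.
(* Points of norm above [2 |x|] are farther from [x] than the origin is, so the minimum may be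
   sought on this compact part. *)
pose A := closure K `&` [set v | normc v <= 2 * normc x].
have cA : compact A.
  apply: (@closed_normc_bounded_compact _ _ _ (2 * normc x)); last by move=> v [].
  apply: closedI; first exact: closed_closure.
  rewrite (_ : [set _ | _] = (@normc R n) @^-1` [set y | y <= 2 * normc x])//.
  by apply: closed_comp => [z _|]; [exact: normc_continuous|exact: closed_le].
have A0 : A !=set0.
  by exists 0; split; [exact: closure_cone0|rewrite /= normc0 mulr_ge0 ?normc_ge0].
have cf : continuous (fun v => normc (v - x)).
  move=> z; apply: (@loclip_continuous _ _ _ _ 1) => // y _; rewrite mul1r.
  rewrite (le_trans (normc_dist_le _ _))// (_ : y - x - (z - x) = y - z)//.
  by apply/matrixP => i j; rewrite !mxE; ring.
have [q] := compact_EVT_min A0 cA (continuous_subspaceT cf).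
rewrite inE => -[cq nq] qmin.
have qm v : closure K v -> normc (q - x) <= normc (v - x).
  move=> cv; have [vx|vx] := leP (normc v) (2 * normc x).
    by apply: qmin; rewrite inE.
  have : normc (q - x) <= normc (0 - x).
    by apply: qmin; rewrite inE; split; [exact: closure_cone0|rewrite /= normc0 mulr_ge0 ?normc_ge0].
  rewrite sub0r normcN => /le_trans; apply.
  have := normc_dist_le v x; rewrite ler_norml => /andP[]; lra.
have qm2 v : closure K v -> dotc (q - x) (q - x) <= dotc (v - x) (v - x).
  by move=> cv; rewrite -!normc_sqr ler_sqr ?nnegrE ?normc_ge0// qm.
have [u uE] : exists u, u = q - x by eexists.
have uv v : (forall t, 0 < t -> t <= 1 -> closure K (q + t *: v)) -> 0 <= dotc u v.
  move=> H; suff : 0 <= 2 * dotc u v by rewrite pmulr_rge0.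
  apply: (@small_quadratic _ (dotc v v)); first exact: dotc_ge0.
  move=> t t0 t1; have := qm2 _ (H t t0 t1).
  have -> : q + t *: v - x = u + t *: v by rewrite uE addrAC.
  rewrite -uE !(dotcDl, dotcDr, dotcZl, dotcZr) (dotcC v u) => L.
  rewrite -(pmulr_rge0 _ t0); nra.
have uq : dotc u q <= 0.
  rewrite -oppr_ge0 -dotcNr; apply: uv => t t0 t1.
  have [->|t1'] := eqVneq t 1; first by rewrite scale1r subrr; exact: closure_cone0.
  rewrite scalerN -[X in X - _]scale1r -scalerBl; apply: closure_cone_scale => //.
  by rewrite subr_gt0 lt_neqAle t1'.
exists u^T; split=> [v Kv|].
  rewrite pairingE trmxK; apply: uv => t t0 t1; apply: subset_closure.
  by rewrite addrC; apply: cone_closure_add => //; exact: (cone_scale OmP).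
rewrite pairingE trmxK.
have uu : 0 < dotc u u.
  rewrite lt0r dotc_ge0 andbT dotc_eq0 uE subr_eq0; apply: contra_notN ncx => /eqP <- //.
have -> : x = q - u by rewrite uE subKr.
rewrite dotcDr dotcNr; lra.
Qed.

(** Evaluate [p] at [v - (r / |p|) p^T], the point of the ball around [v] where it is least. *)
Lemma pos_on_cone (p : 'rV[R]_n) v r : p != 0 -> (forall v, K v -> 0 <= pairing p v) ->
  (forall u, normc u <= r -> K (v + u)) -> 0 < r -> r * normrow p <= pairing p v.
Proof.
move=> p0 Hp Hr r0.
have np : 0 < normrow p.
  by rewrite normrowE normc_gt0 -(inj_eq (@trmx_inj _ _ _)) trmx0 trmxK.
have := Hp _ (Hr (- ((r / normrow p) *: p^T)) _).
rewrite normcN normcZ -normrowE gtr0_norm ?divr_gt0// divfK ?gt_eqF// => /(_ (lexx _)).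
rewrite pairingD pairingN pairingZ [pairing p p^T]pairingE -normc_sqr -normrowE subr_ge0.
by move=> /(le_trans _); apply; rewrite expr2 mulrA divfK ?gt_eqF.
Qed.

Lemma pairing_cone_gt0 (p : 'rV[R]_n) v : p != 0 -> (forall v, K v -> 0 <= pairing p v) ->
  K v -> 0 < pairing p v.
Proof.
move=> p0 Hp Kv; have [r r0 Hr] := cone_open OmP Kv.
apply: lt_le_trans (pos_on_cone p0 Hp Hr r0).
by rewrite mulr_gt0// normrowE normc_gt0 -(inj_eq (@trmx_inj _ _ _)) trmx0 trmxK.
Qed.

(** Minimise the value at [x] over the compact set of unit functionals nonnegative on the cone. If
    the minimum were positive, [cone_separation] would allow a small multiple of an interior point
    to be subtracted from [x] within the closed cone, and [x] would be interior. *)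
Lemma supporting_functional x : closure K x -> ~ K x -> exists p : 'rV[R]_n,
  [/\ p != 0, pairing p x = 0 & forall v, K v -> 0 < pairing p v].
Proof.
move=> cx nKx.
have [ o Ko] : exists o, K o.
  by have [_ [_ [[v Ov] _]]] := OmP; have [Kv|Kv] := Om_cone OmP Ov; eexists; exact: Kv.
have no : 0 < normc o by rewrite normc_gt0 (cone_neq0 Ko).
pose Psi := [set v | normc v = 1] `&` [set v | forall w, K w -> 0 <= dotc v w].
have dc w : continuous (fun v => dotc v w).
  move=> z; rewrite (_ : (fun v => dotc v w) = pairing w^T); first exact: pairing_continuous.
  by apply/funext => v; rewrite pairingE trmxK dotcC.
have cPsi : compact Psi.
  apply: (@closed_normc_bounded_compact _ _ _ 1); last by move=> v [-> _].
  apply: closedI; first exact: closed_sphere.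
  rewrite (_ : [set _ | _] = \bigcap_(w in K) ((fun v => dotc v w) @^-1` [set r | 0 <= r])).
    apply: closed_bigI => w _.
    by apply: closed_comp => [z _|]; [exact: dc|exact: closed_ge].
  by apply/seteqP; split=> v /= H w => /H.
have Psi0 : Psi !=set0.
  have [p0 pp] : exists p : 'rV[R]_n, p != 0 /\ forall v, K v -> 0 <= pairing p v.
    exists phi; split; last by move=> v [_ /ltW].
    apply: contraTneq (Ko.2) => ->; rewrite /pairing mul0mx mxE ltxx//.
  case: pp => pn0 pp.
  have np : 0 < normc p0^T.
    by rewrite normc_gt0 -(inj_eq (@trmx_inj _ _ _)) trmx0 trmxK.
  exists ((normc p0^T)^-1 *: p0^T); split => /=.
    by rewrite normcZ gtr0_norm ?invr_gt0// mulVf// gt_eqF.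
  by move=> w Kw; rewrite dotcZl mulr_ge0 ?invr_ge0 ?normc_ge0// -pairingE pp.
have [p] := compact_EVT_min Psi0 cPsi (continuous_subspaceT (@dc x)).
rewrite inE => -[/= p1 pp] pmin.
have pn0 : p^T != 0.
  rewrite -(inj_eq (@trmx_inj _ _ _)) trmx0 trmxK -normc_gt0 p1 ltr01//.
have pp' v : K v -> 0 <= pairing p^T v by move=> Kv; rewrite pairingE trmxK pp.
exists p^T; split=> //; last by move=> v; exact: pairing_cone_gt0.
have px0 := pairing_closure_cone_ge0 pp' cx.
apply/eqP; rewrite eq_le px0 andbT leNgt; apply/negP => px.
rewrite pairingE trmxK in px.
pose e := dotc p x / 2 / normc o.
have e0 : 0 < e by rewrite !divr_gt0.
have cx' : closure K (x - e *: o).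
  apply: contrapT => /cone_separation[q [qq qx]].
  have nq : 0 < normc q^T.
    rewrite normc_gt0; apply: contraTneq qx => q0.
    by rewrite pairingE q0 /dotc trmx0 mul0mx mxE ltxx.
  have := pmin ((normc q^T)^-1 *: q^T); rewrite inE => /(_ _).
  rewrite dotcZl => /(_ _).
  have H : Psi ((normc q^T)^-1 *: q^T).
    split => /=; first by rewrite normcZ gtr0_norm ?invr_gt0// mulVf// gt_eqF.
    by move=> w Kw; rewrite dotcZl mulr_ge0 ?invr_ge0 ?normc_ge0// -pairingE qq.
  move=> /(_ H); rewrite ler_pdivlMl// => L.
  move: qx; rewrite pairingD pairingN pairingZ !pairingE.
  have := le_trans (ler_norm _) (dotc_CS q^T o) => L2.
  have : e * dotc q^T o <= dotc p x / 2 * normc q^T.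
    apply: le_trans (ler_wpM2l (ltW e0) L2) _.
    by rewrite /e mulrCA divfK ?gt_eqF// mulrC.
  nra.
apply: nKx; have := cone_closure_add (cone_scale OmP e0 Ko) cx'.
by rewrite addrC subrK.
Qed.

(** In particular no nonzero limit of [Om] lies on the hyperplane at infinity of the chart. *)
Lemma closure_Om_chart : exists2 B : R, 0 < B & forall x, closure Om x ->
  normc x <= B * `|pairing phi x|.
Proof.
have [B B0 HB] := cone_normc OmP; exists B => // x /closure_normcP cx.
have HO v : Om v -> normc v <= B * `|pairing phi v|.
  move=> /(Om_cone OmP)[Kv|Kv].
    by rewrite ger0_norm ?HB//; case: Kv => _ /ltW.
  have := HB _ Kv; rewrite normcN pairingN => /le_trans; apply.
  by rewrite ler_pM2l// -normrN ler_norm.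
apply/ler_addgt0Pr => e e0.
have np : 0 <= normrow phi by rewrite normrowE normc_ge0.
have q0 : 0 < 1 + B * normrow phi by rewrite ltr_wpDr// mulr_ge0// ltW.
have [y Oy yx] := cx _ (divr_gt0 e0 q0).
move: yx; rewrite ltr_pdivlMr// => yx.
have h1 : normc x <= normc y + normc (y - x).
  by have := normc_dist_le y x; rewrite ler_norml => /andP[]; lra.
have h2 : `|pairing phi y| <= `|pairing phi x| + normrow phi * normc (y - x).
  rewrite -{1}[y](subrK x) pairingD addrC (le_trans (ler_normD _ _))// lerD2l.
  exact: pairing_le.
have h3 := HO _ Oy; have h4 : B * `|pairing phi y| <= B * (`|pairing phi x| + normrow phi * normc (y - x)) by rewrite ler_pM2l.
rewrite mulrDr in h4; lra.
Qed.

Lemma closure_Om_cone x : closure Om x -> 0 < pairing phi x -> closure K x.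
Proof.
move=> /closure_normcP cx px; apply/closure_normcP => e e0.
have np : 0 < normrow phi + 1 by rewrite ltr_wpDl// normrowE normc_ge0.
have [|y Oy] := cx (Num.min e (pairing phi x / (normrow phi + 1))).
  by rewrite lt_min e0 divr_gt0.
rewrite lt_min => /andP[ye]; rewrite ltr_pdivlMr// => yp.
exists y => //; split=> //; rewrite -[y](subrK x) pairingD.
have := pairing_le phi (y - x); rewrite ler_norml => /andP[].
have := normc_ge0 (y - x); lra.
Qed.

Lemma near_hilbert w : K w -> exists2 r : R, 0 < r &
  forall v, normc (v - w) <= r -> K v /\ d w v <= 1.
Proof.
move=> Kw; have [r r0 Hr] := cone_open OmP Kw.
exists (r / 2); first by rewrite divr_gt0.
move=> v vw; have Kv : K v.
  by rewrite -[v](subrK w) addrC; apply: Hr; lra.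
split=> //; rewrite (hilbert_gauge OmP)//.
have m1 : M w v <= 2.
  apply: (gauge_le OmP) => //.
  have -> : 2 *: w - v = w + (w - v) by apply/matrixP => i j; rewrite !mxE; ring.
  by apply: Hr; rewrite normc_distC; lra.
have m2 : M v w <= 2.
  apply: (gauge_le OmP) => //.
  have -> : 2 *: v - w = w + 2 *: (v - w) by apply/matrixP => i j; rewrite !mxE; ring.
  by apply: Hr; rewrite normcZ gtr0_norm//; lra.
have g1 := gauge_gt0 OmP Kw Kv; have g2 := gauge_gt0 OmP Kv Kw.
rewrite ler_pdivrMr// mul1r lnM ?posrE//.
have l2 : ln (2 : R) <= 1.
  by rewrite (_ : 2 = 1 + 1 :> R) ?le_ln1Dx//; lra.
have H1 : ln (M w v) <= ln 2 by rewrite ler_ln ?posrE.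
have H2 : ln (M v w) <= ln 2 by rewrite ler_ln ?posrE.
lra.
Qed.

End Support.

(** * The group action *)

Lemma compact_nat_cover (T : topologicalType) (A : set T) (P : nat -> set T) :
  compact A -> (forall i j, (i <= j)%N -> P i `<=` P j) ->
  (forall x, A x -> exists i, nbhs x (P i)) -> exists i, A `<=` P i.
Proof.
move=> /compact_near_coveringP cA mP nP.
have := cA nat \oo P _; case.
  move=> x /nP[i Pi]; exists (P i, [set j | (i <= j)%N]) => /=.
    by split=> //; exists i.
  by move=> [y j] /= [Piy ij]; apply: mP Piy.
by move=> N _ HN; exists N; apply: HN => /=.
Qed.

Ltac dist_lra :=
  repeat match goal with |- context [hilbert_dist ?O ?x ?y] =>
    move: (hilbert_dist O x y) => ? end; clear; intros; lra.

Section Action.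
Variables (R : realType) (n : nat).
Implicit Types (u v w x y z : 'cV[R]_n) (a b s t : R) (g h : 'M[R]_n).
Variable (G : set 'M[R]_n) (Om C : set 'cV[R]_n).
Hypothesis GP : strongly_proj_convex_cocompact G Om C.
Local Notation phi := (chart Om).
Local Notation K := (cone Om).
Local Notation M := (gauge Om).
Local Notation d := (hilbert_dist Om).

Lemma spcc_Om : properly_convex_open Om.
Proof. by case: GP => _ []. Qed.
Let OmP := spcc_Om.

Lemma spcc_dim : (0 < n)%N.
Proof.
have [[nO _] [_ [[v Ov] _]]] := OmP.
case: posnP => // n0; exfalso; apply: nO; congr (Om _) : Ov.
by apply/matrixP => i; have := ltn_ord i; rewrite {2}n0.
Qed.

Lemma G_one : G 1%:M. Proof. by case: GP => -[[]]. Qed.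
Lemma G_mul g h : G g -> G h -> G (g *m h).
Proof. by case: GP => -[[_ [H _]] _] _; exact: H. Qed.
Lemma G_inv g : G g -> G (invmx g).
Proof. by case: GP => -[[_ [_ [H _]]] _] _; exact: H. Qed.
Lemma G_det g : G g -> \det g = 1.
Proof. by case: GP => -[[_ [_ [_ H]]] _] _; exact: H. Qed.
Lemma G_unit g : G g -> g \in unitmx.
Proof. by move=> /G_det; rewrite unitmxE => ->; rewrite unitr1. Qed.
Lemma G_Om g v : G g -> Om v -> Om (g *m v).
Proof. by case: GP => _ [_ [H _]]; exact: H. Qed.
Lemma G_C g v : G g -> C v -> C (g *m v).
Proof. by case: GP => _ [_ [_ [_ [_ [_ [_ [_ [H _]]]]]]]]; exact: H. Qed.
Lemma C_Om : C `<=` Om.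
Proof. by case: GP => _ [_ [_ [_ [_ [_ []]]]]]. Qed.
Lemma C_scale t v : t != 0 -> C v -> C (t *: v).
Proof. by case: GP => _ [_ [_ [_ [[_ H] _]]]] t0 Cv; exact: H. Qed.

Lemma C_add v w : C v -> C w -> K v -> K w -> C (v + w).
Proof.
move=> Cv Cw [_ pv] [_ pw].
have p0 : 0 < pairing phi v + pairing phi w by rewrite addr_gt0.
have conv : convex_in Om C by case: GP => _ [_ [_ [_ [_ [_ [_ []]]]]]].
pose t := pairing phi w / (pairing phi v + pairing phi w).
have sl x : C x -> 0 < pairing phi x -> chart_slice phi C ((pairing phi x)^-1 *: x).
  by move=> Ox px; split; [apply: C_scale => //; rewrite invr_eq0 gt_eqF|rewrite pairingZ mulVf// gt_eqF].
have := conv _ _ t (sl _ Cv pv) (sl _ Cw pw).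
rewrite divr_ge0 ?(ltW p0) ?(ltW pw)//= ler_pdivrMr// mul1r lerDr (ltW pv) => /(_ isT).
move=> /(C_scale (lt0r_neq0 p0)).
rewrite scalerDr !scalerA.
by congr (C (_ + _)); rewrite -[RHS]scale1r; congr (_ *: _); rewrite /t; field; rewrite !gt_eqF.
Qed.

Lemma C_segment s x y : 0 <= s <= 1 -> C x -> C y -> K x -> K y ->
  C ((1 - s) *: x + s *: y).
Proof.
move=> /andP[s0 s1] Cx Cy Kx Ky.
have [->|s0'] := eqVneq s 0; first by rewrite subr0 scale1r scale0r addr0.
have [->|s1'] := eqVneq s 1; first by rewrite subrr scale1r scale0r add0r.
have s0p : 0 < s by rewrite lt0r s0'.
have s1p : 0 < 1 - s by rewrite subr_gt0 lt_neqAle s1'.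
apply: C_add; [| |exact: (cone_scale OmP)..].
  by apply: C_scale => //; rewrite gt_eqF.
by apply: C_scale.
Qed.

Lemma exists_base : exists2 o, C o & K o.
Proof.
have [v Cv] : exists v, C v by case: GP => _ [_ [_ [_ [_ [H _]]]]].
have [Kv|Kv] := Om_cone OmP (C_Om Cv); first by exists v.
by exists (- v) => //; rewrite -scaleN1r; apply: C_scale => //; rewrite oppr_eq0 oner_eq0.
Qed.

(** If [phi (g o)] and [phi (g v)] had opposite signs, a nonnegative combination of [o] and [v]
    would be sent to a point of [Om] at which [phi] vanishes. *)
Lemma G_cone_sign g : G g ->
  (forall v, K v -> K (g *m v)) \/ (forall v, K v -> K (- (g *m v))).
Proof.
move=> Gg; have [H _] := chartP OmP.
have [ o _ Ko] := exists_base.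
have sgn e v : e != 0 -> K v -> 0 < e * pairing phi (g *m o) -> 0 < e * pairing phi (g *m v).
  move=> e0 Kv po; rewrite ltNge; apply/negP => pv.
  have := H (g *m (- (e * pairing phi (g *m v)) *: o + (e * pairing phi (g *m o)) *: v)).
  rewrite mulmxDr -!scalemxAr pairingD !pairingZ => E.
  have /E/eqP : Om (- (e * pairing phi (g *m v)) *: (g *m o) + (e * pairing phi (g *m o)) *: (g *m v)).
    rewrite !scalemxAr -mulmxDr; apply: (G_Om Gg).
    have Kv' : K ((e * pairing phi (g *m o)) *: v) by exact: (cone_scale OmP).
    move: pv; rewrite le_eqVlt => /orP[/eqP ->|pv]; first by rewrite oppr0 scale0r add0r; case: Kv'.
    suff [] : K (- (e * pairing phi (g *m v)) *: o + (e * pairing phi (g *m o)) *: v) by [].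
    apply: (cone_add OmP) => //; apply: (cone_scale OmP) => //.
    by rewrite oppr_gt0.
  by apply; ring.
have := H _ (G_Om Gg Ko.1); rewrite neq_lt => /orP[po|po]; [right|left] => v Kv.
  split; first by rewrite -scaleN1r; apply: (Om_scale OmP); [rewrite oppr_eq0 oner_eq0|exact: (G_Om Gg Kv.1)].
  by rewrite pairingN -mulN1r sgn// ?oppr_eq0 ?oner_eq0// mulN1r oppr_gt0.
split; first exact: (G_Om Gg Kv.1).
by rewrite -[pairing _ _]mul1r sgn// ?oner_eq0// mul1r.
Qed.

(** One sign serves [g] and its inverse: otherwise the cone would contain both [v] and [- v]. *)
Lemma G_cone g : G g -> exists gs, [/\ gs = g \/ gs = - g,
  gs \in unitmx, (forall v, K v -> K (gs *m v)) & (forall v, K v -> K (invmx gs *m v))].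
Proof.
move=> Gg; have gu := G_unit Gg.
have cN v : K v -> ~ K (- v).
  by move=> [_ pv] [_]; rewrite pairingN oppr_gt0; lra.
have inv1 h : h \in unitmx -> (forall v, K v -> K (h *m v)) ->
    (forall v, K v -> K (invmx h *m v)) \/ (forall v, K v -> K (- (invmx h *m v))) ->
    (forall v, K v -> K (invmx h *m v)).
  move=> hu Kh [//|Hi] v Kv; exfalso; apply: (cN _ Kv).
  by have := Kh _ (Hi _ Kv); rewrite mulmxN mulmxA mulmxV// mul1mx.
have [Kg|Kg] := G_cone_sign Gg.
  exists g; split; [by left|by []|by []|].
  by apply: inv1 => //; exact: G_cone_sign (G_inv Gg).
have gNu : - g \in unitmx by rewrite unitmxE -scaleN1r detZ unitrM unitrX ?unitrN1// -unitmxE.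
have gNi : invmx (- g) = - invmx g.
  rewrite -[RHS]mul1mx -(mulVmx gNu) -mulmxA mulmxN mulNmx opprK mulmxV// mulmx1//.
exists (- g); split; [by right|by []|by move=> v Kv; rewrite mulNmx; exact: Kg|].
apply: inv1 => //; first by move=> v Kv; rewrite mulNmx; exact: Kg.
have [H|H] := G_cone_sign (G_inv Gg); [right|left] => v Kv; rewrite gNi mulNmx ?opprK; exact: H.
Qed.

Lemma gauge_mul_le g x y : (forall v, K v -> K (g *m v)) -> K x -> K y ->
  M (g *m x) (g *m y) <= M x y.
Proof.
move=> Kg Kx Ky; apply/ler_addgt0Pl => e e0; apply: (gauge_le OmP); first exact: Kg.
by rewrite scalemxAr -mulmxBr; apply: Kg; apply: (gauge_lt OmP) => //; rewrite ltrDr.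
Qed.

Lemma gauge_invariant g x y : g \in unitmx -> (forall v, K v -> K (g *m v)) ->
  (forall v, K v -> K (invmx g *m v)) -> K x -> K y -> M (g *m x) (g *m y) = M x y.
Proof.
move=> gu Kg Ki Kx Ky; apply/eqP; rewrite eq_le gauge_mul_le//=.
have := gauge_mul_le Ki (Kg _ Kx) (Kg _ Ky).
by rewrite !mulmxA mulVmx// !mul1mx.
Qed.

Lemma hilbert_invariant g x y : G g -> Om x -> Om y -> d (g *m x) (g *m y) = d x y.
Proof.
move=> Gg Ox Oy; have [H _] := chartP OmP.
have [gs [gsE gu Kg Ki]] := G_cone Gg.
have Kx := cone_normalize OmP Ox; have Ky := cone_normalize OmP Oy.
have E z : Om z -> exists2 c : R, c != 0 & g *m z = c *: (gs *m normalize phi z).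
  move=> Oz; case: gsE => ->.
    exists (pairing phi z); first exact: H.
    by rewrite /normalize -scalemxAr scalerA divff ?scale1r ?H.
  exists (- pairing phi z); first by rewrite oppr_eq0; exact: H.
  by rewrite /normalize mulNmx -scalemxAr scalerN scaleNr opprK scalerA divff ?scale1r ?H.
have [a a0 ->] := E _ Ox; have [b b0 ->] := E _ Oy.
have [Ogx _] := Kg _ Kx; have [Ogy _] := Kg _ Ky.
rewrite (hilbert_scale OmP)// (hilbert_normalize OmP Ox Oy).
rewrite (hilbert_gauge OmP (Kg _ Kx) (Kg _ Ky)) (hilbert_gauge OmP Kx Ky).
by rewrite !gauge_invariant.
Qed.

Lemma hilbert_locally_bounded x w : Om x -> Om w ->
  exists N : nat, nbhs w [set v | Om v /\ d x v <= N%:R].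
Proof.
move=> Ox Ow.
have [c c0 Kw] : exists2 c : R, c != 0 & K (c *: w).
  have [Kw|Kw] := Om_cone OmP Ow; first by exists 1; rewrite ?oner_eq0// scale1r.
  by exists (- 1); rewrite ?oppr_eq0 ?oner_eq0// scaleN1r.
have [r r0 Hr] := near_hilbert OmP Kw.
have [Ocw _] := Kw.
exists (Num.truncn (d x w + 1)).+1; apply/nbhs_normcP.
exists (r / `|c|); first by rewrite divr_gt0// normr_gt0.
move=> v; rewrite ltr_pdivlMr ?normr_gt0// mulrC -normcZ scalerBr => /ltW/Hr[[Ocv _] dv].
have Ov : Om v.
  rewrite -[v]scale1r -(mulVf c0) -scalerA; apply: (Om_scale OmP) => //.
  by rewrite invr_eq0.
split=> //.
have := hilbert_triangle OmP Ox Ow Ov.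
have E : d (c *: w) (c *: v) = d w v by apply: (hilbert_scale OmP).
move: dv; rewrite E; have := truncnS_gt (d x w + 1).
by move: (_.+1%:R); dist_lra.
Qed.

(** By compactness [d o] is bounded on the set whose translates fill [C]; invariance of the distance
    does the rest. *)
Lemma cocompact_bound o : C o -> K o ->
  exists2 D : R, 0 <= D & forall v, C v -> exists2 g, G g & d v (g *m o) <= D.
Proof.
move=> Co Ko; have [Oo _] := Ko.
have [K0 [K0p [K0C [K0c HK]]]] : acts_cocompactly G C by case: GP => _ [_ [_ [_ [_ [_ [_ [_ [_ []]]]]]]]].
have [|x K0x|N HN] := @compact_nat_cover _ _ (fun N => [set v | Om v /\ d o v <= N%:R]) K0c.
- move=> i j ij v [Ov dv]; split=> //; apply: le_trans dv _; rewrite ler_nat//.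
- by apply: hilbert_locally_bounded => //; apply: C_Om; apply: K0C; case: K0x.
exists N%:R; first exact: ler0n.
move=> v /HK[g [k [Gg [Kk ->]]]]; exists g => //.
have k0 : k != 0 by apply/eqP => k0; apply: K0p.1; rewrite -k0.
have nk : 0 < normc k by rewrite normc_gt0.
have Ok : Om k by apply/C_Om/K0C.
rewrite hilbert_invariant// (hilbert_sym OmP)//.
have [|_] := HN ((normc k)^-1 *: k).
  split; last by rewrite normcZ gtr0_norm ?invr_gt0// mulVf// gt_eqF.
  by apply: K0p.2 => //; rewrite invr_eq0 gt_eqF.
have -> : d o ((normc k)^-1 *: k) = d (1 *: o) ((normc k)^-1 *: k) by rewrite scale1r.
by rewrite (hilbert_scale OmP) ?oner_eq0 ?invr_eq0 ?gt_eqF.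
Qed.

End Action.

Lemma finite_set_inj (T : pointedType) (F : finType) (E : set T) (f : T -> F) :
  (forall x y, E x -> E y -> f x = f y -> x = y) -> finite_set E.
Proof.
move=> fi; pose h (c : F) := xget point [set x | E x /\ f x = c].
apply: (@sub_finite_set _ _ (h @` [set: F])).
  move=> x Ex; exists (f x) => //; rewrite /h; apply: xget_unique => //= y [Ey] fy.
  exact: fi.
exact/finite_image/finite_finset.
Qed.

(** * Operator norms, displacement of the base point, and discreteness *)

Section Norms.
Variables (R : realType) (n : nat).
Implicit Types (u v w x y z : 'cV[R]_n) (a b s t : R) (g h : 'M[R]_n).
Variable (G : set 'M[R]_n) (Om C : set 'cV[R]_n).
Hypothesis GP : strongly_proj_convex_cocompact G Om C.
Local Notation phi := (chart Om).
Local Notation K := (cone Om).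
Local Notation M := (gauge Om).
Local Notation d := (hilbert_dist Om).
Let OmP := spcc_Om GP.

Lemma hilbert_signr x g gs v : gs = g \/ gs = - g -> Om x -> Om (g *m v) ->
  d x (gs *m v) = d x (g *m v).
Proof.
move=> [->//|->] Ox Og.
have -> : d x (- g *m v) = d (1 *: x) (-1 *: (g *m v)).
  by rewrite scale1r scaleN1r mulNmx.
by rewrite (hilbert_scale OmP) ?oppr_eq0 ?oner_eq0.
Qed.

Lemma normc_sign g gs v : gs = g \/ gs = - g -> normc (gs *m v) = normc (g *m v).
Proof. by case=> ->//; rewrite mulNmx normcN. Qed.

Lemma invmx_sign g gs : g \in unitmx -> gs = g \/ gs = - g ->
  invmx gs = invmx g \/ invmx gs = - invmx g.
Proof.
move=> gu [->|->]; [by left|right].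
have gNu : - g \in unitmx by rewrite unitmxE -scaleN1r detZ unitrM unitrX ?unitrN1// -unitmxE.
by rewrite -[RHS]mul1mx -(mulVmx gNu) -mulmxA mulmxN mulNmx opprK mulmxV// mulmx1.
Qed.

(** One interior point measures the operator norm: for a unit vector [u], both [o + r u] and
    [o - r u] lie in the cone, the norms of their images are bounded by [B] times [phi], and these
    two values of [phi] add up to twice that of [gs *m o]. *)
Lemma cone_opnorm B r o gs h : 0 < B -> 0 < r ->
  (forall v, K v -> normc v <= B * pairing phi v) ->
  (forall u, normc u <= r -> K (o + u)) ->
  (forall v, K v -> K (gs *m v)) -> \det h = 1 -> (gs = h \/ gs = - h) ->
  expR (mu h 0) <= B / r * pairing phi (gs *m o).
Proof.
move=> B0 r0 HB Hr Kg dh gh.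
have [u u1 <-] := normc_mul_attained (spcc_dim GP) dh.
rewrite -(normc_sign _ gh) mulrAC ler_pdivlMr// mulrC.
have Kp : K (gs *m (o + r *: u)) by apply/Kg/Hr; rewrite normcZ u1 mulr1 gtr0_norm.
have Km : K (gs *m (o - r *: u)) by apply/Kg/Hr; rewrite normcN normcZ u1 mulr1 gtr0_norm.
have := lerD (HB _ Kp) (HB _ Km).
rewrite -mulrDr -pairingD -mulmxDr.
have -> : o + r *: u + (o - r *: u) = 2 *: o.
  by apply/matrixP => i j; rewrite !mxE; ring.
rewrite -scalemxAr pairingZ => L.
have : normc (2 *: (r *: (gs *m u))) <= normc (gs *m (o + r *: u)) + normc (gs *m (o - r *: u)).
  rewrite (_ : 2 *: _ = gs *m (o + r *: u) - gs *m (o - r *: u)) ?normcB//.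
  rewrite -mulmxBr (_ : o + r *: u - (o - r *: u) = 2 *: (r *: u)) -?scalemxAr//.
  by apply/matrixP => i j; rewrite !mxE; ring.
rewrite !normcZ !gtr0_norm//; lra.
Qed.

Lemma gauge_base_le r o v : 0 < r -> (forall u, normc u <= r -> K (o + u)) -> K o -> v != 0 ->
  M o v <= normc v / r.
Proof.
move=> r0 Hr Ko v0; have nv : 0 < normc v by rewrite normc_gt0.
apply: (gauge_le OmP) => //.
have -> : (normc v / r) *: o - v = (normc v / r) *: (o + - ((r / normc v) *: v)).
  apply/matrixP => i j; rewrite !mxE; field; rewrite !gt_eqF//.
apply: (cone_scale OmP); first by rewrite divr_gt0.
by apply: Hr; rewrite normcN normcZ gtr0_norm ?divr_gt0// divfK// gt_eqF.
Qed.

(** [M o (g o)] is at most a multiple of [|g o|], and [M (g o) o = M o (g^-1 o)] at most a multiple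
    of the norm of [g^-1], which is bounded by [exp (- mu_n)]. *)
Lemma hilbert_orbit_le o : K o -> exists c : R, forall g, G g ->
  d o (g *m o) <= (mu g 0 - mu g n.-1) / 2 + c.
Proof.
move=> Ko; have [r r0 Hr] := cone_open OmP Ko.
have no : 0 < normc o by rewrite normc_gt0 (cone_neq0 Ko).
exists (ln (normc o / r)) => g Gg.
have [gs [gsE gu Kg Ki]] := G_cone GP Gg.
rewrite -(hilbert_signr gsE Ko.1 (G_Om GP Gg Ko.1)) (hilbert_gauge OmP Ko (Kg _ Ko)).
have dg := G_det GP Gg; have n0 := spcc_dim GP.
have h1 : M o (gs *m o) <= expR (mu g 0) * normc o / r.
  apply: le_trans (gauge_base_le r0 Hr Ko (cone_neq0 (Kg _ Ko))) _.
  by rewrite ler_pM2r ?invr_gt0// (normc_sign _ gsE) normc_mul_le.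
have h2 : M (gs *m o) o <= expR (- mu g n.-1) * normc o / r.
  have -> : M (gs *m o) o = M o (invmx gs *m o).
    by rewrite -(gauge_invariant GP gu Kg Ki Ko (Ki _ Ko)) mulmxA mulmxV// mul1mx.
  apply: le_trans (gauge_base_le r0 Hr Ko (cone_neq0 (Ki _ Ko))) _.
  rewrite ler_pM2r ?invr_gt0// (normc_sign _ (invmx_sign (G_unit GP Gg) gsE)).
  exact: normc_invmx_le.
have g1 := gauge_gt0 OmP Ko (Kg _ Ko); have g2 := gauge_gt0 OmP (Kg _ Ko) Ko.
rewrite ler_pdivrMr// lnM ?posrE//.
have e1 : ln (M o (gs *m o)) <= mu g 0 + ln (normc o / r).
  by rewrite -ler_expR lnK ?posrE// expRD lnK ?posrE ?divr_gt0// mulrA.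
have e2 : ln (M (gs *m o) o) <= - mu g n.-1 + ln (normc o / r).
  by rewrite -ler_expR lnK ?posrE// expRD lnK ?posrE ?divr_gt0// mulrA.
lra.
Qed.

Lemma entry_le_normc g (a : R) i j : (forall v, normc (g *m v) <= a * normc v) -> `|g i j| <= a.
Proof.
move=> Hg; have := Hg (delta_mx j 0).
have -> : normc (delta_mx j 0 : 'cV[R]_n) = 1.
  rewrite /normc dotcE (bigD1 j)//= !mxE !eqxx mulr1 big1 ?addr0 ?sqrtr1//.
  by move=> k kj; rewrite !mxE (negPf kj) mulr0.
rewrite mulr1 -colE; apply: le_trans.
rewrite -ler_sqr ?nnegrE ?normc_ge0// normc_sqr dotcE real_normK ?num_real//.
rewrite (bigD1 i)//= !mxE expr2 lerDl sumr_ge0// => k _.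
by rewrite -expr2 sqr_ge0.
Qed.

(** Pigeonhole on entries cut into cells of size [del]: if [g] and [h] share all cells, then
    [g^-1 h] is within [eps] of the identity, the entries of [g^-1] being bounded as well. *)
Lemma G_bounded_finite (T : R) : finite_set
  [set g | G g /\ expR (mu g 0) <= T /\ expR (mu (invmx g) 0) <= T].
Proof.
have [eps [e0 He]] : exists eps : R, 0 < eps /\
    forall g, G g -> (forall i j, `|g i j - (1%:M : 'M[R]_n) i j| < eps) -> g = 1%:M.
  by case: GP => -[].
have n0 := spcc_dim GP.
(* Makes [n |T| del < eps], where [n |T| del] bounds an entry of [g^-1 (h - g)]. *)
pose del := eps / (n%:R * `|T| + 1).
have q0 : 0 < n%:R * `|T| + 1 by rewrite ltr_wpDl// mulr_ge0.
have del0 : 0 < del by rewrite divr_gt0.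
pose m := Num.truncn (2 * `|T| / del).
pose f (g : 'M[R]_n) : {ffun 'I_n * 'I_n -> 'I_m.+1} :=
  [ffun ij => inord (Num.truncn ((g ij.1 ij.2 + `|T|) / del))].
have ent g i j : G g -> expR (mu g 0) <= T -> `|g i j| <= `|T|.
  move=> Gg gT; apply: (@entry_le_normc _ _) => v.
  rewrite (le_trans (normc_mul_le n0 v (G_det GP Gg)))// ler_wpM2r ?normc_ge0//.
  by rewrite (le_trans gT)// ler_norm.
have cell g i j : G g -> expR (mu g 0) <= T ->
    let k := (f g (i, j) : nat) in k%:R * del <= g i j + `|T| < (k.+1)%:R * del.
  move=> Gg gT; rewrite /f ffunE /=.
  have := ent _ i j Gg gT; rewrite ler_norml => /andP[l1 l2].
  have p0 : 0 <= (g i j + `|T|) / del by rewrite divr_ge0 ?(ltW del0)//; lra.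
  rewrite inordK.
    by have := truncn_itv p0; rewrite ler_pdivlMr// ltr_pdivrMr.
  rewrite ltnS /m; apply: le_truncn; rewrite ler_pM2r ?invr_gt0//; lra.
apply: (@finite_set_inj _ _ _ f) => g h [Gg [gT gT']] [Gh [hT hT']] fE.
have gh i j : `|h i j - g i j| < del.
  have /andP[l1 l2] := cell g i j Gg gT; have /andP[l3 l4] := cell h i j Gh hT.
  rewrite fE in l1 l2; rewrite ltr_norml; move: l1 l2 l3 l4.
  move: (nat_of_ord (f h (i, j))) => k /=; rewrite -!natr1 !mulrDl !mul1r.
  move: (k%:R * del) (g i j) (h i j) => x y z l1 l2 l3 l4.
  by clear -l1 l2 l3 l4; apply/andP; split; lra.
have Gi := G_inv GP Gg; have gu := G_unit GP Gg.
have /(congr1 (mulmx g)) : invmx g *m h = 1%:M.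
  apply: He; first exact: (G_mul GP).
  move=> i j; rewrite -(mulVmx gu) -[X in `|X|](_ : (invmx g *m (h - g)) i j = _); last first.
    by rewrite mulmxBr; set X := invmx g *m h; set Y := invmx g *m g; rewrite !mxE.
  rewrite mxE (le_lt_trans (ler_norm_sum _ _ _))//.
  apply: (@le_lt_trans _ _ (\sum_(k < n) `|T| * del)).
    apply: ler_sum => k _; rewrite normrM ler_pM// ?(ent _ _ _ Gi)//.
    by rewrite !mxE ltW.
  rewrite sumr_const card_ord -[ltLHS]mulr_natl mulrA.
  by rewrite /del mulrA ltr_pdivrMr// mulrC ltr_pM2l// ltrDl ltr01.
by rewrite mulmxA mulmxV// mul1mx mulmx1.
Qed.

(** A bound on [d o (g o)] bounds the product of the norms of [g] and [g^-1], and neither is below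
    [1]. *)
Lemma orbit_finite o (N : R) : K o -> finite_set [set g | G g /\ d o (g *m o) <= N].
Proof.
move=> Ko; have [r r0 Hr] := cone_open OmP Ko.
have [B B0 HB] := cone_normc OmP.
have [_ po] := Ko.
pose q := B / r * pairing phi o.
have q0 : 0 < q by rewrite !mulr_gt0// invr_gt0.
apply: sub_finite_set (G_bounded_finite (q ^+ 2 * expR (2 * N))) => g /= [Gg dN].
split=> //.
have [gs [gsE gu Kg Ki]] := G_cone GP Gg.
have n0 := spcc_dim GP.
have c1 := cone_opnorm B0 r0 HB Hr Kg (G_det GP Gg) gsE.
have c2 := cone_opnorm B0 r0 HB Hr Ki (G_det GP (G_inv GP Gg)) (invmx_sign (G_unit GP Gg) gsE).
have phi0 v : K v -> 0 <= pairing phi v by move=> [_ /ltW].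
have p1 := gauge_pairing OmP (gs *m o) phi0 Ko.
have p2 := gauge_pairing OmP (invmx gs *m o) phi0 Ko.
have E : M o (invmx gs *m o) = M (gs *m o) o.
  by rewrite -(gauge_invariant GP gu Kg Ki Ko (Ki _ Ko)) mulmxA mulmxV// mul1mx.
have g1 := gauge_gt0 OmP Ko (Kg _ Ko); have g2 := gauge_gt0 OmP (Kg _ Ko) Ko.
have MM : M o (gs *m o) * M (gs *m o) o <= expR (2 * N).
  move: dN; rewrite -(hilbert_signr gsE Ko.1 (G_Om GP Gg Ko.1)) (hilbert_gauge OmP Ko (Kg _ Ko)).
  rewrite ler_pdivrMr// => dN.
  by rewrite -[leLHS]lnK ?posrE ?mulr_gt0// ler_expR (mulrC 2).
have e1 : 1 <= expR (mu g 0) by rewrite -expR0 ler_expR mu0_ge0// (G_det GP Gg).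
have e2 : 1 <= expR (mu (invmx g) 0).
  by rewrite -expR0 ler_expR mu0_ge0// (G_det GP (G_inv GP Gg)).
have Br : 0 < B / r by rewrite divr_gt0.
have f1 : expR (mu g 0) <= q * M o (gs *m o).
  rewrite (le_trans c1)// (_ : q * _ = B / r * (M o (gs *m o) * pairing phi o)) ?ler_pM2l//.
  by rewrite /q mulrAC -mulrA.
have f2 : expR (mu (invmx g) 0) <= q * M (gs *m o) o.
  rewrite (le_trans c2)// -E (_ : q * _ = B / r * (M o (invmx gs *m o) * pairing phi o)) ?ler_pM2l//.
  by rewrite /q mulrAC -mulrA.
have prod : expR (mu g 0) * expR (mu (invmx g) 0) <= q ^+ 2 * expR (2 * N).
  apply: (@le_trans _ _ ((q * M o (gs *m o)) * (q * M (gs *m o) o))).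
    by rewrite ler_pM ?expR_ge0.
  have -> : q * M o (gs *m o) * (q * M (gs *m o) o) = q ^+ 2 * (M o (gs *m o) * M (gs *m o) o) by ring.
  by rewrite ler_pM2l// exprn_gt0.
split; first exact: le_trans (ler_peMr (expR_ge0 _) e2) prod.
exact: le_trans (ler_peMl (expR_ge0 _) e1) prod.
Qed.

End Norms.

(** * The lower bound *)

Section LowerGeometry.
Variables (R : realType) (n : nat).
Implicit Types (u v w x y z : 'cV[R]_n) (a b s t : R) (g h : 'M[R]_n) (p : 'rV[R]_n).
Variable (G : set 'M[R]_n) (Om C : set 'cV[R]_n).
Hypothesis GP : strongly_proj_convex_cocompact G Om C.
Local Notation phi := (chart Om).
Local Notation K := (cone Om).
Local Notation M := (gauge Om).
Local Notation d := (hilbert_dist Om).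
Let OmP := spcc_Om GP.

Lemma normrow_gt0 p : (0 < normrow p) = (p != 0).
Proof. by rewrite normrowE normc_gt0 -(inj_eq (@trmx_inj _ _ _)) trmx0 trmxK. Qed.

Lemma functional_sign p : (forall v, Om v -> pairing p v != 0) ->
  exists2 e : R, e = 1 \/ e = -1 & forall v, K v -> 0 < pairing (e *: p) v.
Proof.
move=> Hp; have [ o _ Ko] := exists_base GP.
have sgn e v : e != 0 -> K v -> 0 < e * pairing p o -> 0 < e * pairing p v.
  move=> e0 Kv po; rewrite ltNge; apply/negP => pv.
  have := Hp (- (e * pairing p v) *: o + (e * pairing p o) *: v).
  rewrite pairingD !pairingZ => E.
  have /E/eqP : Om (- (e * pairing p v) *: o + (e * pairing p o) *: v).
    have Kv' : K ((e * pairing p o) *: v) by exact: (cone_scale OmP).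
    move: pv; rewrite le_eqVlt => /orP[/eqP ->|pv]; first by rewrite oppr0 scale0r add0r; case: Kv'.
    suff [] : K (- (e * pairing p v) *: o + (e * pairing p o) *: v) by [].
    apply: (cone_add OmP) => //; apply: (cone_scale OmP) => //.
    by rewrite oppr_gt0.
  by apply; ring.
have := Hp _ Ko.1; rewrite neq_lt => /orP[po|po].
  exists (-1); first by right.
  by move=> v Kv; rewrite pairingZl sgn// ?oppr_eq0 ?oner_eq0// mulN1r oppr_gt0.
exists 1; first by left.
by move=> v Kv; rewrite pairingZl sgn// ?oner_eq0// mul1r.
Qed.

(** Each gauge is bounded below by one functional: [M o w >= phi w / phi o] and
    [M w o >= p o / p w], where [p o >= r |p|] because the cone contains a ball around [o]. *)
Lemma hilbert_ge_functional o r p w k : 0 < r -> (forall u, normc u <= r -> K (o + u)) ->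
  K o -> K w -> p != 0 -> (forall v, K v -> 0 < pairing p v) -> 0 < k ->
  pairing p w <= k * normrow p * pairing phi w ->
  ln (r / pairing phi o / k) / 2 <= d o w.
Proof.
move=> r0 Hr Ko Kw p0 pp k0 pw; rewrite (hilbert_gauge OmP)// ler_pM2r ?invr_gt0//.
have pp' v : K v -> 0 <= pairing p v by move=> /pp/ltW.
have phi0 v : K v -> 0 <= pairing phi v by move=> [_ /ltW].
have po : 0 < pairing phi o by case: Ko.
have pw0 : 0 < pairing phi w by case: Kw.
have g1 := gauge_gt0 OmP Ko Kw; have g2 := gauge_gt0 OmP Kw Ko.
rewrite ler_ln ?posrE ?mulr_gt0 ?invr_gt0//.
have h1 := gauge_pairing OmP w phi0 Ko.
have h2 := gauge_pairing OmP o pp' Kw.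
have h3 := pos_on_cone p0 pp' Hr r0.
have np : 0 < normrow p by rewrite normrow_gt0.
rewrite -mulrA -invfM ler_pdivrMr ?mulr_gt0//.
rewrite -(ler_pM2r np) -(ler_pM2r pw0).
apply: (@le_trans _ _ (M w o * pairing p w * pairing phi w)).
  by rewrite ler_pM2r// (le_trans h3).
apply: (@le_trans _ _ (M w o * (k * normrow p * pairing phi w) * (M o w * pairing phi o))).
  by rewrite ler_pM ?mulr_ge0 ?(ltW g2) ?pp' ?phi0// ler_pM2l.
by rewrite le_eqVlt; apply/orP; left; apply/eqP; ring.
Qed.

(** The condition on [p] is convex, so it holds on the whole segment from [y] to [z] and keeps the
    segment far from [o]; and [(y | z)] based at [o] is, up to [2 dl], at least the distance from
    [o] to some point of the segment. *)
Lemma gromov_ge_functional dl o r p y z k :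
  (forall x y z w, Om x -> Om y -> Om z -> Om w ->
     Num.min (gromov_product d w x y) (gromov_product d w y z) - dl <= gromov_product d w x z) ->
  0 < r -> (forall u, normc u <= r -> K (o + u)) ->
  K o -> K y -> K z -> p != 0 -> (forall v, K v -> 0 < pairing p v) -> 0 < k ->
  pairing p y <= k * normrow p * pairing phi y ->
  pairing p z <= k * normrow p * pairing phi z ->
  ln (r / pairing phi o / k) / 2 - 2 * dl <= gromov_product d o y z.
Proof.
move=> hyp r0 Hr Ko Ky Kz p0 pp k0 py pz.
have [Oo _] := Ko; have [Oy _] := Ky; have [Oz _] := Kz.
(* For [w] at this distance from [y], the products [(y | o)] and [(o | z)] based at [w] are both
   equal to [(d o w - (y | z)) / 2], with [(y | z)] based at [o]; hyperbolicity bounds them by [dl],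
   as [(y | z)] based at [w] is [0]. *)
pose t := gromov_product d y o z.
have t01 : 0 <= t <= d y z.
  rewrite /t /gromov_product; have := hilbert_triangle OmP Oo Oy Oz.
  have := hilbert_triangle OmP Oy Oz Oo.
  have := hilbert_triangle OmP Oo Oz Oy.
  rewrite (hilbert_sym OmP Oo Oy) (hilbert_sym OmP Oz Oo) (hilbert_sym OmP Oz Oy).
  dist_lra.
have [s s01] := hilbert_segment OmP Ky Kz t01.
set w := _ + _ => /= -[yw wz].
have Kw : K w by exact: (cone_segment OmP).
have [Ow _] := Kw.
have pw : pairing p w <= k * normrow p * pairing phi w.
  move: s01 => /andP[s0 s1].
  have s1' : 0 <= 1 - s by rewrite subr_ge0.
  have := lerD (ler_wpM2l s1' py) (ler_wpM2l s0 pz).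
  rewrite /w !pairingD !pairingZ; clear; lra.
have dow := hilbert_ge_functional r0 Hr Ko Kw p0 pp k0 pw.
have := hyp y o z w Oy Oo Oz Ow.
rewrite (_ : gromov_product d w y z = 0); last first.
  by rewrite /gromov_product (hilbert_sym OmP Ow Oy) yw wz; dist_lra.
have wy := hilbert_sym OmP Ow Oy; have wo := hilbert_sym OmP Ow Oo.
have yo := hilbert_sym OmP Oy Oo; have zo := hilbert_sym OmP Oz Oo.
move: dow; set E := ln _ / 2 => dow.
have [m|m] := leP (gromov_product d w y o) (gromov_product d w o z).
  move: m yw wz wy wo yo zo dow; rewrite /t /gromov_product; dist_lra.
move: m yw wz wy wo yo zo dow; rewrite /t /gromov_product; dist_lra.
Qed.

(** Take [y] in [C] inside the strip, near the limit point, and [m] on the segment from [o] to [y]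
    at distance [t = ln (A / k) / 2] from [o]. Any [z] of the strip has Gromov product at least
    [t - 2 dl] with [y], so [m] is nearly on the way from [o] to [z]; and [m] lies in [C] by
    convexity, hence near the orbit. *)
Lemma shadow_lemma o : C o -> K o -> exists2 k0 : R, 0 < k0 & exists c : R,
  forall q, xi_sym_image Om C q -> forall k, 0 < k -> k < k0 ->
  exists2 g, G g & forall z, Om z ->
    `|pairing q.2 z| < k * normrow q.2 * `|pairing phi z| ->
    d (g *m o) z <= d o z + ln k / 2 + c.
Proof.
move=> Co Ko; have [Oo po] := Ko; have [r r0 Hr] := cone_open OmP Ko.
have [dl [dl0 hyp]] : gromov_hyperbolic Om d by case: GP => _ [_ [_ []]].
have [D D0 HD] := cocompact_bound GP Co Ko.
pose A := r / pairing phi o.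
have A0 : 0 < A by rewrite divr_gt0.
(* [k < A] makes [t] nonnegative. The term [6 dl] is twice the loss in [(m | z)]: [2 dl] from
   [gromov_ge_functional] and [dl] from one more use of hyperbolicity. *)
exists A => //; exists (D + 6 * dl - ln A / 2) => -[x q] [/= [x0 [cx nOx]] [q0 [qx qOm]]] k k0 kA.
have [e e1 ep] := functional_sign qOm.
set p := e *: q in ep.
have e0 : e != 0 by case: e1 => ->; rewrite ?oppr_eq0 oner_eq0.
have p0 : p != 0 by rewrite scaler_eq0 negb_or e0.
have en : `|e| = 1 by case: e1 => ->; rewrite ?normrN normr1.
have pq v : `|pairing p v| = `|pairing q v| by rewrite pairingZl normrM en mul1r.
have npq : normrow p = normrow q by rewrite !normrowE linearZ /= normcZ en mul1r.
have np : 0 < normrow p by rewrite normrow_gt0.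
have toK z : Om z -> exists2 c : R, c = 1 \/ c = -1 & K (c *: z).
  move=> /(Om_cone OmP)[Kz|Kz]; first by exists 1; [left|rewrite scale1r].
  by exists (-1); [right|rewrite scaleN1r].
have cond c z : c = 1 \/ c = -1 -> K (c *: z) ->
    `|pairing q z| < k * normrow q * `|pairing phi z| ->
    pairing p (c *: z) <= k * normrow p * pairing phi (c *: z).
  move=> c1 [_ Kz] L; rewrite -(gtr0_norm Kz) (le_trans (ler_norm _))//.
  by rewrite !pairingZ !normrM (_ : `|c| = 1) ?mul1r ?pq ?npq ?ltW//; case: c1 => ->; rewrite ?normrN normr1.
have [y Cy Ly] : exists2 y, C y & `|pairing q y| < k * normrow q * `|pairing phi y|.
  have [B B0 HB] := closure_Om_chart OmP.
  have cOx : closure Om x by apply: closure_subset cx; exact: (C_Om GP).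
  have px : 0 < `|pairing phi x|.
    have : 0 < normc x by rewrite normc_gt0.
    by move=> /lt_le_trans/(_ (HB _ cOx)); rewrite pmulr_rgt0.
  have nphi : 0 <= normrow phi by rewrite normrowE normc_ge0.
  have s0 : 0 < 1 + k * normrow phi by rewrite ltr_wpDr// mulr_ge0// ltW.
  have /closure_normcP/(_ (k * `|pairing phi x| / (1 + k * normrow phi))) := cx.
  case; first by rewrite divr_gt0// mulr_gt0.
  move=> y Cy; rewrite ltr_pdivlMr// => yx; exists y => //.
  have h1 : `|pairing q y| <= normrow q * normc (y - x).
    by have := pairing_le q (y - x); rewrite pairingD pairingN qx subr0.
  have h2 : `|pairing phi x| <= `|pairing phi y| + normrow phi * normc (y - x).
    have -> : pairing phi x = pairing phi y - pairing phi (y - x).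
      by rewrite pairingD pairingN subKr.
    by rewrite (le_trans (ler_normB _ _))// lerD2l pairing_le.
  apply: le_lt_trans h1 _; rewrite -npq (mulrC k) -mulrA ltr_pM2l//.
  have := ler_wpM2l (ltW k0) h2; rewrite mulrDr; move: yx; clear; lra.
have [cy cy1 Ky] := toK _ (C_Om GP Cy).
have Cy' : C (cy *: y) by apply: (C_scale GP) => //; case: cy1 => ->; rewrite ?oppr_eq0 oner_eq0.
have py := cond _ _ cy1 Ky Ly.
move: Cy' Ky py; set y' := cy *: y => Cy' Ky py.
have [Oy' _] := Ky.
pose t := ln (A / k) / 2.
have t01 : 0 <= t <= d o y'.
  rewrite (hilbert_ge_functional r0 Hr Ko Ky p0 ep k0 py) andbT divr_ge0// ln_ge0//.
  by rewrite ler_pdivlMr// mul1r ltW.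
have [s s01] := hilbert_segment OmP Ko Ky t01.
set m := _ + _ => /= -[om my].
have Cm : C m by exact: (C_segment GP).
have Om_m := C_Om GP Cm.
have [g Gg dg] := HD _ Cm; exists g => // z Oz Lz.
have [cz cz1 Kz] := toK _ Oz.
have pz := cond _ _ cz1 Kz Lz.
have cz0 : cz != 0 by case: cz1 => ->; rewrite ?oppr_eq0 oner_eq0.
have dz v : Om v -> d v (cz *: z) = d v z.
  move=> Ov; have -> : d v (cz *: z) = d (1 *: v) (cz *: z) by rewrite scale1r.
  by rewrite (hilbert_scale OmP) ?oner_eq0.
have gr := gromov_ge_functional hyp r0 Hr Ko Ky Kz p0 ep k0 py pz.
have Ogo := G_Om GP Gg Oo.
have tE : t = ln A / 2 - ln k / 2 by rewrite /t ln_div ?posrE// mulrBl.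
have tri := hilbert_triangle OmP Ogo Om_m Oz.
rewrite (hilbert_sym OmP Ogo Om_m) in tri.
have := hyp m y' (cz *: z) o Om_m Oy' Kz.1 Oo.
rewrite lerBlDr ge_min => H.
move: gr H om my tri dg tE dl0; rewrite -/A -/t /gromov_product !dz//.
move: (ln A) (ln k) (t) => lA lk t' gr /orP[] H; move: gr H; dist_lra.
Qed.

End LowerGeometry.

(** * Flags over the limit set *)

Section LimitSet.
Variables (R : realType) (n : nat).
Implicit Types (u v w x y z : 'cV[R]_n) (a b s t : R) (g h : 'M[R]_n) (p : 'rV[R]_n).
Implicit Types (q : 'cV[R]_n * 'rV[R]_n).
Variable (G : set 'M[R]_n) (Om C : set 'cV[R]_n).
Hypothesis GP : strongly_proj_convex_cocompact G Om C.
Local Notation phi := (chart Om).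
Local Notation K := (cone Om).
Local Notation d := (hilbert_dist Om).
Let OmP := spcc_Om GP.

Lemma angle_c_scale a b v w : a != 0 -> b != 0 -> angle_c (a *: v) (b *: w) = angle_c v w.
Proof.
move=> a0 b0; rewrite /angle_c !normcZ dotcZl dotcZr !normrM; congr acos.
have [->|v0] := eqVneq (normc v) 0; first by rewrite !(mulr0, mul0r) invr0 !mulr0.
have [->|w0] := eqVneq (normc w) 0; first by rewrite !(mulr0, mul0r) invr0 !mulr0.
by field; rewrite v0 w0 !normr_eq0 a0 b0.
Qed.

Lemma dsym_ge_c q q' : angle_c q.1 q'.1 <= dsym q q'.
Proof.
rewrite /dsym -{1}(ger0_norm (angle_c_ge0 q.1 q'.1)) -sqrtr_sqr ler_wsqrtr//.
by rewrite lerDl sqr_ge0.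
Qed.

Lemma dsym_ge_r q q' : angle_r q.2 q'.2 <= dsym q q'.
Proof.
have := angle_c_ge0 q.2^T q'.2^T; rewrite -angle_rE => h.
by rewrite /dsym -{1}(ger0_norm h) -sqrtr_sqr ler_wsqrtr// lerDr sqr_ge0.
Qed.

Lemma dsym_le q q' : dsym q q' <= angle_c q.1 q'.1 + angle_r q.2 q'.2.
Proof.
have h1 := angle_c_ge0 q.1 q'.1.
have := angle_c_ge0 q.2^T q'.2^T; rewrite -angle_rE => h2.
rewrite /dsym -[leRHS](ger0_norm (addr_ge0 h1 h2)) -sqrtr_sqr ler_wsqrtr//.
by rewrite sqrrD lerD2r lerDl mulrn_wge0// mulr_ge0.
Qed.

Lemma dsym_ge0 q q' : 0 <= dsym q q'.
Proof. exact: sqrtr_ge0. Qed.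

Lemma closure_C_chart : exists2 B : R, 0 < B & forall x, closure C x ->
  normc x <= B * `|pairing phi x|.
Proof.
have [B B0 HB] := closure_Om_chart OmP; exists B => // x cx; apply: HB.
by apply: closure_subset cx; exact: (C_Om GP).
Qed.

Lemma closure_C_scale (c : R) x : c != 0 -> closure C x -> closure C (c *: x).
Proof.
move=> c0 /closure_normcP cx; apply/closure_normcP => e e0.
have nc : 0 < `|c| by rewrite normr_gt0.
have [y Cy yx] := cx (e / `|c|) (divr_gt0 e0 nc).
exists (c *: y); first exact: (C_scale GP).
by rewrite -scalerBr normcZ mulrC -ltr_pdivlMr// normr_gt0.
Qed.

(** Fixes the signs of unit representatives: the point in the closed cone, the functional positive
    on the cone. *)
Lemma xi_normalize B : 0 < B -> (forall x, closure C x -> normc x <= B * `|pairing phi x|) ->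
  forall q, xi_sym_image Om C q -> exists a e : R,
  [/\ a != 0, e != 0, normc (a *: q.1) = 1 & normrow (e *: q.2) = 1] /\
  [/\ 1 <= B * pairing phi (a *: q.1), closure K (a *: q.1) &
      forall v, K v -> 0 < pairing (e *: q.2) v].
Proof.
move=> B0 HB [x p] [/= [x0 [cx nOx]] [p0 [px pOm]]].
have nx : 0 < normc x by rewrite normc_gt0.
have np : 0 < normrow p by rewrite normrow_gt0.
have pp : 0 < `|pairing phi x|.
  by have := lt_le_trans nx (HB _ cx); rewrite pmulr_rgt0.
have [e e1 ep] := functional_sign GP pOm.
have en : `|e| = 1 by case: e1 => ->; rewrite ?normrN normr1.
pose a := Num.sg (pairing phi x) / normc x.
have a0 : a != 0.
  apply: mulf_neq0; first by rewrite sgr_eq0 -normr_gt0.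
  by rewrite invr_eq0 gt_eqF.
have an : `|a| = (normc x)^-1.
  by rewrite normrM normr_sg -normr_gt0 pp mul1r gtr0_norm ?invr_gt0.
have E : pairing phi (a *: x) = `|pairing phi x| / normc x.
  by rewrite pairingZ /a mulrAC -normrEsg.
exists a, (e / normrow p); split; split=> //.
- apply: mulf_neq0; first by rewrite -normr_gt0 en ltr01.
  by rewrite invr_eq0 gt_eqF.
- by rewrite normcZ an mulVf// gt_eqF.
- by rewrite normrowE linearZ /= normcZ -normrowE normrM en mul1r gtr0_norm ?invr_gt0// mulVf// gt_eqF.
- by rewrite E mulrA ler_pdivlMr// mul1r HB.
- have cO : closure Om (a *: x).
    exact: closure_subset (C_Om GP) _ (closure_C_scale a0 cx).
  have pa : 0 < pairing phi (a *: x) by rewrite E divr_gt0.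
  exact: closure_Om_cone cO pa.
- move=> v /ep; rewrite -[e / _]mulrC -scalerA [pairing (_^-1 *: _) _]pairingZl => H.
  by rewrite mulr_gt0 ?invr_gt0.
Qed.

(* Since [p x = p' x' = 0], [p' x + p x' = (p' - p) (x - x')] is quadratic in the
   distance. *)
Lemma dsym_pairing : exists2 r0 : R, 0 < r0 & exists2 B : R, 0 < B &
  forall q q' (rho : R), xi_sym_image Om C q -> xi_sym_image Om C q' ->
    dsym q q' <= rho -> rho < r0 ->
    `|pairing q'.2 q.1| <= B * rho ^+ 2 * normrow q'.2 * `|pairing phi q.1|.
Proof.
have [B B0 HB] := closure_C_chart.
have [ o Co Ko] := exists_base GP; have [r r1 Hr] := cone_open OmP Ko.
have no : 0 < normc o by rewrite normc_gt0 (cone_neq0 Ko).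
have nf : 0 <= normrow phi by rewrite normrowE normc_ge0.
(* Each bound makes one of the angles come from vectors with nonnegative scalar product. Otherwise
   [|x + x'| <= rho] against [phi (x + x') >= 2 / B], respectively [|p + p'| <= rho] against
   [(p + p') o >= 2 r]. *)
exists (Num.min (2 / (B * (normrow phi + 1))) (2 * r / normc o)).
  by rewrite lt_min !divr_gt0 ?mulr_gt0// ltr_wpDl.
exists B => // q q' rho xq xq' dr; rewrite lt_min => /andP[r01 r02].
have rho0 : 0 <= rho := le_trans (dsym_ge0 q q') dr.
have [a [e [[a0 e0 x1 p1] [fx cx pp]]]] := xi_normalize B0 HB xq.
have [a' [e' [[a'0 e'0 x1' p1'] [fx' cx' pp']]]] := xi_normalize B0 HB xq'.
have qx : pairing q.2 q.1 = 0 by case: xq => _ [_ []].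
have qx' : pairing q'.2 q'.1 = 0 by case: xq' => _ [_ []].
have ac : angle_c (a *: q.1) (a' *: q'.1) <= rho.
  by rewrite angle_c_scale// (le_trans (dsym_ge_c q q')).
have ar : angle_r (e *: q.2) (e' *: q'.2) <= rho.
  by rewrite angle_rE !linearZ /= angle_c_scale// -angle_rE (le_trans (dsym_ge_r q q')).
have px : pairing (e *: q.2) (a *: q.1) = 0 by rewrite pairingZ pairingZl qx !mulr0.
have px' : pairing (e' *: q'.2) (a' *: q'.1) = 0 by rewrite pairingZ pairingZl qx' !mulr0.
suff key : pairing (e' *: q'.2) (a *: q.1) <= rho ^+ 2.
  have k0 : 0 <= pairing (e' *: q'.2) (a *: q.1).
    by apply: pairing_closure_cone_ge0 cx => v /pp'/ltW.
  have : `|e'| * `|a| * `|pairing q'.2 q.1| <= rho ^+ 2.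
    by rewrite -!normrM -mulrA -pairingZ -pairingZl ger0_norm.
  have na : 0 < `|a| by rewrite normr_gt0.
  have ne : 0 < `|e'| by rewrite normr_gt0.
  move=> L; rewrite -(ler_pM2l (mulr_gt0 ne na)) (le_trans L)//.
  have -> : `|e'| * `|a| * (B * rho ^+ 2 * normrow q'.2 * `|pairing phi q.1|) =
     rho ^+ 2 * ((`|e'| * normrow q'.2) * (B * (`|a| * `|pairing phi q.1|))) by ring.
  have -> : `|e'| * normrow q'.2 = 1 by rewrite -p1' !normrowE linearZ /= normcZ.
  rewrite mul1r ler_peMr ?sqr_ge0// -normrM -pairingZ.
  by rewrite (le_trans fx)// ler_pM2l// ler_norm.
move: (a *: q.1) (a' *: q'.1) (e *: q.2) (e' *: q'.2) x1 p1 fx cx pp x1' p1' fx' cx' pp' ac ar px px'.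
move=> x x' p p' x1 p1 fx cx pp x1' p1' fx' cx' pp' ac ar px px'.
have h : 0 <= pairing p x' by apply: pairing_closure_cone_ge0 cx' => v /pp/ltW.
have E : pairing p' x + pairing p x' = pairing (p' - p) (x - x').
  by rewrite !(pairingD, pairingN, pairingDl, pairingNl) px px'; ring.
have xx : 0 <= dotc x x'.
  rewrite leNgt; apply/negP => neg.
  have x1N : normc (- x') = 1 by rewrite normcN.
  have := @normc_dist_le_angle _ _ x (- x') x1 x1N.
  rewrite dotcNr oppr_ge0 (ltW neg) => /(_ isT); rewrite opprK -scaleN1r -[x in angle_c x _]scale1r.
  rewrite angle_c_scale ?oppr_eq0 ?oner_eq0// => L.
  have := le_trans (ler_norm _) (pairing_le phi (x + x')); rewrite pairingD => L2.
  have q0 : 0 < B * (normrow phi + 1) by rewrite mulr_gt0// ltr_wpDl.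
  move: r01; rewrite (ltr_pdivlMr _ _ q0).
  have L3 : normrow phi * normc (x + x') <= (normrow phi + 1) * rho.
    by rewrite ler_pM ?normc_ge0// ?lerDl// (le_trans L).
  have := ler_wpM2l (ltW B0) (le_trans L2 L3).
  move: fx fx'; clear; lra.
have pps : 0 <= dotc p^T p'^T.
  have p0 : p != 0 by rewrite -normrow_gt0 p1.
  have p'0 : p' != 0 by rewrite -normrow_gt0 p1'.
  have o1 := @pos_on_cone _ _ Om p o r p0 (fun v Kv => ltW (pp v Kv)) Hr r1.
  have o2 := @pos_on_cone _ _ Om p' o r p'0 (fun v Kv => ltW (pp' v Kv)) Hr r1.
  rewrite leNgt; apply/negP => neg.
  have p1T : normc p^T = 1 by rewrite -normrowE.
  have p1N : normc (- p'^T) = 1 by rewrite normcN -normrowE.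
  have := @normc_dist_le_angle _ _ p^T (- p'^T) p1T p1N.
  rewrite dotcNr oppr_ge0 (ltW neg) => /(_ isT); rewrite opprK -scaleN1r -[x in angle_c x _]scale1r.
  rewrite angle_c_scale ?oppr_eq0 ?oner_eq0// -angle_rE => L.
  have := le_trans (ler_norm _) (pairing_le (p + p') o); rewrite pairingDl normrowE linearD /= => L2.
  move: r02; rewrite ltr_pdivlMr//.
  have L3 : normc (p^T + p'^T) * normc o <= rho * normc o.
    by rewrite ler_pM2r// (le_trans L).
  move: o1 o2; rewrite p1 p1' mulr1; move: (le_trans L2 L3); clear; lra.
have d1 := le_trans (normc_dist_le_angle x1 x1' xx) ac.
have d2 : normrow (p' - p) <= rho.
  rewrite normrowE linearB /= normc_distC (le_trans _ ar)// angle_rE.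
  by apply: normc_dist_le_angle => //; rewrite -normrowE.
have := le_trans (ler_norm _) (pairing_le (p' - p) (x - x')); rewrite -E.
have : normrow (p' - p) * normc (x - x') <= rho ^+ 2.
  by rewrite expr2 ler_pM ?normc_ge0// normrowE normc_ge0.
by move: h; clear; lra.
Qed.

(** Through this, a cover of the flags covers the limit set. *)
Lemma xi_sym_exists x : limit_set Om C x -> exists p, xi_sym_image Om C (x, p).
Proof.
have pos z : limit_set Om C z -> 0 < pairing phi z -> exists p, xi_sym_image Om C (z, p).
  move=> [z0 [cz nOz]] pz.
  have ck : closure K z.
    exact: closure_Om_cone (closure_subset (C_Om GP) cz) pz.
  have [|p [p0 p1 p2]] := supporting_functional OmP ck; first by move=> [].
  exists p; do 3!split=> //; move=> v /(Om_cone OmP)[/p2|/p2] /=.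
    by rewrite lt0r => /andP[].
  by rewrite pairingN oppr_gt0 => /ltr0_neq0.
move=> lx; have [x0 [cx nOx]] := lx.
have [B B0 HB] := closure_C_chart.
have px : pairing phi x != 0.
  rewrite -normr_gt0; have nx : 0 < normc x by rewrite normc_gt0.
  by have := lt_le_trans nx (HB _ cx); rewrite pmulr_rgt0.
move: px; rewrite neq_lt => /orP[px|px]; last exact: pos.
have N1 : (-1 : R) != 0 by rewrite oppr_eq0 oner_eq0.
have [||p [_ [p0 [p1 p2]]]] := pos (- x).
- split; first by rewrite oppr_eq0.
  split; first by rewrite -scaleN1r; apply: closure_C_scale.
  by move=> /(Om_scale OmP N1); rewrite scaleN1r opprK.
- by rewrite pairingN oppr_gt0.
exists p; do 3!split=> //=.
by move: p1; rewrite /= pairingN => /eqP; rewrite oppr_eq0 => /eqP.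
Qed.

Lemma nbhs_strip p k z : 0 <= k -> `|pairing p z| < k * `|pairing phi z| ->
  nbhs z [set v | `|pairing p v| < k * `|pairing phi v|].
Proof.
move=> k0 L; apply/nbhs_normcP.
pose q := normrow p + k * normrow phi + 1.
have np : 0 <= normrow p by rewrite normrowE normc_ge0.
have nf : 0 <= normrow phi by rewrite normrowE normc_ge0.
have q0 : 0 < q by rewrite ltr_wpDl// addr_ge0// mulr_ge0.
exists ((k * `|pairing phi z| - `|pairing p z|) / q).
  by rewrite divr_gt0// subr_gt0.
move=> y; rewrite ltr_pdivlMr// => yz /=.
have h1 : `|pairing p y| <= `|pairing p z| + normrow p * normc (y - z).
  rewrite -{1}[y](subrK z) pairingD addrC (le_trans (ler_normD _ _))// lerD2l.
  exact: pairing_le.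
have h2 : `|pairing phi z| <= `|pairing phi y| + normrow phi * normc (y - z).
  have -> : pairing phi z = pairing phi y - pairing phi (y - z).
    by rewrite pairingD pairingN subKr.
  by rewrite (le_trans (ler_normB _ _))// lerD2l pairing_le.
have := ler_wpM2l k0 h2; rewrite mulrDr.
move: yz; rewrite /q !mulrDr; have := normc_ge0 (y - z); move: h1; clear.
rewrite mulr1 (mulrCA (normc _)) (mulrC (normc _) (normrow p)) (mulrC (normc _) (normrow phi)).
by move=> *; lra.
Qed.

(** Compactness of the unit vectors of [closure C]: those in [Om] have neighbourhoods at bounded
    Hilbert distance from [o], the limit points lie in open strips, and finitely many of these sets
    suffice. *)
Lemma cover_orbit o (k : nat -> R)
    (qq : nat -> 'cV[R]_n * 'rV[R]_n) : C o -> Om o -> (forall i, 0 <= k i) ->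
  (forall x p, xi_sym_image Om C (x, p) -> exists i,
     `|pairing (qq i).2 x| < k i * normrow (qq i).2 * `|pairing phi x|) ->
  exists N : nat, forall v, C v -> d o v <= N%:R \/
    exists2 i, (i < N)%N & `|pairing (qq i).2 v| < k i * normrow (qq i).2 * `|pairing phi v|.
Proof.
move=> Co Oo k0 cov.
pose A := closure C `&` [set v | normc v = 1].
pose V i := [set v | `|pairing (qq i).2 v| < k i * normrow (qq i).2 * `|pairing phi v|].
have kk i : 0 <= k i * normrow (qq i).2 by rewrite mulr_ge0// normrowE normc_ge0.
have cA : compact A.
  apply: (@closed_normc_bounded_compact _ _ _ 1); last by move=> v [_ ->].
  by apply: closedI; [exact: closed_closure|exact: closed_sphere].
have [|x [cx x1]|N HN] := @compact_nat_cover _ A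
    (fun N => [set v | Om v /\ d o v <= N%:R] `|` [set v | exists2 i, (i < N)%N & V i v]) cA.
- move=> i j ij v [[Ov dv]|[l li Vl]]; [left; split=> //|right; exists l => //].
    by rewrite (le_trans dv)// ler_nat.
  exact: leq_trans li ij.
- have [Ox|nOx] := pselect (Om x).
    have [N HN] := hilbert_locally_bounded GP Oo Ox; exists N.
    by apply: filterS HN => v Hv; left.
  have [|p xp] := @xi_sym_exists x.
    by split=> //; rewrite -normc_gt0 x1 ltr01.
  have [i Hi] := cov _ _ xp; exists i.+1.
  by apply: filterS (nbhs_strip (kk i) Hi) => v Hv; right; exists i.
exists N => v Cv.
have Ov := C_Om GP Cv.
have v0 : v != 0 by have [Kv|/cone_neq0] := Om_cone OmP Ov; [exact: cone_neq0 Kv|rewrite oppr_eq0].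
have nv : 0 < (normc v)^-1 by rewrite invr_gt0 normc_gt0.
have [|[_ dv]|[i iN Vi]] := HN ((normc v)^-1 *: v).
- split; first by apply: subset_closure; apply: (C_scale GP) => //; rewrite gt_eqF.
  by rewrite /= normcZ gtr0_norm// mulVf// gt_eqF// normc_gt0.
- left; move: dv; have -> : d o ((normc v)^-1 *: v) = d (1 *: o) ((normc v)^-1 *: v) by rewrite scale1r.
  by rewrite (hilbert_scale OmP) ?oner_eq0 ?gt_eqF.
right; exists i => //; move: Vi; rewrite /V /= !pairingZ !normrM (gtr0_norm nv).
by rewrite mulrCA ltr_pM2l.
Qed.

End LimitSet.

(** * Counting functions and the absorption argument *)

Section Counting.
Variable R : realType.

Lemma ler_sum_uniq (T : eqType) (l l' : seq T) (w : T -> R) :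
  uniq l -> uniq l' -> {subset l <= l'} -> (forall x, 0 <= w x) ->
  \sum_(x <- l) w x <= \sum_(x <- l') w x.
Proof.
move=> ul ul' ll' w0.
have /(perm_big _)-> : perm_eq l [seq x <- l' | x \in l].
  apply: uniq_perm => //; first exact: filter_uniq.
  by move=> x; rewrite mem_filter; case: (boolP (x \in l)) => // /ll' ->.
rewrite big_filter big_mkcond /=; apply: ler_sum => x _.
by case: ifP.
Qed.

Lemma sum_one_seq (T : Type) (l : seq T) : \sum_(x <- l) (1 : R) = (size l)%:R.
Proof. by elim: l => [|x l IH]; rewrite ?big_nil// big_cons IH /= -natr1 addrC. Qed.

Lemma count_leE n (G : set 'M[R]_n) f r : finite_set [set g | G g /\ f g <= r] ->
  exists l : seq 'M[R]_n, [/\ uniq l, (forall g, g \in l <-> G g /\ f g <= r) &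
    count_le G f r = ((size l)%:R)%:E].
Proof.
move=> fin; exists (finmap.enum_fset (fset_set [set g | G g /\ f g <= r])); split.
- exact: finmap.fset_uniq.
- by move=> g; rewrite in_fset_set// inE.
- rewrite /count_le esum_fset// fsbig_finite//= -[in RHS]sum_one_seq -sumEFin.
  by [].
Qed.

Lemma crit_exp_le n (G : set 'M[R]_n) f (P tau : R) : 0 < P -> 0 <= tau ->
  (forall r, finite_set [set g | G g /\ f g <= r]) ->
  (forall r l, uniq l -> (forall g, g \in l -> G g /\ f g <= r) ->
     (size l)%:R <= P * expR (tau * r)) ->
  (crit_exp G f <= tau%:E)%E.
Proof.
move=> P0 t0 fin bd; apply/lee_addgt0Pr => e e0.
(* For [r >= T] one has [ln P <= r e], so the factor [P] costs at most [e] in the exponent. *)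
pose T := Num.max 1 (`|ln P| / e).
have T1 : 1 <= T by rewrite le_max lexx.
have Te : `|ln P| / e <= T by rewrite le_max lexx orbT.
apply: (@le_trans _ _ (ereal_sup [set ((r^-1)%:E * elog (count_le G f r))%E | r in [set r : R | T <= r]])).
  by apply: ereal_inf_lbound; exists T.
apply: ub_ereal_sup => _ [r /= Tr <-].
have r0 : 0 < r by rewrite (lt_le_trans _ Tr)// (lt_le_trans _ T1).
have [l [ul ml ->]] := count_leE (fin r).
rewrite /= -EFinM -EFinD lee_fin ler_pdivrMl// mulrDr.
have er : `|ln P| <= r * e by rewrite -ler_pdivrMr// (le_trans Te).
have [->|s0] := eqVneq (size l) 0%N.
  by rewrite ln0// addr_ge0 ?mulr_ge0 ?(ltW r0) ?(ltW e0).
have s0' : 0 < (size l)%:R :> R by rewrite ltr0n lt0n.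
have := bd r l ul (fun g H => (ml g).1 H).
rewrite -ler_ln ?posrE ?mulr_gt0 ?expR_gt0// lnM ?posrE ?expR_gt0// expRK.
have := ler_norm (ln P); lra.
Qed.

(** Truncation at a level [r] gives a finite sum [S], and where [h i] is applied it does not
    increase [l], so it stays within the truncation. By injectivity the terms handled by the [i]-th
    map add up to at most [a i * S]; hence [S <= F + S / 2], a bound independent of [r]. *)
Lemma poincare_bound (T : choiceType) (E : set T) (l : T -> R) (s N0 : R) (N : nat)
    (a : nat -> R) (h : nat -> T -> T) :
  (forall r, finite_set [set g | E g /\ l g <= r]) ->
  (forall i, injective (h i)) -> (forall i g, E g -> E (h i g)) ->
  (forall i, 0 <= a i) -> \sum_(i < N) a i <= 1 / 2 ->
  (forall g, E g -> l g <= N0 \/ exists2 i, (i < N)%N &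
     l (h i g) <= l g /\ expR (- s * l g) <= a i * expR (- s * l (h i g))) ->
  exists2 P : R, 0 < P & forall e : seq T, uniq e -> (forall g, g \in e -> E g) ->
    \sum_(g <- e) expR (- s * l g) <= P.
Proof.
move=> fin hi hE a0 a1 H.
pose w g := expR (- s * l g).
have w0 g : 0 <= w g by exact: expR_ge0.
pose lst r := finmap.enum_fset (fset_set [set g | E g /\ l g <= r]).
have lstu r : uniq (lst r) by exact: finmap.fset_uniq.
have lstP r g : g \in lst r <-> E g /\ l g <= r.
  by rewrite /lst in_fset_set ?inE.
exists (2 * \sum_(g <- lst N0) w g + 1); first by rewrite ltr_wpDl// mulr_ge0// sumr_ge0.
move=> e ue eE.
have [r er] : exists r, forall g, g \in e -> l g <= r.
  elim: e {ue eE} => [|x e [r IH]]; first by exists 0.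
  exists (Num.max (l x) r) => g; rewrite inE => /orP[/eqP->|/IH gr]; rewrite le_max ?lexx//.
  by rewrite gr orbT.
pose S := \sum_(g <- lst r) w g.
have eS : \sum_(g <- e) w g <= S.
  apply: ler_sum_uniq => // g ge; apply/lstP.
  by split; [exact: eE|exact: er].
have SS : S <= \sum_(g <- lst N0) w g + 1 / 2 * S.
  have : S <= \sum_(g <- lst r) ((if g \in lst N0 then w g else 0) +
      \sum_(i < N) (if h i g \in lst r then a i * w (h i g) else 0)).
    rewrite /S big_seq [leRHS]big_seq; apply: ler_sum => g /lstP[Eg gr].
    have s0 : 0 <= \sum_(i < N) (if h i g \in lst r then a i * w (h i g) else 0).
      by apply: sumr_ge0 => i _; case: ifP => // _; rewrite mulr_ge0.
    have [gN|[i iN [li wi]]] := H g Eg.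
      by rewrite ifT ?lerDl//; apply/lstP.
    apply: ler_wpDl; first by case: ifP.
    rewrite (bigD1 (Ordinal iN))//= ifT; last first.
      by apply/lstP; split; [exact: hE|exact: le_trans gr].
    apply: ler_wpDr => //.
    by apply: sumr_ge0 => j _; case: ifP => // _; rewrite mulr_ge0.
  move=> /le_trans; apply; rewrite big_split /= lerD//.
    rewrite -big_mkcond -big_filter; apply: ler_sum_uniq => //; first exact: filter_uniq.
    by move=> g; rewrite mem_filter => /andP[].
  rewrite exchange_big /=.
  apply: (@le_trans _ _ (\sum_(i < N) a i * S)); last first.
    by rewrite -mulr_suml ler_wpM2r// /S sumr_ge0.
  apply: ler_sum => i _; rewrite -big_mkcond -mulr_sumr ler_wpM2l//.
  rewrite -big_filter -(big_map (h i) xpredT w); apply: ler_sum_uniq => //.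
    by rewrite map_inj_uniq ?filter_uniq.
  by move=> x /mapP[g]; rewrite mem_filter => /andP[hg _] ->.
rewrite (le_trans eS)//; move: SS; clear; lra.
Qed.

End Counting.

(** * Covers obtained from a null Hausdorff measure *)

Section HausdorffCover.
Variables (R : realType) (T : Type) (d : T -> T -> R).
Hypothesis d_ge0 : forall x y, 0 <= d x y.

Lemma hausdorff_null_cover (s delta eps : R) (A : set T) : 0 < delta -> 0 < eps ->
  hausdorff_measure d s A = 0%E ->
  exists (U : nat -> set T) (rho : nat -> R), [/\ A `<=` \bigcup_i U i,
    (forall i, 0 <= rho i <= delta), (forall i x y, U i x -> U i y -> d x y <= rho i) &
    forall N, \sum_(i < N) rho i `^ s <= eps].
Proof.
move=> d0 e0 H0.
have : (hausdorff_pre d s delta A < eps%:E)%E.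
  apply: (@le_lt_trans _ _ 0%E); last by rewrite lte_fin.
  by rewrite -H0; apply: ereal_sup_ubound; exists delta.
move=> /ereal_inf_lt[_ [U [AU dU] <-]] lt.
have hd i x y : U i x -> U i y -> ((d x y)%:E <= hdiam d (U i))%E.
  by move=> Ux Uy; apply: ereal_sup_ubound; exists (x, y).
have fin i : U i !=set0 -> hdiam d (U i) \is a fin_num.
  move=> [x Ux]; rewrite ge0_fin_numE; last by apply: le_trans (hd i x x Ux Ux); rewrite lee_fin.
  by rewrite (le_lt_trans (dU i))// ltry.
exists U, (fun i => fine (hdiam d (U i))); split=> //.
(* The empty set has [hdiam] equal to [-oo], whose [fine] is [0]. *)
- move=> i; have [->|/set0P U0] := eqVneq (U i) set0.
    rewrite /hdiam setX0 image_set0 ereal_sup0 /= lexx ltW//.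
  have Uf := fin i U0; rewrite -!lee_fin fineK// dU andbT.
  by case: U0 => x Ux; apply: le_trans (hd i x x Ux Ux); rewrite lee_fin.
- move=> i x y Ux Uy; rewrite -lee_fin fineK ?hd//.
  by apply: fin; exists x.
- move=> N; rewrite -lee_fin -sumEFin -(big_mkord xpredT (fun i => (fine (hdiam d (U i)) `^ s)%:E)).
  apply: le_trans (ltW lt); apply: nneseries_lim_ge => i _ _.
  by rewrite lee_fin powR_ge0.
Qed.

End HausdorffCover.

(** * Convergence of the Poincare series and the lower bound *)

Section LowerBound.
Variables (R : realType) (n : nat).
Implicit Types (g h : 'M[R]_n).
Variable (G : set 'M[R]_n) (Om C : set 'cV[R]_n).
Hypothesis GP : strongly_proj_convex_cocompact G Om C.
Local Notation phi := (chart Om).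
Local Notation K := (cone Om).
Local Notation d := (hilbert_dist Om).
Let OmP := spcc_Om GP.

Lemma sum_half_pow N : \sum_(i < N) (2^-1 ^+ i.+1 : R) <= 1.
Proof.
suff -> : \sum_(i < N) (2^-1 ^+ i.+1 : R) = 1 - 2^-1 ^+ N.
  by rewrite gerBl exprn_ge0// invr_ge0.
elim: N => [|N IH]; first by rewrite big_ord0 expr0 subrr.
by rewrite big_ord_recr /= IH exprS; field.
Qed.

Lemma poincare_converges o (s : R) : 0 < s -> C o -> K o ->
  hausdorff_measure (@dsym R n) s (xi_sym_image Om C) = 0%E ->
  exists2 P : R, 0 < P & forall e : seq 'M[R]_n, uniq e -> (forall g, g \in e -> G g) ->
    \sum_(g <- e) expR (- s * d o (g *m o)) <= P.
Proof.
move=> s0 Co Ko H0; have [Oo _] := Ko.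
have [k0 k00 [c shadow]] := shadow_lemma GP Co Ko.
have [r0 r00 [B B0 dp]] := dsym_pairing GP.
pose b := ln (B + 1) / 2 + c.
have B1 : 0 < B + 1 by rewrite addr_gt0.
(* smallness making every [k i] below admissible for the shadow lemma *)
pose m := Num.min (ln (k0 / (B + 1)) / 2) (- b).
(* The first bound yields [L i < m], the second makes the coefficients given to [poincare_bound] add
   up to at most [1 / 2]. *)
pose eps := Num.min (expR (s * m) / 4) (expR (- (s * b)) / 4).
have eps0 : 0 < eps by rewrite lt_min !divr_gt0 ?expR_gt0.
have eps1 : 2 * eps < expR (s * m).
  have : eps <= expR (s * m) / 4 by rewrite ge_min lexx.
  by have := expR_gt0 (s * m); clear; lra.
have eps2 : expR (s * b) * (2 * eps) <= 1 / 2.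
  have : eps <= expR (- (s * b)) / 4 by rewrite ge_min lexx orbT.
  move=> /(ler_wpM2l (expR_ge0 (s * b))); rewrite mulrA -expRD subrr expR0.
  by clear; lra.
have [U [rho [AU rho01 dU sU]]] := hausdorff_null_cover (@dsym_ge0 _ _) (divr_gt0 r00 (ltr0n R 2)) eps0 H0.
(* A covering set may have diameter [0]. Adding a summable positive term gives each set a positive
   radius [exp (L i) >= rho i], and only doubles [eps]. *)
pose X i := rho i `^ s + eps * 2^-1 ^+ i.+1.
have X0 i : 0 < X i by rewrite ltr_wpDl ?powR_ge0// mulr_gt0// exprn_gt0// invr_gt0.
have sumX N : \sum_(i < N) X i <= 2 * eps.
  rewrite big_split /= -mulr_sumr.
  have := sU N; have := ler_wpM2l (ltW eps0) (sum_half_pow N); clear; lra.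
have Xle i : X i <= 2 * eps.
  apply: le_trans (sumX i.+1); rewrite big_ord_recr /= lerDr.
  by apply: sumr_ge0 => j _; exact: ltW.
pose L i := ln (X i) / s.
have LX i : expR (s * L i) = X i by rewrite /L mulrC divfK ?gt_eqF// lnK ?posrE.
have Lm i : L i < m.
  rewrite -(ltr_pM2l s0) -ltr_expR LX; exact: le_lt_trans (Xle i) eps1.
(* [B + 1] instead of [B] turns the bound of [dsym_pairing] into the strict inequality that defines
   a strip. *)
pose k i := (B + 1) * expR (2 * L i).
have kp i : 0 < k i by rewrite mulr_gt0// expR_gt0.
have lnk i : ln (k i) / 2 + c = b + L i.
  by rewrite /k lnM ?posrE ?expR_gt0// expRK /b; clear; lra.
have kk0 i : k i < k0.
  have : L i < ln (k0 / (B + 1)) / 2.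
    by apply: lt_le_trans (Lm i) _; rewrite ge_min lexx.
  move=> h; have : 2 * L i < ln (k0 / (B + 1)) by move: h; clear; lra.
  rewrite -ltr_expR lnK ?posrE ?divr_gt0// ltr_pdivlMr// mulrC.
  exact.
have rhoL i : rho i <= expR (L i).
  have /andP[h0 _] := rho01 i.
  move: h0; rewrite le_eqVlt => /orP[/eqP <-|h0]; first exact: expR_ge0.
  rewrite -[leLHS](@lnK R) ?posrE// ler_expR -(ler_pM2l s0) -ler_expR LX.
  by rewrite -ln_powR lnK ?posrE ?powR_gt0// /X lerDl mulr_ge0 ?(ltW eps0)// exprn_ge0// invr_ge0.
(* A covering set that misses the image gets the zero flag; its strip is empty, and the identity
   serves as its group element. *)
pose qq i := xget (0, 0) (U i `&` xi_sym_image Om C).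
have cov x p : xi_sym_image Om C (x, p) -> exists i,
     `|pairing (qq i).2 x| < k i * normrow (qq i).2 * `|pairing phi x|.
  move=> xp; have [i _ Ui] := AU _ xp; exists i.
  have [Uq xq] : (U i `&` xi_sym_image Om C) (qq i) by apply: xgetPex; exists (x, p).
  have rr : rho i < r0.
    have /andP[_ h] := rho01 i; apply: le_lt_trans h _.
    by rewrite ltr_pdivrMr// ltr_pMr// ltr1n.
  have := dp _ _ _ xp xq (dU _ _ _ Ui Uq) rr; move=> /le_lt_trans; apply => /=.
  have nq : 0 < normrow (qq i).2 by rewrite normrow_gt0; case: xq => _ [].
  have px : 0 < `|pairing phi x|.
    have [B' B'0 HB] := closure_C_chart GP.
    have [[x0 [cx _]] _] := xp.
    have nx : 0 < normc x by rewrite normc_gt0.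
    by have := lt_le_trans nx (HB _ cx); rewrite pmulr_rgt0.
  rewrite ltr_pM2r// ltr_pM2r// /k.
  have : rho i ^+ 2 <= expR (2 * L i).
    rewrite (_ : 2 * L i = L i + L i); last by clear; lra.
    have /andP[h _] := rho01 i.
    by rewrite expRD expr2 ler_pM.
  move=> /(ler_wpM2l (ltW B0)) /le_lt_trans; apply.
  by rewrite ltr_pM2r ?expR_gt0// ltrDl.
have [N HN] := cover_orbit GP Co Oo (fun i => ltW (kp i)) cov.
have /choice[h Hh] i : exists h, G h /\ forall z, Om z ->
    `|pairing (qq i).2 z| < k i * normrow (qq i).2 * `|pairing phi z| ->
    d (h *m o) z <= d o z + (b + L i).
  have [xq|nxq] := pselect (xi_sym_image Om C (qq i)).
    have [h Gh Hh] := shadow _ xq _ (kp i) (kk0 i); exists h; split=> // z Oz Hz.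
    by have := Hh z Oz Hz; rewrite -addrA lnk.
  exists 1%:M; split; first exact: (G_one GP).
  move=> z Oz; rewrite /qq; case: xgetP => [q qE [_ xq]|_].
    by exfalso; apply: nxq; rewrite /qq -qE.
  by rewrite /= normrowE trmx0 normc0 mulr0 mul0r ltNge normr_ge0.
apply: (@poincare_bound R _ G (fun g => d o (g *m o)) s N%:R N
  (fun i => expR (s * b) * X i) (fun i g => invmx (h i) *m g)).
- by move=> r; exact: (orbit_finite GP).
- move=> i g1 g2 /(congr1 (mulmx (h i))).
  by rewrite !mulmxA mulmxV ?(G_unit GP)// ?mul1mx//; case: (Hh i).
- by move=> i g Gg; apply: (G_mul GP) => //; apply: (G_inv GP); case: (Hh i).
- by move=> i; rewrite mulr_ge0 ?expR_ge0// ltW.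
- by rewrite -mulr_sumr (le_trans _ eps2)// ler_wpM2l ?expR_ge0.
move=> g Gg; have [dN|[i iN Vi]] := HN _ (G_C GP Gg Co); first by left.
right; exists i; first exact: iN.
have [Gh Hi] := Hh i.
have Og := G_Om GP Gg Oo.
have dE : d o (invmx (h i) *m g *m o) = d (h i *m o) (g *m o).
  have E : g *m o = h i *m (invmx (h i) *m g *m o).
    by rewrite !mulmxA mulmxV ?mul1mx// (G_unit GP Gh).
  rewrite [in RHS]E; apply/esym/(hilbert_invariant GP Gh Oo).
  exact: G_Om GP _ _ (G_mul GP (G_inv GP Gh) Gg) Oo.
have le := Hi _ Og Vi; rewrite dE.
(* This is where [m <= - b] enters: translating by the inverse of [h i] must not lengthen [g]. *)
have bL : b + L i <= 0.
  have : L i < - b by apply: lt_le_trans (Lm i) _; rewrite ge_min lexx orbT.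
  by clear; lra.
split; first by move: le bL; dist_lra.
rewrite -LX -!expRD ler_expR; have := ler_wpM2l (ltW s0) le.
by move: (L i); dist_lra.
Qed.

Theorem lower_bound :
  (2%:E * delta1n G <= hausdorff_dim (@dsym R n) (xi_sym_image Om C))%E.
Proof.
apply: le_ereal_inf_tmp => _ [s [s0 H0] <-].
have [ o Co Ko] := exists_base GP.
have [P P0 HP] := poincare_converges s0 Co Ko H0.
have [c Hc] := hilbert_orbit_le GP Ko.
suff : (delta1n G <= (s / 2)%:E)%E.
  move=> H; apply: (@le_trans _ _ (2%:E * (s / 2)%:E)%E).
    by rewrite lee_pmul2l// lte_fin.
  by rewrite -EFinM mulrC divfK.
apply: (@crit_exp_le _ _ _ _ (P * expR (s * c))).
- by rewrite mulr_gt0// expR_gt0.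
- by rewrite divr_ge0// ltW.
- move=> r; apply: sub_finite_set (orbit_finite GP (r / 2 + c) Ko) => g [Gg gr]; split=> //.
  by rewrite (le_trans (Hc g Gg))// lerD2r ler_pM2r// invr_gt0.
move=> r l ul lG.
have lG' g : g \in l -> G g by move=> /lG[].
have := HP l ul lG'.
(* Each element counted up to [r] contributes at least [exp (- s (r / 2 + c))] to a sum bounded by
   [P]. *)
have : \sum_(g <- l) expR (- s * (r / 2 + c)) <= \sum_(g <- l) expR (- s * d o (g *m o)).
  rewrite big_seq [leRHS]big_seq; apply: ler_sum => g /lG[Gg gr].
  rewrite ler_expR !mulNr lerN2 ler_pM2l//; apply: le_trans (Hc g Gg) _.
  by rewrite lerD2r ler_pM2r ?invr_gt0.
rewrite (eq_bigr (fun g => expR (- s * (r / 2 + c)) * 1)) => [|g _]; last by rewrite mulr1.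
rewrite -mulr_sumr sum_one_seq => /le_trans H /H.
rewrite mulNr expRN mulrC ler_pdivrMr ?expR_gt0// => /le_trans; apply.
by rewrite -mulrA -expRD ler_pM2l// ler_expR; lra.
Qed.

End LowerBound.

(** * The upper bound *)

Section Shadows.
Variables (R : realType) (n : nat).
Implicit Types (u v w x y z : 'cV[R]_n) (a b s t : R) (g h : 'M[R]_n) (p : 'rV[R]_n).
Implicit Types (q : 'cV[R]_n * 'rV[R]_n).
Variable (G : set 'M[R]_n) (Om C : set 'cV[R]_n).
Hypothesis GP : strongly_proj_convex_cocompact G Om C.
Local Notation phi := (chart Om).
Local Notation K := (cone Om).
Local Notation M := (gauge Om).
Local Notation d := (hilbert_dist Om).
Let OmP := spcc_Om GP.

(** As the determinant is [1], the inverse of the least singular value is the product of the others.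
    With [G_bounded_finite], a bound on the norm of [g] alone then leaves finitely many elements. *)
Lemma mu_inv_le g : \det g = 1 ->
  expR (mu (invmx g) 0) <= expR (mu g 0) ^+ n.-1.
Proof.
move=> dg; have n0 := spcc_dim GP.
have gu : g \in unitmx by rewrite unitmxE dg unitr1.
have dgi : \det (invmx g) = 1 by rewrite det_inv dg invr1.
have [u u1 uE] := normc_mul_attained n0 dgi.
rewrite -[leLHS]uE; apply: le_trans (normc_invmx_le n0 u dg) _; rewrite u1 mulr1 expRN.
have [P [Q [e [PP QQ gE es em]]]] := svd dg.
have nl : (n.-1 < n)%N by rewrite prednK.
have [el ml] := em (Ordinal nl); have [e0 m0] := em (Ordinal n0).
rewrite [mu g n.-1]ml [mu g 0]m0 !lnK ?posrE//.
have : `|\det g| = 1 by rewrite dg normr1.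
rewrite gE !det_mulmx !normrM (det_orthogonal PP) (det_orthogonal QQ) mulr1 mul1r det_diag.
rewrite (bigD1 (Ordinal nl))//= normrM gtr0_norm// => E.
rewrite -[leLHS]mulr1 -E mulrA mulVf ?gt_eqF// mul1r normr_prod.
apply: le_trans (_ : \prod_(i < n | i != Ordinal nl) e 0 (Ordinal n0) <= _).
  apply: ler_prod => i _; have [ei _] := em i; rewrite normr_ge0 gtr0_norm//=.
  exact: es.
rewrite prodr_const; suff -> : #|[pred i : 'I_n | i != Ordinal nl]| = n.-1 by [].
by rewrite cardC1 card_ord.
Qed.

Lemma closure_C_act g x : G g -> closure C x -> closure C (g *m x).
Proof.
move=> Gg /closure_normcP cx; apply/closure_normcP => e e0.
have [c c0 Hc] := mulmx_normc_bound g.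
have [y Cy yx] := cx (e / (c + 1)) (divr_gt0 e0 (ltr_wpDl c0 ltr01)).
exists (g *m y); first exact: (G_C GP).
rewrite -mulmxBr (le_lt_trans (Hc _))//; move: yx; rewrite ltr_pdivlMr ?ltr_wpDl// mulrDr mulr1 => yx.
by apply: le_lt_trans yx; rewrite mulrC lerDl normc_ge0.
Qed.

(** Up to scaling, [a *: q.1 + t *: o] runs through the open segment from [o] to the limit point:
    the segment meets the ball of radius [D] around [g o]. *)
Definition shadow o (D : R) g : set ('cV[R]_n * 'rV[R]_n) :=
  [set q | xi_sym_image Om C q /\ exists a t : R,
     [/\ a != 0, 0 < t, closure K (a *: q.1), 0 < pairing phi (a *: q.1) & d (a *: q.1 + t *: o) (g *m o) <= D]].

Lemma pairing_mulmx p g v : pairing (p *m g) v = pairing p (g *m v).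
Proof. by rewrite /pairing mulmxA. Qed.

(* In the cone order, [g^-1 (x + t o)] is comparable to [o] whenever the segment
   from [o] to [x] passes near [g o]; everything is read off from this. *)
Lemma shadow_expand o D : K o -> exists T c : R, 0 < c /\
  forall g q, G g -> shadow o D g q -> T <= expR (mu g 0) ->
  c * expR (mu g 0) * normc (invmx g *m q.1) <= normc q.1 /\
  c * expR (mu (invmx g) 0) * normrow (q.2 *m g) <= normrow q.2.
Proof.
move=> Ko; have [Oo po] := Ko.
have [r r0 Hr] := cone_open OmP Ko.
have [B B0 HB] := cone_normc OmP.
have [B' B'0 HB'] := closure_C_chart GP.
have no : 0 < normc o by rewrite normc_gt0 (cone_neq0 Ko).
have nf : 0 < normrow phi.
  rewrite normrow_gt0; apply: contraTneq po => ->.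
  by rewrite /pairing mul0mx mxE ltxx.
pose A := expR (2 * D); have A0 : 0 < A by exact: expR_gt0.
pose f := pairing phi o.
have f0 : 0 < f by [].
pose c1 := r / (2 * B * A * B' * f * normrow phi).
pose c2 := r ^+ 2 / (A * f * B * normc o).
have c10 : 0 < c1 by rewrite divr_gt0// !mulr_gt0.
have c20 : 0 < c2 by rewrite divr_gt0 ?exprn_gt0// !mulr_gt0.
(* Above this threshold the part [t *: o] of [w] accounts for at most half of [S1 r / B] in [key1],
   so [x] accounts for the rest. *)
exists (2 * A * f ^+ 2 * B ^+ 2 / r ^+ 2), (Num.min c1 c2).
split; first by rewrite lt_min c10.
move=> g q Gg [xq [a [t [a0 t0 cx px dD]]]] gT.
have [gs [gsE gu Kg Ki]] := G_cone GP Gg.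
set x := a *: q.1 in cx px dD.
pose w := x + t *: o.
have Kw : K w by rewrite /w addrC; apply: (cone_closure_add OmP) => //; exact: (cone_scale OmP).
pose w' := invmx gs *m w.
have Kw' : K w' by exact: Ki.
have gw' : gs *m w' = w by rewrite /w' mulmxA mulmxV// mul1mx.
pose m := M o w'; pose m' := M w' o.
have m0 : 0 < m by exact: (gauge_gt0 OmP).
have m'0 : 0 < m' by exact: (gauge_gt0 OmP).
have mm : m' * m <= A.
  have : d w (gs *m o) <= D.
    by rewrite (hilbert_signr GP gsE)//; [case: Kw|exact: (G_Om GP)].
  rewrite (hilbert_gauge OmP Kw (Kg _ Ko)) -gw'.
  rewrite !(gauge_invariant GP gu Kg Ki)// -/m -/m' ler_pdivrMr// => L.
  by rewrite -[leLHS]lnK ?posrE ?mulr_gt0// ler_expR (mulrC 2).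
have phi0 v : K v -> 0 <= pairing phi v by move=> [_ /ltW].
pose q0 := invmx gs *m o; pose v := invmx gs *m x.
have Kq0 : K q0 by exact: Ki.
have w'E : w' = v + t *: q0 by rewrite /w' /w mulmxDr -(scalemxAr t).
have gsv : gs *m v = x by rewrite /v mulmxA mulmxV// mul1mx.
have gsq0 : gs *m q0 = o by rewrite /q0 mulmxA mulmxV// mul1mx.
have pv : 0 <= pairing phi v.
  rewrite /v -pairing_mulmx; apply: pairing_closure_cone_ge0 cx => z Kz.
  by rewrite pairing_mulmx; apply/phi0/Ki.
have pq0 : 0 < pairing phi q0 by case: Kq0.
have sg1 := cone_opnorm GP B0 r0 HB Hr Kg (G_det GP Gg) gsE.
have sg2 := cone_opnorm GP B0 r0 HB Hr Ki (G_det GP (G_inv GP Gg)) (invmx_sign (G_unit GP Gg) gsE).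
have n0 := spcc_dim GP.
have s1 : 1 <= expR (mu g 0) by rewrite -expR0 ler_expR mu0_ge0// (G_det GP Gg).
have s2 : 1 <= expR (mu (invmx g) 0).
  by rewrite -expR0 ler_expR mu0_ge0// (G_det GP (G_inv GP Gg)).
revert gT sg1 s1 sg2 s2.
generalize (expR (mu g 0)) (expR (mu (invmx g) 0)) => S1 S2 gT sg1 s1 sg2 s2.
have S10 : 0 <= S1 by exact: le_trans ler01 s1.
have S20 : 0 <= S2 by exact: le_trans ler01 s2.
have Br : 0 < B / r by rewrite divr_gt0.
have h1 : pairing phi v + t * pairing phi q0 <= m * f.
  by rewrite -pairingZ -pairingD -w'E; exact: (gauge_pairing OmP).
have h2 : pairing phi (gs *m o) <= m' * (pairing phi x + t * f).
  have := @gauge_pairing _ _ _ OmP (phi *m gs) w' o _ Kw'.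
  rewrite !pairing_mulmx gw' /w pairingD pairingZ => /(_ _).
  by apply=> z Kz; rewrite pairing_mulmx; apply/phi0/Kg.
(* [w' = v + t q0] with [phi v >= 0], and [phi q0] dominates a multiple of the norm [S2] of the
   inverse; so [t] is at most of order [m / S2]. *)
have h3 : t * S2 <= m * f * (B / r).
  have : t * pairing phi q0 <= m * f by move: h1 pv; clear; lra.
  have := ler_wpM2l (ltW t0) sg2; rewrite -/q0 => k1 k2.
  apply: le_trans k1 _; rewrite mulrCA mulrC ler_pM2r//.
have t1 : t <= m * f * (B / r).
  by apply: le_trans h3; rewrite ler_peMr ?(ltW t0).
have key1 : S1 * r / (2 * B) <= m' * pairing phi x.
  have k1 : S1 * (r / B) <= m' * (pairing phi x + t * f).
    apply: le_trans h2; have := sg1.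
    have Br' : 0 < r / B by rewrite divr_gt0.
    move=> /(ler_wpM2r (ltW Br')); rewrite mulrAC.
    by rewrite (_ : B / r * (r / B) = 1) ?mul1r//; field; rewrite !gt_eqF.
  have k2 : m' * (t * f) <= A * f ^+ 2 * (B / r).
    apply: (@le_trans _ _ (m' * (m * f * (B / r) * f))).
      by rewrite ler_pM2l// ler_pM2r.
    have -> : m' * (m * f * (B / r) * f) = (m' * m) * (f ^+ 2 * (B / r)) by ring.
    by rewrite -[leRHS]mulrA ler_wpM2r// mulr_ge0 ?(ltW Br)// sqr_ge0.
  have k3 : A * f ^+ 2 * (B / r) <= S1 * (r / (2 * B)).
    move: gT; rewrite ler_pdivrMr ?exprn_gt0// => gT.
    have -> : A * f ^+ 2 * (B / r) = 2 * A * f ^+ 2 * B ^+ 2 / (2 * B * r).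
      by field; rewrite !gt_eqF.
    have -> : S1 * (r / (2 * B)) = S1 * r ^+ 2 / (2 * B * r) by field; rewrite !gt_eqF.
    by rewrite ler_pM2r// invr_gt0 !mulr_gt0.
  have -> : S1 * r / (2 * B) = S1 * (r / B) - S1 * (r / (2 * B)) by field; rewrite gt_eqF.
  by move: k1 k2 k3; rewrite mulrDr; clear; lra.
have xE : gs *m v = x := gsv.
have na : 0 < `|a| by rewrite normr_gt0.
have cC : closure C (invmx g *m q.1).
  by apply: closure_C_act; [exact: (G_inv GP)|case: xq => -[_ []]].
have nvE : normc v = `|a| * normc (invmx g *m q.1).
  by rewrite /v (normc_sign _ (invmx_sign (G_unit GP Gg) gsE)) /x -scalemxAr normcZ.
have pvE : `|pairing phi v| = `|a| * `|pairing phi (invmx g *m q.1)|.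
  rewrite /v /x -scalemxAr pairingZ normrM; congr (_ * _).
  by case: (invmx_sign (G_unit GP Gg) gsE) => ->//; rewrite mulNmx pairingN normrN.
have nv : normc v <= B' * pairing phi v.
  by rewrite -(ger0_norm pv) pvE nvE mulrCA ler_pM2l// HB'.
split.
  apply: (@le_trans _ _ (c1 * S1 * normc (invmx g *m q.1))).
    apply: ler_wpM2r; first exact: normc_ge0.
    by apply: ler_wpM2r; rewrite ?S10 ?S20// ge_min lexx.
  rewrite -(ler_pM2l na) mulrCA -nvE -normcZ -/x.
  have nx : pairing phi x <= normrow phi * normc x.
    exact: le_trans (ler_norm _) (pairing_le _ _).
  have vm : normc v <= B' * (m * f).
    apply: le_trans nv _; rewrite ler_pM2l//.
    by move: h1 (mulr_gt0 t0 pq0); clear; lra.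
  have e1 : S1 * r / (2 * B) * normc v <= A * B' * f * normrow phi * normc x.
    apply: (@le_trans _ _ (m' * pairing phi x * (B' * (m * f)))).
      by rewrite ler_pM ?normc_ge0// divr_ge0 ?mulr_ge0 ?S10 ?S20 ?(ltW r0) ?(ltW B0).
    have -> : m' * pairing phi x * (B' * (m * f)) = (m' * m) * (B' * f * pairing phi x) by ring.
    apply: (@le_trans _ _ (A * (B' * f * pairing phi x))).
      by rewrite ler_wpM2r// mulr_ge0 ?(ltW px)// mulr_ge0// ltW.
    have -> : A * B' * f * normrow phi * normc x = A * (B' * f * (normrow phi * normc x)) by ring.
    by rewrite ler_pM2l// ler_pM2l// mulr_gt0.
  have q1 : 0 < A * B' * f * normrow phi by rewrite !mulr_gt0.
  rewrite -(ler_pM2l q1); apply: le_trans e1.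
  rewrite le_eqVlt; apply/orP; left; apply/eqP; rewrite /c1; field.
  by rewrite !gt_eqF.
have qOm : forall v, Om v -> pairing q.2 v != 0 by case: xq => _ [_ []].
have [e e1 ep] := functional_sign GP qOm.
have en : `|e| = 1 by case: e1 => ->; rewrite ?normrN normr1.
pose p := e *: q.2.
have qx : pairing q.2 q.1 = 0 by case: xq => _ [_ []].
have pxz : pairing p x = 0 by rewrite /p /x pairingZ pairingZl qx !mulr0.
have npE : normrow p = normrow q.2 by rewrite /p !normrowE linearZ /= normcZ en mul1r.
have ppos z : K z -> 0 <= pairing (p *m gs) z.
  by move=> Kz; rewrite pairing_mulmx ltW//; apply/ep/Kg.
have pgs0 : p *m gs != 0.
  have := ep _ (Kg _ Ko); rewrite -/p -pairing_mulmx; apply: contraTneq => ->.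
  by rewrite /pairing mul0mx mxE ltxx.
have npg : normrow (p *m gs) = normrow (q.2 *m g).
  rewrite /p -scalemxAl !normrowE linearZ /= normcZ en mul1r.
  by case: gsE => ->//; rewrite mulmxN linearN normcN.
(* [p] vanishes at [x], so only [t p o] survives in [p w]; the bound [h3] on [t S2] then controls
   [p gs]. *)
have k1 := @pos_on_cone _ _ Om (p *m gs) o r pgs0 ppos Hr r0.
have k2 := gauge_pairing OmP o ppos Kw'.
rewrite [pairing _ w']pairing_mulmx gw' /w pairingD pxz add0r pairingZ -/m' in k2.
have k3 : pairing p o <= normrow p * normc o.
  exact: le_trans (ler_norm _) (pairing_le _ _).
have k4 : r * normrow (p *m gs) <= m' * t * (normrow p * normc o).
  apply: le_trans k1 _; apply: le_trans k2 _.
  by rewrite mulrA ler_pM2l// mulr_gt0.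
have k5 : r * normrow (p *m gs) * S2 <= A * f * (B / r) * (normrow p * normc o).
  have np : 0 <= normrow p * normc o by rewrite mulr_ge0 ?normc_ge0// normrowE normc_ge0.
  apply: (@le_trans _ _ (m' * t * (normrow p * normc o) * S2)).
    by rewrite ler_wpM2r// S20.
  have -> : m' * t * (normrow p * normc o) * S2 = m' * (t * S2) * (normrow p * normc o) by ring.
  rewrite ler_wpM2r//; apply: (@le_trans _ _ (m' * (m * f * (B / r)))).
    by rewrite ler_pM2l.
  have -> : m' * (m * f * (B / r)) = m' * m * (f * (B / r)) by ring.
  by rewrite -[leRHS]mulrA ler_wpM2r// mulr_ge0 ?(ltW Br) ?(ltW f0).
apply: (@le_trans _ _ (c2 * S2 * normrow (q.2 *m g))).
  apply: ler_wpM2r; first by rewrite normrowE normc_ge0.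
  by apply: ler_wpM2r; rewrite ?S10 ?S20// ge_min lexx orbT.
rewrite -npE -npg.
have q2 : 0 < A * f * (B / r) * normc o by rewrite !mulr_gt0// invr_gt0.
rewrite -(ler_pM2l q2).
have -> : A * f * (B / r) * normc o * normrow p = A * f * (B / r) * (normrow p * normc o) by ring.
apply: le_trans k5; rewrite le_eqVlt; apply/orP; left; apply/eqP; rewrite /c2; field.
by rewrite !gt_eqF.
Qed.

End Shadows.

(** * Diameters of shadows, and their covering property *)

Section ShadowCover.
Variables (R : realType) (n : nat).
Implicit Types (u v w x y z : 'cV[R]_n) (a b s t : R) (g h : 'M[R]_n) (p : 'rV[R]_n).
Implicit Types (q : 'cV[R]_n * 'rV[R]_n).
Variable (G : set 'M[R]_n) (Om C : set 'cV[R]_n).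
Hypothesis GP : strongly_proj_convex_cocompact G Om C.
Local Notation phi := (chart Om).
Local Notation K := (cone Om).
Local Notation d := (hilbert_dist Om).
Let OmP := spcc_Om GP.

Definition gap g : R := mu g 0 - mu g 1.

(** Write [x = g (g^-1 x)] and [p^T = (g^-1)^T (p g)^T]. By [shadow_expand] both are expansions at a
    rate comparable to the norm, so [angle_contraction] applies to [g] and to the transpose of
    [g^-1]. *)
Lemma shadow_diam o D : K o -> exists T C0 : R, 0 < C0 /\
  forall g q q', G g -> T <= expR (mu g 0) -> shadow Om C o D g q -> shadow Om C o D g q' ->
  dsym q q' <= C0 * (expR (- gap g) + expR (- gap (invmx g))).
Proof.
move=> Ko; have [T [c [c0 Hc]]] := shadow_expand GP D Ko.
have [C1 C10 con] := angle_contraction (spcc_dim GP) c0.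
exists T, C1; split=> // g q q' Gg gT sq sq'.
have gu := G_unit GP Gg.
have [e1 e2] := Hc _ _ Gg sq gT; have [e1' e2'] := Hc _ _ Gg sq' gT.
have E (z : 'cV[R]_n) : z = g *m (invmx g *m z) by rewrite mulmxA mulmxV// mul1mx.
have E2 (p : 'rV[R]_n) : p^T = (invmx g)^T *m (p *m g)^T.
  by rewrite -trmx_mul -mulmxA mulmxV// mulmx1.
have x0 q1 : shadow Om C o D g q1 -> q1.1 != 0 /\ q1.2 != 0.
  by move=> [[[x0 _] [p0 _]] _].
have [x1 p1] := x0 _ sq; have [x1' p1'] := x0 _ sq'.
have v0 (z : 'cV[R]_n) : z != 0 -> invmx g *m z != 0.
  by apply: contra => /eqP z0; rewrite (E z) z0 mulmx0.
have r0 (p : 'rV[R]_n) : p != 0 -> (p *m g)^T != 0.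
  apply: contra => /eqP z0; have := E2 p; rewrite z0 mulmx0 => /eqP.
  by rewrite -(inj_eq (@trmx_inj _ _ _)) trmxK trmx0.
apply: le_trans (dsym_le q q') _; rewrite mulrDr lerD//.
  rewrite (E q.1) (E q'.1); apply: (con g g) => //; rewrite ?v0 -?E//.
  - exact: (G_det GP).
  - by left.
rewrite angle_rE (E2 q.2) (E2 q'.2).
apply: (con (invmx g) (invmx g)^T) => //; rewrite ?r0 -?E2 -?normrowE//.
- exact: (G_det GP (G_inv GP Gg)).
- by right.
Qed.

(** The freedom in [N] is what lets finitely many elements be discarded from the cover. *)
Lemma shadow_cover o : C o -> K o -> exists D : R, forall q (N : R), xi_sym_image Om C q ->
  exists g, [/\ G g, shadow Om C o D g q & N < d o (g *m o)].
Proof.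
move=> Co Ko; have [Oo po] := Ko.
have [r r0 Hr] := cone_open OmP Ko.
have [B B0 HB] := closure_C_chart GP.
have [D D0 HD] := cocompact_bound GP Co Ko.
exists (D + 1) => q N xq.
have [a [e [[a0 e0 x1 p1] [fx cx pp]]]] := xi_normalize GP B0 HB xq.
have cC : closure C (a *: q.1) by apply: closure_C_scale GP _ _ a0 _; case: xq => -[_ []].
have qx : pairing q.2 q.1 = 0 by case: xq => _ [_ []].
have px : pairing (e *: q.2) (a *: q.1) = 0 by rewrite pairingZ pairingZl qx !mulr0.
set x := a *: q.1 in x1 fx cx px cC *; set p := e *: q.2 in p1 pp px.
have fx0 : 0 < pairing phi x by rewrite -(pmulr_rgt0 _ B0) (lt_le_trans ltr01).
(* [t] is set so that [p w = k phi x], and [k] so that [w] is then at distance at least [N + D + 2]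
   from [o]; at most [D + 1] is lost on the way from [w] to the orbit. *)
pose k := r / pairing phi o * expR (- (2 * (N + D + 2))).
have k0 : 0 < k by rewrite mulr_gt0 ?expR_gt0// divr_gt0.
have pO : 0 < pairing p o by exact: pp.
pose t := k * pairing phi x / pairing p o.
have t0 : 0 < t by rewrite divr_gt0// mulr_gt0.
pose w := x + t *: o.
have Kto : K (t *: o) by exact: (cone_scale OmP).
have Kw : K w by rewrite /w addrC; exact: (cone_closure_add OmP).
have [Ow _] := Kw.
have p0 : p != 0 by rewrite -normrow_gt0 p1.
have dow : N + D + 2 <= d o w.
  have := @hilbert_ge_functional _ _ _ _ _ GP o r p w k r0 Hr Ko Kw p0 pp k0.
  rewrite p1 mulr1 /w !pairingD !(pairingZ _ t o) px add0r /t divfK ?gt_eqF// => H.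
  apply: le_trans (H _).
    rewrite /k invfM mulrA divff ?gt_eqF ?divr_gt0// mul1r -expRN opprK expRK.
    by rewrite mulrAC divff// mul1r.
  rewrite mulrDr lerDl mulr_ge0 ?(ltW k0)// mulr_ge0// ?(ltW po)//.
  by rewrite divr_ge0 ?(ltW pO)// mulr_ge0 ?(ltW k0) ?(ltW fx0).
have [rw rw0 Hrw] := near_hilbert OmP Kw.
have nf : 0 < normrow phi + 1 by rewrite ltr_wpDl// normrowE normc_ge0.
(* [x] is only a limit of [C]. A nearby [y] of [C] replaces it, so that [y + t o] is in [C] and
   within distance [1] of [w]. *)
have /closure_normcP/(_ (Num.min rw (pairing phi x / (normrow phi + 1)))) := cC.
case; first by rewrite lt_min rw0 divr_gt0.
move=> y Cy; rewrite lt_min => /andP[yr]; rewrite ltr_pdivlMr// => yf.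
have Ky : K y.
  split; first exact: (C_Om GP).
  rewrite -[y](subrK x) pairingD.
  have := pairing_le phi (y - x); rewrite ler_norml => /andP[+ _].
  have := normc_ge0 (y - x); lra.
have Cyt : C (y + t *: o).
  by apply: (C_add GP) => //; apply: (C_scale GP) => //; rewrite gt_eqF.
have [|_ dwy] := Hrw (y + t *: o).
  by rewrite /w opprD addrACA subrr addr0 ltW.
have [g Gg dg] := HD _ Cyt; exists g.
have Ogo := G_Om GP Gg Oo; have Oyt := C_Om GP Cyt.
have dwg : d w (g *m o) <= D + 1.
  have := hilbert_triangle OmP Ow Oyt Ogo; move: dg dwy; dist_lra.
split; [exact: Gg|split; [exact: xq|by exists a, t; split]|].
have := hilbert_triangle OmP Oo Ogo Ow; rewrite (hilbert_sym OmP Ogo Ow).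
move: dwg dow; dist_lra.
Qed.

End ShadowCover.

(** * Tails of Poincare series *)

Section Tails.
Variable R : realType.

Lemma size_le_count n (G : set 'M[R]_n) f r l : uniq l ->
  (forall g, g \in l -> G g /\ f g <= r) -> (((size l)%:R)%:E <= count_le G f r)%E.
Proof.
move=> ul lG; apply: esum_ge; exists [set` l].
  by split; [exact: finite_seq|move=> g /= /lG].
by rewrite -fsbig_seq// -sum_one_seq -sumEFin.
Qed.

Lemma crit_exp_lt n (G : set 'M[R]_n) f (s : R) : (crit_exp G f < s%:E)%E ->
  exists T : R, forall r l, T <= r -> uniq l -> (forall g, g \in l -> G g /\ f g <= r) ->
    (size l)%:R <= expR (s * r).
Proof.
move=> /ereal_inf_lt[_ [T _ <-]] sT; exists (Num.max T 1) => r l.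
rewrite ge_max => /andP[Tr r1] ul lG.
have r0 : 0 < r by exact: lt_le_trans r1.
have : ((r^-1)%:E * elog (count_le G f r) < s%:E)%E.
  by apply: le_lt_trans sT; apply: ereal_sup_ubound; exists r.
have := size_le_count ul lG; case: (count_le G f r) => [c| |] //=; last first.
  by rewrite gt0_muley ?lte_fin ?invr_gt0.
rewrite lee_fin -EFinM lte_fin ltr_pdivrMl// => lc cs; apply: le_trans lc _.
have [c0|c0] := leP c 0; first exact: le_trans c0 (expR_ge0 _).
by rewrite -[leLHS](@lnK R) ?posrE// ler_expR mulrC ltW.
Qed.

Lemma crit_exp_ge0 n (G : set 'M[R]_n) f : G !=set0 -> (0 <= crit_exp G f)%E.
Proof.
move=> [g Gg]; apply: le_ereal_inf_tmp => _ [T _ <-].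
pose r := Num.max T (Num.max 1 (f g)).
have r0 : 0 < r by rewrite !lt_max ltr01 orbT.
apply: (@le_trans _ _ ((r^-1)%:E * elog (count_le G f r))%E); last first.
  by apply: ereal_sup_ubound; exists r => //=; rewrite le_max lexx.
have : (1%:E <= count_le G f r)%E.
  apply: (@size_le_count n G f r [:: g] isT) => h.
  by rewrite inE => /eqP ->; split=> //; rewrite !le_max lexx !orbT.
case: (count_le G f r) => [c| |] //=; rewrite ?lee_fin => c1.
  by rewrite mulr_ge0 ?invr_ge0 ?(ltW r0)// ln_ge0.
by rewrite mule_ge0// lee_fin invr_ge0 ltW.
Qed.

(** Group the elements by the integer part [j] of [f]: there are at most [exp (s' (j + 1))] of them,
    each of weight at most [exp (- s j)]. The sum is dominated by the tail of a geometric series of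
    ratio [z]. *)
Lemma tail_sum (T : eqType) (E : set T) (f : T -> R) (s s' T0 eps : R) :
  0 <= s -> s' < s -> 0 < eps ->
  (forall r l, T0 <= r -> uniq l -> (forall g, g \in l -> E g /\ f g <= r) ->
    (size l)%:R <= expR (s' * r)) ->
  exists k0 : nat, forall l, uniq l -> (forall g, g \in l -> E g /\ k0%:R <= f g) ->
    \sum_(g <- l) expR (- (s * f g)) <= eps.
Proof.
move=> s0 ss' e0 cnt; pose z := expR (- (s - s')).
have z0 : 0 < z by exact: expR_gt0.
have z1 : z < 1 by rewrite -expR0 ltr_expR oppr_lt0 subr_gt0.
have zn : `|z| < 1 by rewrite gtr0_norm.
(* Compensates the sum [1 / (1 - z)] of the series and the factor [exp s'] due to [j + 1] in place
   of [j]. *)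
pose e' := eps * (1 - z) / expR s'.
have e'0 : 0 < e' by rewrite divr_gt0 ?expR_gt0// mulr_gt0// subr_gt0.
have [k1 _ Hk1] : \forall k \near \oo, `|0 - z ^+ k| < e'.
  by have /cvgrPdist_lt := cvg_expr zn; apply.
pose k0 := maxn k1 (Num.truncn T0).+1; exists k0.
have zk : z ^+ k0 < e'.
  have := Hk1 k0; rewrite /= leq_maxl => /(_ isT).
  by rewrite sub0r normrN gtr0_norm// exprn_gt0.
have Tk : T0 <= k0%:R.
  rewrite (le_trans (ltW (truncnS_gt T0)))// ler_nat leq_maxr//.
move=> l ul lE.
have [N HN] : exists N : nat, forall g, g \in l -> (Num.truncn (f g) < k0 + N)%N.
  elim: l {ul lE} => [|x l [N IH]]; first by exists 0%N.
  exists (maxn (Num.truncn (f x)).+1 N) => g; rewrite inE => /orP[/eqP->|/IH gN].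
    by rewrite (leq_trans (leq_maxl _ N))// leq_addl.
  by rewrite (leq_trans gN)// leq_add2l leq_maxr.
have tr g : g \in l -> (k0 <= Num.truncn (f g))%N /\
    (Num.truncn (f g))%:R <= f g < (Num.truncn (f g)).+1%:R.
  move=> /lE[_ kf]; have f0 : 0 <= f g by rewrite (le_trans _ kf).
  by have := truncn_itv f0; split=> //; rewrite truncn_ge_nat.
apply: (@le_trans _ _ (\sum_(g <- l) \sum_(k0 <= j < k0 + N)
    (if Num.truncn (f g) == j then expR (- (s * j%:R)) else 0))).
  rewrite big_seq [leRHS]big_seq; apply: ler_sum => g gl.
  have [kg /andP[f1 f2]] := tr g gl.
  rewrite (bigD1_seq (Num.truncn (f g)))/= ?iota_uniq ?mem_index_iota ?kg ?HN//.
  rewrite eqxx; apply: ler_wpDr; first by apply: sumr_ge0 => j _; case: ifP.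
  by rewrite ler_expR lerN2 ler_wpM2l.
rewrite exchange_big /=.
apply: (@le_trans _ _ (\sum_(k0 <= j < k0 + N) expR s' * z ^+ j)).
  rewrite big_nat [leRHS]big_nat; apply: ler_sum => j /andP[kj _].
  rewrite -big_mkcond -big_filter.
  rewrite (eq_bigr (fun g => expR (- (s * j%:R)) * 1)) => [|g _]; last by rewrite mulr1.
  rewrite -mulr_sumr sum_one_seq.
  have H : (size [seq g <- l | Num.truncn (f g) == j])%:R <= expR (s' * j.+1%:R).
    apply: cnt; first by rewrite (le_trans Tk)// ler_nat leqW.
      exact: filter_uniq.
    move=> g; rewrite mem_filter => /andP[/eqP gj gl]; split; first by case: (lE g gl).
    by have [_ /andP[_ /ltW]] := tr g gl; rewrite gj.
  apply: le_trans (ler_wpM2l (expR_ge0 _) H) _.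
  rewrite -expRM_natl -!expRD ler_expR -natr1; lra.
rewrite -mulr_sumr geometric_partial_tail.
apply: le_trans (ler_wpM2l (expR_ge0 _) (geometric_le_lim _ _ z0 zn)) _.
  by rewrite exprn_ge0// ltW.
rewrite mulrA ler_pdivrMr ?subr_gt0// mulrC -ler_pdivlMr ?expR_gt0//.
exact: ltW.
Qed.

End Tails.

(** * Null Hausdorff measure from explicit covers *)

Section HausdorffUpper.
Variables (R : realType) (T : Type) (d : T -> T -> R).
Hypothesis d_ge0 : forall x y, 0 <= d x y.

Lemma hcontrib_le (s rho : R) (U : set T) : 0 < s -> 0 <= rho ->
  (forall x y, U x -> U y -> d x y <= rho) ->
  (hdiam d U <= rho%:E)%E /\ (hcontrib d s U <= (rho `^ s)%:E)%E.
Proof.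
move=> s0 r0 H.
have hd : (hdiam d U <= rho%:E)%E.
  by apply: ub_ereal_sup => _ [[x y] [Ux Uy] <-]; rewrite lee_fin H.
split=> //; rewrite /hcontrib lee_fin ge0_ler_powR ?nnegrE ?(ltW s0)//.
  have [->|/set0P[x Ux]] := eqVneq U set0.
    by rewrite /hdiam setX0 image_set0 ereal_sup0.
  apply: fine_ge0; apply: le_trans (_ : ((d x x)%:E <= _)%E); first by rewrite lee_fin.
  by apply: ereal_sup_ubound; exists (x, x).
have [->|/set0P[x Ux]] := eqVneq U set0.
  by rewrite /hdiam setX0 image_set0 ereal_sup0.
have h0 : (0 <= hdiam d U)%E.
  apply: le_trans (_ : ((d x x)%:E <= _)%E); first by rewrite lee_fin.
  by apply: ereal_sup_ubound; exists (x, x).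
rewrite -lee_fin fineK// ge0_fin_numE//; apply: le_lt_trans hd _; exact: ltry.
Qed.

Lemma hausdorff_measure_eq0 (s : R) (A : set T) : 0 < s ->
  (forall delta eps : R, 0 < delta -> 0 < eps ->
    exists (U : nat -> set T) (rho : nat -> R), [/\ A `<=` \bigcup_i U i,
      (forall i, 0 <= rho i <= delta), (forall i x y, U i x -> U i y -> d x y <= rho i) &
      forall N, \sum_(i < N) rho i `^ s <= eps]) ->
  hausdorff_measure d s A = 0%E.
Proof.
move=> s0 H.
have pre0 delta : (0 <= hausdorff_pre d s delta A)%E.
  apply: le_ereal_inf_tmp => _ [U _ <-]; apply: nneseries_ge0 => i _ _.
  by rewrite lee_fin powR_ge0.
apply/eqP; rewrite eq_le; apply/andP; split; last first.
  apply: le_trans (pre0 1) _; apply: ereal_sup_ubound; exists 1 => //=.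
apply: ub_ereal_sup => _ [delta /= d0 <-].
apply/lee_addgt0Pr => eps e0; rewrite add0e.
have [U [rho [AU rho01 dU sU]]] := H delta eps d0 e0.
apply: (@le_trans _ _ (\sum_(i <oo) hcontrib d s (U i))%E).
  apply: ereal_inf_lbound; exists U => //; split=> // i.
  have /andP[r0 rd] := rho01 i.
  have [hd _] := hcontrib_le s0 r0 (dU i).
  by apply: le_trans hd _; rewrite lee_fin.
apply: lime_le.
  by apply: is_cvg_nneseries => i _ _; rewrite lee_fin powR_ge0.
apply: nearW => N; apply: (@le_trans _ _ (\sum_(0 <= i < N) (rho i `^ s)%:E)%E).
  apply: lee_sum => i _; have /andP[r0 rd] := rho01 i.
  by have [] := hcontrib_le s0 r0 (dU i).
by rewrite big_mkord sumEFin lee_fin.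
Qed.

End HausdorffUpper.

(** * The upper bound *)

Section UpperBound.
Variables (R : realType) (n : nat).
Implicit Types (g h : 'M[R]_n).
Variable (G : set 'M[R]_n) (Om C : set 'cV[R]_n).
Hypothesis GP : strongly_proj_convex_cocompact G Om C.
Local Notation d := (hilbert_dist Om).

Lemma finite_of_bounded_size (T : choiceType) (E : set T) (B : R) :
  (forall l : seq T, uniq l -> (forall x, x \in l -> E x) -> (size l)%:R <= B) -> finite_set E.
Proof.
move=> H; apply: contrapT => /(infinite_set_fset (Num.truncn B).+1)[F FE sF].
have := H (finmap.enum_fset F) (finmap.fset_uniq F) (fun x => FE x).
move=> /le_lt_trans/(_ (truncnS_gt B)); by rewrite ltr_nat ltnNge sF.
Qed.

Lemma finite_set_bounded (T : choiceType) (E : set T) (f : T -> R) : finite_set E ->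
  exists B : R, forall x, E x -> f x <= B.
Proof.
move=> /finite_seqP[l ->]; elim: l => [|x l [B IH]]; first by exists 0.
exists (Num.max (f x) B) => g /=; rewrite inE => /orP[/eqP->|/IH gr]; rewrite le_max ?lexx//.
by rewrite gr orbT.
Qed.

Lemma powR_add_le (s a b : R) : 0 < s -> 0 <= a -> 0 <= b ->
  (a + b) `^ s <= 2 `^ s * (a `^ s + b `^ s).
Proof.
move=> s0; wlog ab : a b / a <= b => [H a0 b0|a0 b0].
  have [ab|/ltW ba] := leP a b; first exact: H.
  by rewrite addrC (addrC (a `^ s)); exact: H.
apply: (@le_trans _ _ ((2 * b) `^ s)).
  rewrite ge0_ler_powR ?(ltW s0) ?nnegrE ?addr_ge0 ?mulr_ge0//; lra.
by rewrite powRM// ler_wpM2l ?powR_ge0// lerDr powR_ge0.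
Qed.

Lemma powR_expR (x s : R) : expR x `^ s = expR (s * x).
Proof. by rewrite /powR gt_eqF ?expR_gt0// expRK. Qed.

Lemma G_countable o : cone Om o -> countable G.
Proof.
move=> Ko; have -> : G = \bigcup_(N in [set: nat]) [set g | G g /\ d o (g *m o) <= N%:R].
  apply/seteqP; split=> [g Gg|g [N _ []//]]; exists (Num.truncn (d o (g *m o))).+1 => //.
  by split=> //; exact/ltW/truncnS_gt.
apply: bigcup_countable => // N _; apply: finite_set_countable.
exact: (orbit_finite GP).
Qed.

Lemma gap_finite (s T : R) :
  (forall r l, T <= r -> uniq l -> (forall g, g \in l -> G g /\ gap g <= r) ->
    (size l)%:R <= expR (s * r)) ->
  forall r, finite_set [set g | G g /\ gap g <= r].
Proof.
move=> cnt r; apply: (@finite_of_bounded_size _ _ (expR (s * Num.max T r))) => l ul lG.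
apply: cnt => //; first by rewrite le_max lexx.
by move=> g /lG[Gg gr]; split=> //; rewrite (le_trans gr)// le_max lexx orbT.
Qed.

Lemma upper_null (s : R) : 0 < s -> (delta12 G < s%:E)%E ->
  hausdorff_measure (@dsym R n) s (xi_sym_image Om C) = 0%E.
Proof.
move=> s0 ds.
have d0 : (0 <= delta12 G)%E by apply: crit_exp_ge0; exists 1%:M; exact: (G_one GP).
(* The margin between [s'] and [s] makes the tails of the series at [s] arbitrarily small. *)
have [s' ss' ds'] : exists2 s' : R, s' < s & (delta12 G < s'%:E)%E.
  move: d0 ds; case: (delta12 G) => [x| |] //=; rewrite ?lee_fin ?lte_fin => x0 xs.
  by exists ((x + s) / 2); rewrite ?lte_fin; lra.
have [T1 cnt] := crit_exp_lt ds'.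
have [ o Co Ko] := exists_base GP.
have [D HD] := shadow_cover GP Co Ko.
have [T [C0 [C00 dia]]] := shadow_diam GP D Ko.
have gfin := gap_finite cnt.
have /countable_injP[f finj] := G_countable Ko.
apply: hausdorff_measure_eq0 => //; first exact: dsym_ge0.
move=> delta eps del0 e0.
pose C1 := C0 `^ s * 2 `^ s.
have C10 : 0 < C1 by rewrite mulr_gt0 ?powR_gt0.
have e1 : 0 < eps / C1 / 2 by rewrite !divr_gt0.
have [k0 tail] := tail_sum (ltW s0) ss' e1 cnt.
(* The first bound makes the tails small, the second each of the two terms of [rg] at most
   [delta / 2]. *)
pose k := Num.max k0%:R (ln (2 * C0 / delta)).
pose bad := [set g | G g /\ (gap g <= k \/ gap (invmx g) <= k \/ expR (mu g 0) <= T)].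
have badfin : finite_set bad.
  apply: (@sub_finite_set _ _ ([set g | G g /\ gap g <= k] `|`
     (invmx @` [set g | G g /\ gap g <= k] `|`
     [set g | G g /\ expR (mu g 0) <= Num.max T (T ^+ n.-1) /\
              expR (mu (invmx g) 0) <= Num.max T (T ^+ n.-1)]))).
    move=> g [Gg [gk|[gk|gT]]]; [by left|right; left|right; right].
      by exists (invmx g); rewrite ?invmxK//; split=> //; exact: (G_inv GP).
    have T0 : 0 <= T := le_trans (expR_ge0 (mu g 0)) gT.
    split; first exact: Gg.
    split; first by apply: le_trans gT _; rewrite le_max lexx.
    apply: le_trans (mu_inv_le GP (G_det GP Gg)) _.
    rewrite le_max; apply/orP; right.
    apply: lerXn2r gT; rewrite nnegrE; first exact: expR_ge0.
    exact: T0.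
  rewrite !finite_setU; split; first exact: gfin.
  split; [exact/finite_image/gfin|exact: (G_bounded_finite GP)].
have [Nb HNb] := finite_set_bounded (fun g => d o (g *m o)) badfin.
pose good := [set g | G g /\ ~ bad g].
pose rg g := C0 * (expR (- gap g) + expR (- gap (invmx g))).
have rg0 g : 0 <= rg g by rewrite mulr_ge0 ?(ltW C00)// addr_ge0 ?expR_ge0.
have goodP g : good g -> [/\ G g, k <= gap g, k <= gap (invmx g) & T <= expR (mu g 0)].
  by move=> [Gg nb]; split=> //; rewrite leNgt; apply/negP => H; apply: nb; split=> //;
    [left|right; left|right; right]; rewrite ltW.
have rgd g : good g -> rg g <= delta.
  move=> /goodP[_ g1 g2 _].
  have h x : k <= x -> C0 * expR (- x) <= delta / 2.
    move=> kx; have : ln (2 * C0 / delta) <= x by rewrite (le_trans _ kx)// le_max lexx orbT.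
    have q0 : 0 < 2 * C0 / delta by rewrite divr_gt0// mulr_gt0.
    rewrite -ler_expR lnK ?posrE// ler_pdivrMr// => L.
    rewrite expRN ler_pdivrMr ?expR_gt0// mulrAC ler_pdivlMr//.
    by rewrite mulrC (mulrC delta).
  by rewrite /rg mulrDr [leRHS]splitr lerD ?h.
(* The cover is indexed by [nat] through the injection [f]; a code of no good element gets the empty
   set and radius [0]. *)
pose valid i := `[< exists g, good g /\ f g = i >].
pose gi i := xget 0 [set g | good g /\ f g = i].
have giP i : valid i -> good (gi i) /\ f (gi i) = i.
  by move=> /asboolP H; exact: (xgetPex 0 H).
have giE g i : good g -> f g = i -> g = gi i.
  move=> gg fg; have [g1 g2] : good (gi i) /\ f (gi i) = i.
    by apply: giP; apply/asboolP; exists g.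
  by apply: finj; rewrite ?inE ?fg ?g2//; [case: gg|case: g1].
exists (fun i => [set q | exists g, [/\ good g, f g = i & shadow Om C o D g q]]).
exists (fun i => if valid i then rg (gi i) else 0); split.
(* The element found moves [o] farther than any bad one does, so it is good. *)
- move=> q xq; have [g [Gg sg Ng]] := HD q Nb xq.
  have gg : good g by split=> // /HNb; rewrite leNgt Ng.
  by exists (f g) => //; exists g.
- move=> i; case: ifP => [/giP[gg _]|_]; last by rewrite lexx ltW.
  by rewrite rg0 rgd.
- move=> i q q' [g [gg fg sq]] [g' [gg' fg' sq']].
  have gE := giE _ _ gg fg; have gE' := giE _ _ gg' fg'.
  rewrite ifT; last by apply/asboolP; exists g.
  rewrite gE' -gE in sq'; rewrite -gE.
  by have [Gg _ _ gT] := goodP _ gg; exact: (dia _ _ _ Gg gT).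
move=> N.
pose l := [seq gi i | i <- iota 0 N & valid i].
have ul : uniq l.
  rewrite map_inj_in_uniq ?filter_uniq ?iota_uniq// => i j.
  rewrite !mem_filter => /andP[vi _] /andP[vj _] E.
  by have [_ <-] := giP i vi; have [_ <-] := giP j vj; rewrite E.
have lg g : g \in l -> good g.
  by move=> /mapP[i]; rewrite mem_filter => /andP[vi _] ->; case: (giP i vi).
have -> : \sum_(i < N) (if valid i then rg (gi i) else 0) `^ s = \sum_(g <- l) rg g `^ s.
  rewrite -(big_mkord xpredT (fun i => (if valid i then rg (gi i) else 0) `^ s)).
  rewrite /index_iota subn0 big_map big_filter [RHS]big_mkcond /=.
  by apply: eq_bigr => i _; case: ifP => // _; rewrite powR0// gt_eqF.
apply: (@le_trans _ _ (\sum_(g <- l) (C1 * (expR (- (s * gap g)) + expR (- (s * gap (invmx g))))))).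
  apply: ler_sum => g _; rewrite /rg powRM ?(ltW C00) ?addr_ge0 ?expR_ge0//.
  rewrite /C1 -mulrA ler_wpM2l ?powR_ge0//.
  apply: le_trans (powR_add_le s0 (expR_ge0 _) (expR_ge0 _)) _.
  apply: ler_wpM2l; first exact: powR_ge0.
  by apply: lerD; rewrite powR_expR mulrN.
rewrite -mulr_sumr big_split /= mulrC -ler_pdivlMr//.
have t1 : \sum_(g <- l) expR (- (s * gap g)) <= eps / C1 / 2.
  apply: tail => // g /lg/goodP[Gg g1 _ _]; split=> //.
  by rewrite (le_trans _ g1)// le_max lexx.
(* Inversion is injective and preserves [G], so the gaps of the inverses obey the same tail
   estimate. *)
have t2 : \sum_(g <- l) expR (- (s * gap (invmx g))) <= eps / C1 / 2.
  rewrite -(big_map invmx xpredT (fun g => expR (- (s * gap g)))); apply: tail.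
    by rewrite map_inj_uniq//; exact: (can_inj invmxK).
  move=> _ /mapP[g /lg/goodP[Gg _ g1 _] ->]; split; first exact: (G_inv GP).
  by rewrite (le_trans _ g1)// le_max lexx.
by apply: le_trans (lerD t1 t2) _; rewrite -splitr.
Qed.

Theorem upper_bound :
  (hausdorff_dim (@dsym R n) (xi_sym_image Om C) <= delta12 G)%E.
Proof.
have d0 : (0 <= delta12 G)%E by apply: crit_exp_ge0; exists 1%:M; exact: (G_one GP).
case E : (delta12 G) d0 => [x| |] //=; rewrite ?leey// lee_fin => x0.
apply/lee_addgt0Pr => e e0; rewrite -EFinD.
apply: ereal_inf_lbound; exists (x + e) => //; split; first by rewrite ltr_wpDl.
apply: upper_null; first by rewrite ltr_wpDl.
by rewrite E lte_fin ltrDl.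
Qed.

End UpperBound.

Unset Implicit Arguments. Set Strict Implicit. Set Printing Implicit Defensive.

Theorem theorem1p1 (R : realType) (n : nat) (Gamma : set 'M[R]_n)
    (Om C : set 'cV[R]_n) :
  strongly_proj_convex_cocompact Gamma Om C ->
  (2%:E * delta1n Gamma <= hausdorff_dim (@dsym R n) (xi_sym_image Om C)
     <= delta12 Gamma)%E.
Proof. by move=> GP; rewrite (lower_bound GP) (upper_bound GP). Qed.
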